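(* Assume that $X$ is a rearrangement-invariant (r.i.) space over $\mathbb{R}^n$ and $\gamma\in(0,n)$. Then the following statements are equivalent: (a) $T_{\frac\gamma n}\colon X(0,\infty)\to X(0,\infty)$; (b) there exists a positive constant $C$ such that $$\sup_{h\sim f,\ h\ge0}\left\|\int_t^\infty h(s)s^{\frac\gamma n-1}\,ds\right\|_{X'(0,\infty)}\le C\left\|\int_t^\infty f^*(s)s^{\frac\gamma n-1}\,ds\right\|_{X'(0,\infty)},\qquad f\in\mathcal{M}_+(\mathbb{R}^n),$$ where the supremum is over all $h\in\mathcal{M}_+(0,\infty)$ equimeasurable with $f$.
   Context: Let $R$ be $\mathbb{R}^n$ or $(0,\infty)$ with Lebesgue measure $\mu$. $\mathcal{M}(R)$ is the set of measurable functions on $R$ with values in $[-\infty,\infty]$ and $\mathcal{M}_+(R)$ the set of nonnegative ones. For $f\in\mathcal{M}(R)$, $f^*(t)=\inf\{\lambda\in(0,\infty):\mu(\{|f|>\lambda\})\le t\}$. Functions $f,g$ on possibly different measure spaces are equimeasurable, written $f\sim g$, if $f^*=g^*$ on $(0,\infty)$. An r.i. norm on $R$ is a functional $\varrho\colon\mathcal{M}_+(R)\to[0,\infty]$ such that for all $f,g,f_j\in\mathcal{M}_+(R)$ and $\lambda\ge0$: (P1) $\varrho(f)=0$ iff $f=0$ a.e., $\varrho(\lambda f)=\lambda\varrho(f)$, $\varrho(f+g)\le\varrho(f)+\varrho(g)$; (P2) $f\le g$ a.e. implies $\varrho(f)\le\varrho(g)$; (P3) $f_j\nearrow f$ a.e.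 implies $\varrho(f_j)\nearrow\varrho(f)$; (P4) $\varrho(\chi_E)<\infty$ whenever $\mu(E)<\infty$; (P5) if $\mu(E)<\infty$, then $\int_Ef\,d\mu\le C_E\varrho(f)$ with a constant $C_E$ independent of $f$; (P6) $\varrho(f)=\varrho(g)$ whenever $f^*=g^*$. The r.i. space determined by $\varrho$ is $X(\varrho)=\{f\in\mathcal{M}(R):\varrho(|f|)<\infty\}$, with $\|f\|_{X(\varrho)}=\varrho(|f|)$. The associate norm of $\varrho$ is $\varrho'(g)=\sup\{\int_Rfg\,d\mu: f\in\mathcal{M}_+(R),\ \varrho(f)\le1\}$; for $X=X(\varrho)$ the associate space is $X'=X(\varrho')$. For an r.i. space $X$ over $\mathbb{R}^n$, $X(0,\infty)$ denotes its representation space, the unique r.i. space over $(0,\infty)$ with $\|f\|_X=\|f^*\|_{X(0,\infty)}$ for all $f$; $X'(0,\infty)$ is the representation space of $X'$. $T\colon X\to Y$ means there is $C>0$ with $\|Tf\|_Y\le C\|f\|_X$ for all $f\in X$. For $\alpha\ge0$ the supremum operator is $T_\alpha f(t)=t^{-\alpha}\sup_{t\le s<\infty}s^\alpha f^*(s)$, $t\in(0,\infty)$, $f\in\mathcal{M}(0,\infty)$. *)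

(* Defs.v *)
(** Throughout, the measure space underlying a function space is a measurable
    set [D] of [T] with the measure [mu]: functions on it are total functions
    [f : T -> \bar R] whose values off [D] never matter. *)
From HB Require Import structures.
From mathcomp Require Import all_boot all_order all_algebra.
From mathcomp Require Import all_classical all_reals all_analysis.
From mathcomp Require Import measurable_realfun lebesgue_integral_fubini.
Import Order.TTheory GRing.Theory Num.Theory.
Import numFieldNormedType.Exports.

Set Implicit Arguments.
Unset Strict Implicit.
Unset Printing Implicit Defensive.

Local Open Scope classical_set_scope.
Local Open Scope ring_scope.
Local Open Scope ereal_scope.

Section measurable_functions.
Context d (T : measurableType d) (R : realType) (D : set T).

Definition meas_funs : set (T -> \bar R) :=
  [set f : T -> \bar R | measurable_fun D f].

Definition nonneg_meas_funs : set (T -> \bar R) :=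
  [set f : T -> \bar R | measurable_fun D f /\ (forall x, D x -> 0 <= f x)].

End measurable_functions.

Section rearrangement.
Context d (T : measurableType d) (R : realType).
Variables (mu : {measure set T -> \bar R}) (D : set T).

(** [+oo] when no [l] qualifies, being the infimum of the empty set. *)
Definition rearr (f : T -> \bar R) (t : R) : \bar R :=
  ereal_inf [set l%:E | l in
    [set l : R | (0 < l)%R /\ mu (D `&` [set x | l%:E < `|f x|]) <= t%:E]].

End rearrangement.

Definition equimeasurable d1 (T1 : measurableType d1) d2
    (T2 : measurableType d2) (R : realType)
    (mu1 : {measure set T1 -> \bar R}) (D1 : set T1)
    (mu2 : {measure set T2 -> \bar R}) (D2 : set T2)
    (f : T1 -> \bar R) (g : T2 -> \bar R) : Prop :=
  forall t : R, (0 < t)%R -> rearr mu1 D1 f t = rearr mu2 D2 g t.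

Section ri_norm.
Context d (T : measurableType d) (R : realType).
Variables (mu : {measure set T -> \bar R}) (D : set T).
Local Notation Mp := (@nonneg_meas_funs d T R D).

(** The product [0 * +oo] is [0] in [\bar R]. *)
Record ri_norm (rho : (T -> \bar R) -> \bar R) : Prop := {
  ri_norm_ge0 : forall f, Mp f -> 0 <= rho f ;
  ri_norm_eq0 : forall f, Mp f ->
    (rho f = 0 <-> {ae mu, forall x, D x -> f x = 0}) ;
  ri_normZ : forall f (l : R), Mp f -> (0 <= l)%R ->
    rho (fun x => l%:E * f x) = l%:E * rho f ;
  ri_normD : forall f g, Mp f -> Mp g ->
    rho (fun x => f x + g x) <= rho f + rho g ;
  ri_norm_le : forall f g, Mp f -> Mp g ->
    {ae mu, forall x, D x -> f x <= g x} -> rho f <= rho g ;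
  ri_norm_fatou : forall (f_ : (T -> \bar R)^nat) f,
    (forall j, Mp (f_ j)) -> Mp f ->
    {ae mu, forall x, D x ->
      nondecreasing_seq (f_ ^~ x) /\ f_ ^~ x @ \oo --> f x} ->
    nondecreasing_seq (rho \o f_) /\ rho \o f_ @ \oo --> rho f ;
  ri_norm_indic : forall E, measurable E -> E `<=` D -> mu E < +oo ->
    rho (EFin \o \1_E) < +oo ;
  ri_norm_integral : forall E, measurable E -> E `<=` D -> mu E < +oo ->
    exists2 C : R, (0 < C)%R &
      forall f, Mp f -> \int[mu]_(x in E) f x <= C%:E * rho f ;
  ri_norm_equimeasurable : forall f g, Mp f -> Mp g ->
    equimeasurable mu D mu D f g -> rho f = rho g
}.

Definition ri_space_norm (rho : (T -> \bar R) -> \bar R) (f : T -> \bar R) :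
  \bar R := rho (fun x => `|f x|).

Definition ri_space (rho : (T -> \bar R) -> \bar R) : set (T -> \bar R) :=
  [set f | meas_funs D f /\ ri_space_norm rho f < +oo].

Definition associate_norm (rho : (T -> \bar R) -> \bar R) (g : T -> \bar R) :
  \bar R :=
  ereal_sup [set \int[mu]_(x in D) (f x * g x) | f in
    [set f | Mp f /\ rho f <= 1]].

End ri_norm.

Definition bounded_operator d1 (T1 : measurableType d1) d2
    (T2 : measurableType d2) (R : realType) (D1 : set T1)
    (rho1 : (T1 -> \bar R) -> \bar R) (rho2 : (T2 -> \bar R) -> \bar R)
    (A : (T1 -> \bar R) -> (T2 -> \bar R)) : Prop :=
  exists2 C : R, (0 < C)%R &
    forall f, ri_space D1 rho1 f ->
      ri_space_norm rho2 (A f) <= C%:E * ri_space_norm rho1 f.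

(** The product of the Borel measures on R and on R^n, carried to R^(n.+1). *)
Section lebesgue_tuple_succ.
Context {R : realType} (n : nat).
Local Notation bR := (measurableTypeR R).
Variable m : {sigma_finite_measure set (n.-tuple bR) -> \bar R}.

Definition cons_pair (p : bR * n.-tuple bR) : n.+1.-tuple bR :=
  [tuple of p.1 :: p.2].

Lemma measurable_cons_pair : measurable_fun [set: bR * n.-tuple bR] cons_pair.
Proof. exact: (measurable_cons measurable_fst measurable_snd). Qed.

Definition lebesgue_tuple_succ : set (n.+1.-tuple bR) -> \bar R :=
  pushforward (lebesgue_measure \x m) cons_pair.

Let mu0 : lebesgue_tuple_succ set0 = 0.
Proof. by rewrite /lebesgue_tuple_succ /pushforward preimage_set0 measure0. Qed.

Let measurable_preimage_cons A : measurable A -> measurable (cons_pair @^-1` A).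
Proof.
by move=> mA; rewrite -[X in measurable X]setTI; exact: measurable_cons_pair.
Qed.

Let mu_ge0 A : 0 <= lebesgue_tuple_succ A.
Proof. by rewrite /lebesgue_tuple_succ /pushforward; exact: measure_ge0. Qed.

Let mu_sigma_additive : semi_sigma_additive lebesgue_tuple_succ.
Proof.
move=> F mF tF mUF; rewrite /lebesgue_tuple_succ /pushforward preimage_bigcup.
apply: measure_semi_sigma_additive.
- by move=> k; exact: measurable_preimage_cons.
- apply/trivIsetP => /= i j _ _ ij; rewrite -preimage_setI.
  by move/trivIsetP : tF => /(_ _ _ _ _ ij) -> //; rewrite preimage_set0.
- by rewrite -preimage_bigcup; exact: measurable_preimage_cons.
Qed.

HB.instance Definition _ := isMeasure.Build _ _ _ lebesgue_tuple_succ
  mu0 mu_ge0 mu_sigma_additive.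

Let mu_sigma_finite : sigma_finite setT lebesgue_tuple_succ.
Proof.
have /sigma_finiteP[F [TF ndF Foo]] := sigma_finiteT (@lebesgue_measure R).
have /sigma_finiteP[G [TG ndG Goo]] := sigma_finiteT m.
pose uncons (t : n.+1.-tuple bR) : bR * n.-tuple bR :=
  (thead t, [tuple of behead t]).
have measurable_uncons : measurable_fun [set: n.+1.-tuple bR] uncons.
  apply/measurable_fun_pairP; split; first exact: measurable_tnth.
  exact: measurable_behead.
have cons_pairK : uncons \o cons_pair = id.
  apply/funext => -[x t]; rewrite /uncons /cons_pair /= theadE; congr pair.
  exact/val_inj.
exists (fun k => uncons @^-1` (F k `*` G k)).
  rewrite -preimage_bigcup (_ : \bigcup_k _ = setT) ?preimage_setT//.
  apply/seteqP; split=> // -[x y] _.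
  have [i _ Fix] : (\bigcup_i F i) x by rewrite -TF.
  have [j _ Gjy] : (\bigcup_i G i) y by rewrite -TG.
  exists (maxn i j) => //; split => /=.
    exact: (subsetPset _ _ (ndF _ _ (leq_maxl i j))) Fix.
  exact: (subsetPset _ _ (ndG _ _ (leq_maxr i j))) Gjy.
move=> k; have [mF Fk] := Foo k; have [mG Gk] := Goo k; split.
  rewrite -[X in measurable X]setTI; apply: measurable_uncons => //.
  exact: measurableX.
rewrite /lebesgue_tuple_succ /pushforward -comp_preimage cons_pairK preimage_id.
by rewrite product_measure1E// lte_mul_pinfty// ge0_fin_numE.
Qed.

HB.instance Definition _ := Measure_isSigmaFinite.Build _ _ _
  lebesgue_tuple_succ mu_sigma_finite.

End lebesgue_tuple_succ.

Fixpoint borel_lebesgue_tuple (R : realType) (n : nat) :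
    {sigma_finite_measure set (n.-tuple (measurableTypeR R)) -> \bar R} :=
  match n with
  | 0%N => \d_([tuple] : 0.-tuple (measurableTypeR R))
  | m.+1 => lebesgue_tuple_succ (borel_lebesgue_tuple R m)
  end.

(** The completion: its measurable sets are the Lebesgue-measurable ones. *)
Definition Rn_lebesgue (R : realType) (n : nat) :=
  @completed_measure_extension _ _ _ (borel_lebesgue_tuple R n).
HB.instance Definition _ (R : realType) (n : nat) :=
  Measure.on (@Rn_lebesgue R n).

Notation Rn_type R n :=
  (caratheodory_type (measure_extension.mu_ext (borel_lebesgue_tuple R n))).

Notation R1_type R :=
  (caratheodory_type (measure_extension.mu_ext (@wlength R idfun))).

Definition halfline (R : realType) : set (R1_type R) := `]0%R, +oo[.

(** Such a [rhobar] is unique up to its values off [nonneg_meas_funs], which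
    are irrelevant. *)
Definition representation_norm (R : realType) (n : nat)
    (rho : (Rn_type R n -> \bar R) -> \bar R)
    (rhobar : (R1_type R -> \bar R) -> \bar R) : Prop :=
  ri_norm (@completed_lebesgue_measure R) (@halfline R) rhobar /\
  forall f, meas_funs setT f ->
    ri_space_norm rho f = ri_space_norm rhobar (rearr (@Rn_lebesgue R n) setT f).

Definition sup_operator (R : realType) (alpha : R) (f : R1_type R -> \bar R) :
    R1_type R -> \bar R :=
  fun t : R => (t `^ (- alpha))%:E *
    ereal_sup [set (s `^ alpha)%:E *
                     rearr (@completed_lebesgue_measure R) (@halfline R) f s
              | s in [set s : R | (t <= s)%R]].

Definition weighted_tail (R : realType) (beta : R) (h : R1_type R -> \bar R) :
    R1_type R -> \bar R :=
  fun t : R => \int[@completed_lebesgue_measure R]_(s in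
    [set s : R | (t < s)%R]) (h s * ((s : R) `^ beta)%:E).

(* Main.v *)
Require Import Defs.
From HB Require Import structures.
From mathcomp Require Import all_boot all_order all_algebra all_fingroup.
From mathcomp Require Import all_classical all_reals all_analysis.
From mathcomp Require Import measurable_realfun lebesgue_integral_fubini.
From mathcomp Require Import ring lra.
Import Order.TTheory GRing.Theory Num.Theory.
Import numFieldNormedType.Exports.

(** Write [al] for [gamma / n], which lies in [(0, 1)], [fr] for the
    rearrangement of [f], [Hh] for the tail integral
    [\int_t^oo h s `^ (al - 1) ds], and, for a nonincreasing [g] on the
    half-line, [avg g t = t `^ (al - 1) \int_0^t g], whose least nonincreasing
    majorant is [S g s = sup_(t >= s) avg g t]. By Tonelli's theorem
    [\int g Hh = \int h (avg g)] ([weighted_tail_dual]). Two facts link [S] with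
    the supremum operator [T]: [S g <= C avg (T g)] ([sup_avg_le_supop]) and
    [\int_0^a T g <= C a `^ (1 - al) S g a] ([prim_supop_le]); both rest on the
    integrability of [t `^ (- al)] at the origin.

    If [T] is bounded on [X], test the norm of [Hh] in [X'] on a nonincreasing
    [g] of norm at most 1. Then, by the Hardy-Littlewood inequality
    ([hardy_littlewood]), with [f] equimeasurable with [h],
      [\int g Hh = \int h (avg g) <= \int h (S g) <= \int fr (S g)
                <= C \int fr (avg (T g)) = C \int (T g) (H fr)],
    which is at most [C ||T g||_X ||H fr||_X'] ([bounded_sup_operator_tail]).

    Conversely, it suffices to bound a step function [G] below [T g]
    ([norm_le_dyadic]). On the steps of a fixed grid the norm of [X] is a
    sublinear functional in finitely many variables, so that some [Phi] norms
    [G]: [\int Phi G = ||G||_X], and [\int Phi x <= ||x||_X] for all nonnegative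
    steps [x] ([norming_step]). Sorting makes [Phi] nonincreasing; averaging over the cells
    does not increase the norm ([averaging_norm]), which yields
    [||Phi||_X' <= 1] ([dual_step_norm]). This finite-dimensional duality takes
    the place of the equality of [X] with its second associate. Now write
    [Phi = \sum_j c_j 1_(0, a_j)] and spread the masses differently:
    [f = \sum_j c_j a_j `^ (- al) 1_(0, a_j)] satisfies [H f <= Phi / al]
    ([weighted_tail_stairs]). The function [avg g] varies slowly, so that the
    cells of [f] can be moved to distinct cells on which [avg g] is comparable
    with [S g] ([separated_cells]). The hypothesis, applied to [f] and to the
    rearranged function [h], gives
      [\sum_j c_j a_j `^ (1 - al) S g a_j <= C \int h (avg g) = C \int g Hh
         <= C' ||g||_X ||H f||_X' <= C'' ||g||_X],
    and the left-hand side dominates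
    [\sum_j c_j \int_0^(a_j) T g >= \int Phi G = ||G||_X]
    ([supop_dyadic_norm_le]).

    The half-line and the Euclidean space exchange nonincreasing functions by
    composition with [vol], which pushes the measure of the space to that of
    the half-line ([uniform_vol]). *)

Set Implicit Arguments.
Unset Strict Implicit.
Unset Printing Implicit Defensive.

Local Open Scope classical_set_scope.
Local Open Scope ring_scope.

(** * Norming functionals in finite dimension *)

Section sublinear.
Variables (R : realType) (V : lmodType R).
Implicit Types (p q : V -> R) (u v x y : V).

Definition sublinear p :=
  (forall x y, p (x + y) <= p x + p y) /\ (forall c x, 0 <= c -> p (c *: x) <= c * p x).

Lemma sublinear0 p : sublinear p -> p 0 = 0.
Proof.
move=> [pD pZ]; apply/eqP; rewrite eq_le; apply/andP; split.
  by have := pZ 0 0 (lexx 0); rewrite scale0r mul0r.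
by have := pD 0 0; rewrite addr0 -lerBlDr subrr.
Qed.

Lemma sublinearN p x : sublinear p -> - p (- x) <= p x.
Proof.
move=> sp; have := sp.1 x (- x); rewrite subrr (sublinear0 sp).
by lra.
Qed.

Lemma sublinear_sum p (I : Type) (r : seq I) (F : I -> V) : sublinear p ->
  p (\sum_(i <- r) F i) <= \sum_(i <- r) p (F i).
Proof.
move=> sp; elim: r => [|i r IHr]; first by rewrite !big_nil (sublinear0 sp).
by rewrite !big_cons; apply: le_trans (sp.1 _ _) _; rewrite lerD2l.
Qed.

(** The slope of [p] at infinity in the direction [v]: a smaller sublinear
    functional, which is linear along [v] and stays below [- p v] at [- v].
    Iterating over a basis linearizes [p] in finitely many steps. *)
Definition tilt p v x : R := inf [set p (x + t *: v) - t * p v | t in [set t : R | 0 <= t]].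

Section tilt.
Variables (p : V -> R) (v : V).
Hypothesis sp : sublinear p.

Let tilt_lb x : lbound [set p (x + t *: v) - t * p v | t in [set t : R | 0 <= t]] (- p (- x)).
Proof.
move=> _ /= [t t0 <-]; have [pD pZ] := sp.
have tpv : t * p v <= p (t *: v).
  move: t0; rewrite le_eqVlt => /predU1P[<-|t0].
    by rewrite scale0r mul0r (sublinear0 sp).
  have := pZ t^-1 (t *: v); rewrite scalerA mulVf ?gt_eqF// scale1r.
  by rewrite invr_ge0 (ltW t0) mulrC ler_pdivlMr// mulrC; exact.
by have := pD (x + t *: v) (- x); rewrite addrAC subrr add0r; lra.
Qed.

Lemma tilt_le_at x t : 0 <= t -> tilt p v x <= p (x + t *: v) - t * p v.
Proof.
by move=> t0; apply: inf_lbound; [exists (- p (- x)); exact: tilt_lb|exists t].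
Qed.

Lemma le_tilt x c : (forall t, 0 <= t -> c <= p (x + t *: v) - t * p v) -> c <= tilt p v x.
Proof.
move=> h; apply: lb_le_inf; last by move=> _ /= [t t0 <-]; exact: h.
by exists (p (x + 0 *: v) - 0 * p v); exists 0 => //=.
Qed.

Lemma tilt_le x : tilt p v x <= p x.
Proof. by have := tilt_le_at x (lexx 0); rewrite scale0r addr0 mul0r subr0. Qed.

Lemma tiltN : tilt p v (- v) <= - p v.
Proof.
by have := tilt_le_at (- v) ler01; rewrite scale1r addNr (sublinear0 sp) mul1r sub0r.
Qed.

Lemma sublinear_tilt : sublinear (tilt p v).
Proof.
have [pD pZ] := sp; split=> [x y|c x].
  rewrite -lerBlDl; apply: le_tilt => t t0; rewrite lerBlDl -lerBlDr.
  apply: le_tilt => s s0; rewrite lerBlDr.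
  apply: le_trans (tilt_le_at _ (addr_ge0 s0 t0)) _.
  have -> : x + y + (s + t) *: v = (x + s *: v) + (y + t *: v).
    by rewrite scalerDl addrACA.
  by have := pD (x + s *: v) (y + t *: v); rewrite mulrDl; lra.
rewrite le_eqVlt => /predU1P[<-|c0].
  by rewrite scale0r mul0r; apply: le_trans (tilt_le 0) _; rewrite (sublinear0 sp).
rewrite mulrC -ler_pdivrMr//; apply: le_tilt => t t0; rewrite ler_pdivrMr//.
have ct0 : 0 <= c * t by rewrite mulr_ge0// ltW.
apply: le_trans (tilt_le_at _ ct0) _.
rewrite mulrBl -scalerA -scalerDr [t * _ * _]mulrAC (mulrC t) lerD2r mulrC.
exact: pZ (ltW c0).
Qed.

End tilt.

(** Being linear along [e] means [q e + q (- e) <= 0], an inequality that smaller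
    sublinear functionals inherit; hence each tilt keeps what the previous ones
    achieved. *)
Lemma sublinear_linearize p (L : seq V) : sublinear p -> exists q,
  [/\ sublinear q, forall x, q x <= p x & forall e, e \in L -> q e + q (- e) <= 0].
Proof.
elim: L p => [|e L IHL] p sp; first by exists p; split.
have [q [sq qp qL]] := IHL _ (sublinear_tilt e sp).
exists q; split=> //; first by move=> x; apply: le_trans (qp x) (tilt_le e sp x).
move=> f; rewrite inE => /predU1P[->|]; last exact: qL.
have := lerD (le_trans (qp e) (tilt_le e sp e)) (le_trans (qp (- e)) (tiltN e sp)).
by rewrite subrr.
Qed.

End sublinear.

(** The first tilt is along [v] itself: it forces the value [p v] at [v] on every
    functional below it. *)
Lemma norming_functional (R : realType) (N : nat) (p : ('I_N -> R) -> R) (v : 'I_N -> R) :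
  (forall x y, p (fun i => x i + y i) <= p x + p y) ->
  (forall c x, 0 <= c -> p (fun i => c * x i) <= c * p x) ->
  exists2 phi : 'I_N -> R, (forall x, \sum_i phi i * x i <= p x) &
    p v <= \sum_i phi i * v i.
Proof.
move=> pD pZ; pose V : lmodType R := 'rV[R]_N.
pose P (x : V) := p (fun i => x ord0 i).
have sP : sublinear P.
  split=> [x y|c x c0]; rewrite /P.
    by rewrite (_ : (fun i => _) = (fun i => x ord0 i + y ord0 i))//; apply/funext => i; rewrite mxE.
  by rewrite (_ : (fun i => _) = (fun i => c * x ord0 i)) ?pZ//; apply/funext => i; rewrite mxE.
pose v' : V := \row_i v i.
have [q [sq qP qL]] := sublinear_linearize
  [seq delta_mx ord0 i | i <- enum 'I_N] (sublinear_tilt v' sP).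
have [qD qZ] := sq.
pose phi i := q (delta_mx ord0 i).
have phi_le (x : V) : \sum_i phi i * x ord0 i <= q x.
  rewrite -lerN2; apply: le_trans (_ : q (- x) <= _); last first.
    rewrite [x in q (- x)]row_sum_delta -sumrN; apply: le_trans (sublinear_sum _ _ sq) _.
    rewrite -sumrN ler_sum// => i _; rewrite -scaleNr.
    have [x0|x0] := leP (x ord0 i) 0.
      rewrite -mulrN mulrC; apply: qZ; by rewrite oppr_ge0.
    rewrite scaleNr -scalerN; apply: le_trans (qZ _ _ (ltW x0)) _.
    rewrite mulrC -mulNr ler_pM2r// -subr_le0 opprK addrC; apply: qL.
    by apply/mapP; exists i => //; rewrite mem_enum.
  by rewrite lerNl; have := sublinearN x sq.
exists phi => [x|].
  have := phi_le (\row_i x i).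
  under eq_bigr do rewrite mxE.
  move/le_trans; apply; apply: le_trans (qP _) _; apply: le_trans (tilt_le _ sP _) _.
  by rewrite /P (_ : (fun i => _) = x)//; apply/funext => i; rewrite mxE.
have := le_trans (phi_le (- v')) (le_trans (qP _) (tiltN v' sP)).
under eq_bigr do rewrite !mxE mulrN.
rewrite sumrN lerN2; apply: le_trans.
by rewrite /P (_ : (fun i => _) = v)//; apply/funext => i; rewrite mxE.
Qed.

(** Among the permutations maximizing [\sum_i phi (s i) * G i], one that also
    maximizes the same sum for strictly decreasing weights sorts [phi]. *)
Lemma sort_functional (R : realType) (N : nat) (phi G : 'I_N -> R) :
  (forall i j : 'I_N, (i <= j)%N -> G j <= G i) ->
  exists s : {perm 'I_N}, (forall i j : 'I_N, (i <= j)%N -> phi (s j) <= phi (s i)) /\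
    \sum_i phi i * G i <= \sum_i phi (s i) * G i.
Proof.
move=> dG.
pose S (W : 'I_N -> R) (s : {perm 'I_N}) := \sum_i phi (s i) * W i.
have swap W (s : {perm 'I_N}) (i j : 'I_N) : i != j ->
    S W (tperm i j * s)%g - S W s = (phi (s j) - phi (s i)) * (W i - W j).
  move=> ij; rewrite /S -sumrB (bigD1 i)//= (bigD1 j) 1?eq_sym//= big1 => [|k].
    by rewrite !permM tpermL tpermR; ring.
  by move=> /andP[ki kj]; rewrite permM tpermD 1?eq_sym// subrr.
pose s0 := [arg max_(s > 1%g) S G s]%O.
have s0max s : S G s <= S G s0.
  by rewrite /s0; case: arg_maxP => //= t _ h; exact: h.
pose W (i : 'I_N) : R := (N - i)%:R.
pose s1 := [arg max_(s > s0 | S G s == S G s0) S W s]%O.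
have [s1E s1max] : S G s1 = S G s0 /\ forall s, S G s = S G s0 -> S W s <= S W s1.
  rewrite /s1; case: arg_maxP => //= t /eqP tE h; split=> // s /eqP sE; exact: h.
exists s1; split; last first.
  have := s0max 1%g; rewrite -s1E; apply: le_trans.
  by rewrite /S; under [leRHS]eq_bigr do rewrite perm1.
move=> i j ij; have [<-//|inj] := eqVneq i j; rewrite leNgt; apply/negP => lt.
have {}ij : (i < j)%N by rewrite ltn_neqAle ij andbT.
have E : S G (tperm i j * s1)%g = S G s0.
  apply/eqP; rewrite eq_le s0max/= -s1E -subr_ge0 swap// mulr_ge0 ?subr_ge0 ?(ltW lt)//.
  by apply: dG; exact: ltnW.
have := s1max _ E; rewrite -subr_le0 swap// leNgt mulr_gt0// subr_gt0//.
by rewrite ltr_nat ltn_sub2l.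
Qed.

Lemma abel_sum (R : realType) (N : nat) (phi x : nat -> R) : phi N = 0 ->
  \sum_(i < N) phi i * x i =
  \sum_(j < N) (phi j - phi j.+1) * \sum_(i < j.+1) x i.
Proof.
suff h M : \sum_(i < M) phi i * x i = phi M * (\sum_(i < M) x i) +
    \sum_(j < M) (phi j - phi j.+1) * \sum_(i < j.+1) x i.
  by move=> N0; rewrite h N0 mul0r add0r.
elim: M => [|M IHM]; first by rewrite !big_ord0 mulr0 addr0.
by rewrite big_ord_recr/= IHM [in RHS]big_ord_recr/= !big_ord_recr/=; ring.
Qed.

Local Open Scope ereal_scope.

(** * Distribution functions and rearrangements *)

Section distribution.
Context d (T : measurableType d) (R : realType).
Variables (mu : {measure set T -> \bar R}) (D : set T).
Hypothesis mD : measurable D.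

(** The distribution function of [|f|]. *)
Definition distr (f : T -> \bar R) (l : R) : \bar R :=
  mu (D `&` [set x | l%:E < `|f x|]).

Lemma measurable_superlevel (f : T -> \bar R) (l : R) :
  measurable_fun D f -> measurable (D `&` [set x | l%:E < f x]).
Proof. by move=> mf; apply: emeasurable_fun_o_infty. Qed.

Lemma measurable_abse_superlevel (f : T -> \bar R) (l : R) :
  measurable_fun D f -> measurable (D `&` [set x | l%:E < `|f x|]).
Proof. by move=> mf; apply: measurable_superlevel; exact: measurableT_comp. Qed.

Lemma ge0_distrE (f : T -> \bar R) (l : R) : (forall x, D x -> 0 <= f x) ->
  distr f l = mu (D `&` [set x | l%:E < f x]).
Proof.
move=> f0; congr (mu _); apply/seteqP; split=> x /= [Dx].
  by rewrite gee0_abs// f0.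
by rewrite gee0_abs// f0.
Qed.

Lemma distr_nincr (f : T -> \bar R) (l m : R) : measurable_fun D f ->
  (l <= m)%R -> distr f m <= distr f l.
Proof.
move=> mf lm; apply: le_measure; rewrite ?inE; try exact: measurable_abse_superlevel.
by move=> x /= [Dx mx]; split=> //; apply: le_lt_trans mx; rewrite lee_fin.
Qed.

(** Continuity from below of the measure: distribution functions are
    right-continuous. *)
Lemma distr_right (f : T -> \bar R) (m : R) (y : \bar R) : measurable_fun D f ->
  y < distr f m -> exists2 l : R, (m < l)%R & y < distr f l.
Proof.
move=> mf ym; apply: contrapT => nex.
suff : distr f m <= y by rewrite leNgt ym.
pose F k := D `&` [set x | (m + k.+1%:R^-1)%:E < `|f x|].
have UF : \bigcup_k F k = D `&` [set x | m%:E < `|f x|].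
  apply/seteqP; split=> [x [k _ [Dx /=]]|x /= [Dx mx]].
    by move=> h; split=> //=; apply: le_lt_trans h; rewrite lee_fin lerDl.
  have [r mr rx] : exists2 r : R, (m < r)%R & r%:E <= `|f x|.
    case: (`|f x|) mx => [r|_|//]; first by rewrite lte_fin => h; exists r.
    by exists (m + 1)%R; rewrite ?ltrDl ?leey.
  have /ltr_add_invr [k] := mr; rewrite addrC => hk.
  exists k => //; split=> //=; apply: lt_le_trans rx.
  by rewrite lte_fin addrC.
have mF k : measurable (F k) by exact: measurable_abse_superlevel.
have cF : (mu \o F) @ \oo --> distr f m.
  rewrite /distr -UF; apply: nondecreasing_cvg_mu => //.
    by rewrite UF; exact: measurable_abse_superlevel.
  move=> a b ab; apply/subsetPset => x /= [Dx h]; split=> //=.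
  apply: le_lt_trans h; rewrite lee_fin lerD2l lef_pV2 ?posrE//.
  by rewrite ler_nat ltnS.
rewrite -(cvg_lim _ cF)//; apply: lime_le; first by apply/cvg_ex; eexists; exact: cF.
near=> k; rewrite leNgt; apply/negP => h; apply: nex.
by exists (m + k.+1%:R^-1)%R; rewrite ?ltrDl.
Unshelve. all: by end_near. Qed.

(** Rearrangement and distribution function are inverse to each other in this
    Galois-like sense. The condition on the right is open in [t], which makes a
    rearrangement right-continuous. *)
Lemma lt_rearr (f : T -> \bar R) (m t : R) : measurable_fun D f -> (0 <= m)%R ->
  m%:E < rearr mu D f t <-> t%:E < distr f m.
Proof.
move=> mf m0; split=> [|tm].
  move=> h; rewrite ltNge; apply/negP => tm.
  suff : rearr mu D f t <= m%:E by rewrite leNgt h.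
  apply/lee_addgt0Pr => e e0; rewrite -EFinD; apply: ereal_inf_lbound => /=.
  exists (m + e)%R => //; split; first by rewrite ltr_wpDl.
  by apply: le_trans tm; apply: distr_nincr; rewrite ?lerDl ?ltW.
have [l ml tl] := distr_right mf tm.
apply: (@lt_le_trans _ _ l%:E); first by rewrite lte_fin.
apply: le_ereal_inf_tmp => _ /= [r [r0 rt] <-]; rewrite lee_fin leNgt; apply/negP => rl.
have := le_trans (distr_nincr mf (ltW rl)) rt.
by rewrite leNgt tl.
Qed.

Lemma rearr_ge0 (f : T -> \bar R) (t : R) : 0 <= rearr mu D f t.
Proof.
by apply: le_ereal_inf_tmp => _ /= [r [r0 _] <-]; rewrite lee_fin ltW.
Qed.

Lemma rearr_nincr (f : T -> \bar R) (s t : R) : (s <= t)%R ->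
  rearr mu D f t <= rearr mu D f s.
Proof.
move=> st; apply: ereal_inf_le_tmp; apply: image_subset => l [l0 ls]; split=> //.
by apply: le_trans ls _; rewrite lee_fin.
Qed.

Lemma abs_rearr (f : T -> \bar R) t : `|rearr mu D f t| = rearr mu D f t.
Proof. by rewrite gee0_abs// rearr_ge0. Qed.

End distribution.

Lemma rearr_distr d1 (T1 : measurableType d1) d2 (T2 : measurableType d2)
    (R : realType) (mu1 : {measure set T1 -> \bar R}) (D1 : set T1)
    (mu2 : {measure set T2 -> \bar R}) (D2 : set T2) f g :
  (forall l : R, (0 < l)%R -> distr mu1 D1 f l = distr mu2 D2 g l) ->
  rearr mu1 D1 f = rearr mu2 D2 g.
Proof.
move=> fg; apply/funext => t; congr (ereal_inf (_ @` _)).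
by apply/seteqP; split=> l /= [l0]; [rewrite -/(distr _ _ _ _) fg|
  rewrite -/(distr mu2 _ _ _) -fg].
Qed.

(** * Uniformly distributed maps onto the half-line *)

Notation lam := (@completed_lebesgue_measure _).

Section downsets.
Variable R : realType.

(** Downsets of the half-line are the superlevel sets of nonincreasing functions;
    they are totally ordered by inclusion and determined, up to a point, by
    their measure. *)
Definition downset (U : set R) := forall s t : R, (0 < s)%R -> (s <= t)%R ->
  U t -> U s.

Definition nincr (A : R1_type R -> \bar R) := forall s t : R, (0 < s)%R ->
  (s <= t)%R -> A t <= A s.

(** The supremum of the downset [U], hence its length. The value [0] is included
    for the empty downset. *)
Definition extent (U : set R) : \bar R :=
  ereal_sup [set t%:E | t in [set t | t = 0%R \/ (0 < t)%R /\ U t]].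

Lemma downset_superlevel (A : R1_type R -> \bar R) (y : \bar R) : nincr A ->
  downset [set t : R | y < A t].
Proof. by move=> nA s t s0 st /= /lt_le_trans; apply; apply: nA. Qed.

Lemma measurable_downset (U : set R) : downset U ->
  measurable ([set t : R | (0 < t)%R] `&` U).
Proof.
move=> dU; apply: is_interval_measurable => s t /= [s0 Us] [t0 Ut] u /andP[su ut].
have u0 : (0 < u)%R by apply: lt_le_trans su.
by split=> //; apply: dU Ut.
Qed.

End downsets.

Section uniform_map.
Context d (T : measurableType d) (R : realType).
Variables (mu : {measure set T -> \bar R}) (D : set T).
Hypothesis mD : measurable D.

(** [sigma] pushes [mu] to the Lebesgue measure of the half-line. Composition
    with [sigma] then transports nonincreasing functions from the half-line
    without changing their distribution. *)
Definition uniform_map (sigma : T -> R) :=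
  [/\ measurable_fun D sigma, forall x, D x -> (0 < sigma x)%R &
      forall t : R, (0 < t)%R -> mu (D `&` [set x | (sigma x < t)%R]) = t%:E].

Variable sigma : T -> R.
Hypothesis us : uniform_map sigma.

Lemma uniform_preimage (U : set R) :
  D `&` sigma @^-1` U = D `&` sigma @^-1` ([set t : R | (0 < t)%R] `&` U).
Proof.
case: us => _ s0 _; apply/seteqP; split=> x /= [Dx]; first by move=> Ux; split; auto.
by case.
Qed.

Lemma measurable_uniform_downset (U : set R) : downset U ->
  measurable (D `&` sigma @^-1` U).
Proof.
move=> dU; rewrite uniform_preimage; case: us => ms _ _.
exact: ms (measurable_downset dU).
Qed.

(** A downset lies between two initial intervals of almost equal length. *)
Lemma uniform_downset (U : set R) : downset U ->
  mu (D `&` sigma @^-1` U) = extent U.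
Proof.
move=> dU; case: (us) => ms s0 sE; apply/eqP; rewrite eq_le; apply/andP; split.
  case E : (extent U) => [b| |]; last 2 first.
    by rewrite leey.
    suff : 0 <= extent U by rewrite E leeNy_eq.
    by apply: ereal_sup_ubound; exists 0%R => //; left.
  have b0 : (0 <= b)%R.
    by rewrite -lee_fin -E; apply: ereal_sup_ubound; exists 0%R => //; left.
  apply/lee_addgt0Pr => e e0; rewrite -EFinD -sE; last by rewrite ltr_wpDl.
  apply: le_measure; rewrite ?inE.
  - exact: measurable_uniform_downset.
  - rewrite (_ : [set x | _] = sigma @^-1` `]-oo, (b + e)%R[).
      exact: ms.
    by apply/seteqP; split=> x /=; rewrite in_itv.
  - move=> x /= [Dx Ux]; split=> //; suff : (sigma x <= b)%R.
      by move=> /le_lt_trans; apply; rewrite ltrDl.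
    rewrite -lee_fin -E; apply: ereal_sup_ubound.
    by exists (sigma x) => //; right; split=> //; apply: s0.
apply: ge_ereal_sup => _ /= [t [->|[t0 Ut]] <-]; first exact: measure_ge0.
rewrite -sE//; apply: le_measure; rewrite ?inE.
- rewrite (_ : [set x | _] = sigma @^-1` `]-oo, t[); first exact: ms.
  by apply/seteqP; split=> x /=; rewrite in_itv.
- exact: measurable_uniform_downset.
- by move=> x /= [Dx xt]; split=> //; apply: dU (ltW xt) Ut; apply: s0.
Qed.

Lemma measurable_nincr_comp (A : R1_type R -> \bar R) : nincr A ->
  measurable_fun D (fun x => A (sigma x)).
Proof.
move=> nA; apply: (measurability (@ErealGenOInfty.G R)) => [|/= _ [_] [r] -> <-].
  exact: ErealGenOInfty.measurableE.
rewrite (_ : D `&` _ = D `&` sigma @^-1` [set t : R | r%:E < A t]).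
  exact/measurable_uniform_downset/downset_superlevel.
by apply/seteqP; split=> x /=; rewrite in_itv/= andbT.
Qed.

End uniform_map.

Section halfline.
Variable R : realType.
Local Notation HL := (@halfline R).

Lemma halflineE (t : R) : HL t = (0 < t)%R.
Proof. by rewrite /halfline /= in_itv/= andbT. Qed.

Lemma measurable_id_R1 : measurable_fun setT (id : R1_type R -> measurableTypeR R).
Proof. by move=> _ A mA; rewrite setTI; exact: sub_caratheodory. Qed.

Lemma measurable_R1 (A : set R) : measurable A -> measurable (A : set (R1_type R)).
Proof. by move=> mA; rewrite -[A]setTI; apply: measurable_id_R1. Qed.

Lemma measurable_halfline : measurable HL.
Proof. by apply: measurable_R1; exact: measurable_itv. Qed.

Lemma uniform_map_id : uniform_map lam HL (id : R1_type R -> R).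
Proof.
split.
- exact: measurable_funTS measurable_id_R1.
- by move=> x; rewrite halflineE.
- move=> t t0; rewrite (_ : _ `&` _ = [set` `]0%R, t[]); last first.
    by apply/seteqP; split=> x /=; rewrite halflineE in_itv/=; [case=> -> ->|move/andP].
  transitivity (@lebesgue_measure R [set` `]0%R, t[]); first by [].
  by rewrite lebesgue_measure_itv/= lte_fin t0 sube0.
Qed.

End halfline.

(** * Tonelli's theorem over a relation, and the layer cake formula *)

Section tonelli_rel.
Context d1 d2 (T1 : measurableType d1) (T2 : measurableType d2) (R : realType).
Variables (m1 : {sigma_finite_measure set T1 -> \bar R})
          (m2 : {sigma_finite_measure set T2 -> \bar R}).
Variables (D1 : set T1) (D2 : set T2) (E : set (T1 * T2)).
Hypotheses (mD1 : measurable D1) (mD2 : measurable D2) (mE : measurable E).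

(** With a relation in place of a kernel, the formula covers both the layer cake
    and the duality of tail integrals with primitives. *)
Lemma tonelli_rel (f1 : T1 -> \bar R) (f2 : T2 -> \bar R) :
  measurable_fun D1 f1 -> measurable_fun D2 f2 ->
  (forall x, D1 x -> 0 <= f1 x) -> (forall y, D2 y -> 0 <= f2 y) ->
  \int[m1]_(x in D1) (f1 x * \int[m2]_(y in D2 `&` [set y | E (x, y)]) f2 y) =
  \int[m2]_(y in D2) (f2 y * \int[m1]_(x in D1 `&` [set x | E (x, y)]) f1 x).
Proof.
move=> mf1 mf2 f10 f20.
pose g1 := f1 \_ D1; pose g2 := f2 \_ D2.
have g10 x : 0 <= g1 x by apply: erestrict_ge0.
have g20 x : 0 <= g2 x by apply: erestrict_ge0.
have mg1 : measurable_fun setT g1 by apply/(measurable_restrictT _ mD1).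
have mg2 : measurable_fun setT g2 by apply/(measurable_restrictT _ mD2).
have mI : measurable_fun setT (fun p => (\1_E p)%:E : \bar R).
  by apply/measurable_EFinP; exact: measurable_indic.
pose F (p : T1 * T2) := g1 p.1 * (g2 p.2 * (\1_E p)%:E).
have mF : measurable_fun setT F.
  apply: emeasurable_funM; first exact: measurableT_comp.
  by apply: emeasurable_funM => //; exact: measurableT_comp.
have I0 p : 0 <= (\1_E p)%:E :> \bar R by rewrite lee_fin.
have F0 p : 0 <= F p by rewrite !mule_ge0.
transitivity (\int[m1]_x \int[m2]_y F (x, y)).
  rewrite integral_mkcond; apply: eq_integral => x _.
  rewrite /F /= ge0_integralZl//; last 2 first.
  - apply: emeasurable_funM => //.
    exact: (measurableT_comp mI (measurable_pair1 _)).
  - by move=> y _; rewrite mule_ge0.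
  rewrite [LHS]/patch /g1 [in RHS]/patch; case: ifPn => // xD; last by rewrite mul0e.
  congr (_ * _); rewrite [LHS]integral_mkcond; apply: eq_integral => y _.
  rewrite /g2 /patch indicE in_setI.
  case: (y \in D2) => /=; last by rewrite mul0e.
  rewrite (_ : (y \in _) = ((x, y) \in E)); last by apply/idP/idP; rewrite !inE.
  by case: (_ \in E); rewrite ?mule1 ?mule0.
rewrite (fubini_tonelli F mF F0).
rewrite [RHS]integral_mkcond; apply: eq_integral => y _.
under eq_integral do rewrite /F /= muleCA.
rewrite ge0_integralZl//; last 2 first.
- apply: emeasurable_funM => //.
  exact: (measurableT_comp mI (measurable_pair2 _)).
- by move=> x _; rewrite mule_ge0.
rewrite [RHS]/patch /g2 [in LHS]/patch; case: ifPn => // yD; last by rewrite mul0e.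
congr (_ * _); rewrite [RHS]integral_mkcond; apply: eq_integral => x _.
rewrite /g1 /patch indicE in_setI.
case: (x \in D1) => /=; last by rewrite mul0e.
rewrite (_ : (x \in [set _ | _]) = ((x, y) \in E)); last by apply/idP/idP; rewrite !inE.
by case: (_ \in E); rewrite ?mule1 ?mule0.
Qed.

Lemma measurable_rel_section (f2 : T2 -> \bar R) :
  measurable_fun D2 f2 -> (forall y, D2 y -> 0 <= f2 y) ->
  measurable_fun setT (fun x => \int[m2]_(y in D2 `&` [set y | E (x, y)]) f2 y).
Proof.
move=> mf2 f20; pose g2 := f2 \_ D2.
have g20 x : 0 <= g2 x by apply: erestrict_ge0.
have mg2 : measurable_fun setT g2 by apply/(measurable_restrictT _ mD2).
have mI : measurable_fun setT (fun p => (\1_E p)%:E : \bar R).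
  by apply/measurable_EFinP; exact: measurable_indic.
pose F (p : T1 * T2) := g2 p.2 * (\1_E p)%:E.
have := @measurable_fun_fubini_tonelli_F _ _ _ _ _ m2 F.
rewrite (_ : fubini_F m2 F =
  (fun x => \int[m2]_(y in D2 `&` [set y | E (x, y)]) f2 y)); first apply.
- by apply: emeasurable_funM => //; exact: measurableT_comp.
- by move=> p; rewrite mule_ge0// lee_fin.
apply/funext => x; rewrite /fubini_F [RHS]integral_mkcond; apply: eq_integral => y _.
rewrite /F /g2 /patch indicE in_setI /=.
case: (y \in D2) => /=; last by rewrite mul0e.
rewrite (_ : (y \in [set _ | _]) = ((x, y) \in E)); last by apply/idP/idP; rewrite !inE.
by case: (_ \in E); rewrite ?mule1 ?mule0.
Qed.

End tonelli_rel.

Section layer_cake.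
Context d (T : measurableType d) (R : realType).
Variables (mu : {sigma_finite_measure set T -> \bar R}) (D : set T).
Hypothesis mD : measurable D.
Local Notation leb := (@lebesgue_measure R).
Local Notation Rpos := (`]0%R, +oo[%classic : set R).

Let hypo (a : T -> \bar R) : set (T * measurableTypeR R) :=
  [set p | p.2%:E < (a \_ D) p.1].

Let mhypo a : measurable_fun D a -> measurable (hypo a).
Proof.
move=> ma; rewrite -[hypo a]setTI; apply: measurable_lte => //.
  by apply/measurable_EFinP; exact: measurable_snd.
by apply: measurableT_comp => //; apply/(measurable_restrictT _ mD).
Qed.

(** [a x] is the length of the interval of the [l] below it. *)
Lemma layer_cake_mul (a f : T -> \bar R) :
  measurable_fun D a -> measurable_fun D f ->
  (forall x, D x -> 0 <= a x) -> (forall x, D x -> 0 <= f x) ->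
  \int[mu]_(x in D) (a x * f x) =
  \int[leb]_(l in Rpos) \int[mu]_(x in D `&` [set x | l%:E < a x]) f x.
Proof.
move=> ma mf a0 f0.
have := @tonelli_rel _ _ _ _ _ mu leb D Rpos (hypo a) mD (measurable_itv _) (mhypo ma)
  f (cst 1) mf (measurable_cst _) f0 (fun _ _ => lee01).
move=> h; transitivity (\int[leb]_(l in Rpos)
    (cst 1 l * \int[mu]_(x in D `&` [set x | hypo a (x, l)]) f x)).
  rewrite -h; apply: eq_integral => x; rewrite inE => Dx; rewrite muleC.
  congr (_ * _); rewrite integral_cst//; last first.
    apply: measurableI => //.
    rewrite (_ : [set y | _] = (fun y => (y%:E : \bar R)) @^-1` [set` `]-oo, a x[]).
      by rewrite -[X in measurable X]setTI; apply: EFin_measurable => //; exact: emeasurable_itv.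
    by apply/seteqP; split=> y; rewrite /hypo /= /patch mem_set//= in_itv.
  rewrite mul1e.
  case aE : (a x) => [r| |]; last by have := a0 _ Dx; rewrite aE.
    have r0 : (0 <= r)%R by rewrite -lee_fin -aE; apply: a0.
    rewrite (_ : _ `&` _ = [set` `]0%R, r[]).
      symmetry; transitivity (leb [set` `]0%R, r[]); first by [].
      rewrite lebesgue_measure_itv/= lte_fin; case: ltgtP r0 => // r0' _.
        by rewrite sube0.
      by rewrite -r0'.
    apply/seteqP; split=> y; rewrite /hypo /= /patch mem_set//= aE lte_fin !in_itv/= andbT.
      by case=> -> ->.
    by move/andP.
  rewrite (_ : _ `&` _ = [set` `]0%R, +oo[]).
    symmetry; transitivity (leb [set` `]0%R, +oo[]); first by [].
    by rewrite lebesgue_measure_itv/= ltry.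
  apply/seteqP; split=> y; rewrite /hypo /= /patch mem_set//= aE ltry.
    by case.
  by [].
apply: eq_integral => l _; rewrite mul1e; congr (integral _ _ _).
by apply/seteqP; split=> x [Dx]; rewrite /hypo /= /patch mem_set.
Qed.


Lemma layer_cake (f : T -> \bar R) :
  measurable_fun D f -> (forall x, D x -> 0 <= f x) ->
  \int[mu]_(x in D) f x =
  \int[leb]_(l in Rpos) mu (D `&` [set x | l%:E < f x]).
Proof.
move=> mf f0; transitivity (\int[mu]_(x in D) (f x * cst 1 x)).
  by apply: eq_integral => x _; rewrite mule1.
rewrite layer_cake_mul//; apply: eq_integral => l _.
by rewrite integral_cst ?mul1e//; exact: measurable_superlevel.
Qed.

End layer_cake.

(** A nonnegative integral is a supremum over the simple functions below its
    integrand, hence monotone in arbitrary integrands. *)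
Lemma nn_le_integral d (T : measurableType d) (R : realType)
    (mu : {measure set T -> \bar R}) (D : set T) (f g : T -> \bar R) :
  (forall x, D x -> 0 <= f x) -> (forall x, D x -> f x <= g x) ->
  \int[mu]_(x in D) f x <= \int[mu]_(x in D) g x.
Proof.
move=> f0 fg; have g0 x : D x -> 0 <= g x by move=> Dx; exact: le_trans (f0 _ Dx) (fg _ Dx).
rewrite !ge0_integralE//; apply: ereal_sup_le; apply: image_subset => h /= hf x.
apply: le_trans (hf x) _; rewrite /patch; case: ifPn => //; rewrite inE; exact: fg.
Qed.

(** By the layer cake formula, an inequality between distribution functions
    passes to the integrals. *)
Lemma le_integral_superlevel d1 (T1 : measurableType d1) d2 (T2 : measurableType d2)
    (R : realType) (m1 : {sigma_finite_measure set T1 -> \bar R})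
    (m2 : {sigma_finite_measure set T2 -> \bar R}) (D1 : set T1) (D2 : set T2)
    (f1 : T1 -> \bar R) (f2 : T2 -> \bar R) :
  measurable D1 -> measurable D2 -> measurable_fun D1 f1 -> measurable_fun D2 f2 ->
  (forall x, D1 x -> 0 <= f1 x) -> (forall x, D2 x -> 0 <= f2 x) ->
  (forall l : R, (0 < l)%R ->
    m1 (D1 `&` [set x | l%:E < f1 x]) <= m2 (D2 `&` [set x | l%:E < f2 x])) ->
  \int[m1]_(x in D1) f1 x <= \int[m2]_(x in D2) f2 x.
Proof.
move=> mD1 mD2 mf1 mf2 f10 f20 h; rewrite (layer_cake m1 mD1)// (layer_cake m2 mD2)//.
by apply: nn_le_integral => // l; rewrite /= in_itv/= andbT; exact: h.
Qed.

(** * The Hardy-Littlewood inequality *)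

Lemma ge0_eq_lt (R : realType) (x y : \bar R) : 0 <= x -> 0 <= y ->
  (forall m : R, (0 <= m)%R -> m%:E < x <-> m%:E < y) -> x = y.
Proof.
have le a b : 0 <= a -> 0 <= b -> (forall m : R, (0 <= m)%R -> m%:E < a -> m%:E < b) -> a <= b.
  move=> a0 b0 h; case: b b0 h => [r| |] b0 h; rewrite ?leey//.
  by rewrite leNgt; apply/negP => /(h _ b0); rewrite ltxx.
by move=> x0 y0 h; apply/eqP; rewrite eq_le; apply/andP; split; apply: le => // m /h [].
Qed.

Section extent.
Variable R : realType.
Implicit Types U V : set R.
Local Notation HL := (@halfline R).

Lemma extent_lt U (t : R) : (0 < t)%R ->
  t%:E < extent U <-> exists2 s : R, (t < s)%R & U s.
Proof.
move=> t0; split=> [/ereal_sup_gt[_ /= [s [->|[s0 Us]] <-]]|[s ts Us]].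
- by rewrite lte_fin ltNge (ltW t0).
- by rewrite lte_fin => ts; exists s.
- apply: (@lt_le_trans _ _ s%:E); first by rewrite lte_fin.
  by apply: ereal_sup_ubound; exists s => //; right; split=> //; apply: lt_trans ts.
Qed.

Lemma extent_lt_set (y : \bar R) : 0 <= y -> extent [set t : R | t%:E < y] = y.
Proof.
move=> y0; apply/eqP; rewrite eq_le; apply/andP; split.
  by apply: ge_ereal_sup => _ /= [t [->|[_ /ltW ?]] <-].
rewrite leNgt; apply/negP => lty.
have [] : exists2 m : R, extent [set t : R | t%:E < y] < m%:E & m%:E < y.
  case E : (extent _) lty => [r| |].
  - case: y y0 {E} => // [s|] _; rewrite ?lte_fin => h.
      by exists ((r + s) / 2)%R; rewrite lte_fin ?midf_lt.
    by exists (r + 1)%R; rewrite ?lte_fin ?ltrDl ?ltry.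
  - by rewrite ltNge leey.
  - move=> _; suff : 0 <= extent [set t : R | t%:E < y] by rewrite E leeNy_eq.
    by apply: ereal_sup_ubound; exists 0%R => //; left.
move=> m em my; have : m%:E <= extent [set t : R | t%:E < y].
  apply: ereal_sup_ubound; exists m => //; right; split=> //.
  rewrite -lte_fin; apply: le_lt_trans em.
  by apply: ereal_sup_ubound; exists 0%R => //; left.
by rewrite leNgt em.
Qed.

Lemma downset_total U V : downset U -> downset V ->
  HL `&` U `<=` V \/ HL `&` V `<=` U.
Proof.
move=> dU dV; have [|nUV] := pselect (HL `&` U `<=` V); [by left|right].
have [u [[]]] : exists u, (HL `&` U) u /\ ~ V u.
  by apply: contrapT => h; apply: nUV => u Uu; apply: contrapT => Vu; apply: h; exists u.
rewrite halflineE => u0 Uu nVu v [/=]; rewrite halflineE => v0 Vv.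
apply: (dU _ u) => //; rewrite leNgt; apply/negP => uv.
by apply: nVu; apply: dV Vv => //; exact: ltW.
Qed.

Lemma lam_downset U : downset U -> lam (HL `&` U) = extent U.
Proof.
by move=> dU; rewrite -(uniform_downset (@measurable_halfline R) (@uniform_map_id R) dU).
Qed.

End extent.

Section hardy_littlewood.
Context d (T : measurableType d) (R : realType).
Variables (mu : {sigma_finite_measure set T -> \bar R}) (D : set T).
Hypothesis mD : measurable D.
Local Notation HL := (@halfline R).

Lemma measurable_nincr (A : R1_type R -> \bar R) : nincr A -> measurable_fun HL A.
Proof.
move=> nA; exact: (measurable_nincr_comp (@measurable_halfline R) (@uniform_map_id R) nA).
Qed.

Lemma nincr_rearr (f : T -> \bar R) : nincr (rearr mu D f : R1_type R -> _).
Proof. by move=> s t _ st; exact: rearr_nincr. Qed.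

Lemma measurable_rearr (f : T -> \bar R) : measurable_fun HL (rearr mu D f).
Proof. exact/measurable_nincr/nincr_rearr. Qed.

(** By [lt_rearr] a superlevel set of the rearrangement is the initial interval
    whose length is the distribution function. *)
Lemma lam_rearr_superlevel (f : T -> \bar R) (m : R) : measurable_fun D f ->
  (0 <= m)%R -> lam (HL `&` [set t : R1_type R | m%:E < rearr mu D f t]) = distr mu D f m.
Proof.
move=> mf m0; rewrite -[RHS]extent_lt_set; last exact: measure_ge0.
rewrite lam_downset; last exact/downset_superlevel/nincr_rearr.
by congr extent; apply/seteqP; split=> t /lt_rearr; apply.
Qed.

Lemma rearr_idem (f : T -> \bar R) : measurable_fun D f ->
  rearr lam HL (rearr mu D f) = rearr mu D f.
Proof.
move=> mf; apply: rearr_distr => l l0; rewrite ge0_distrE; last first.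
  by move=> t _; exact: rearr_ge0.
exact: (lam_rearr_superlevel mf (ltW l0)).
Qed.

Variable sigma : T -> R.
Hypothesis us : uniform_map mu D sigma.

Lemma uniform_superlevel (A : R1_type R -> \bar R) (y : \bar R) : nincr A ->
  mu (D `&` [set x | y < A (sigma x)]) = lam (HL `&` [set t : R1_type R | y < A t]).
Proof.
move=> nA; rewrite lam_downset; last exact: downset_superlevel.
by rewrite -(uniform_downset mD us) //; exact: downset_superlevel.
Qed.

Lemma uniform_ge0 (A : R1_type R -> \bar R) : (forall t : R, (0 < t)%R -> 0 <= A t) ->
  forall x, D x -> 0 <= A (sigma x).
Proof. by move=> A0 x Dx; apply: A0; case: us => _ + _; apply. Qed.

Lemma rearr_uniform (A : R1_type R -> \bar R) : nincr A ->
  (forall t : R, (0 < t)%R -> 0 <= A t) ->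
  rearr mu D (A \o sigma) = rearr lam HL A.
Proof.
move=> nA A0; apply: rearr_distr => l l0.
rewrite ge0_distrE; last exact: uniform_ge0.
rewrite ge0_distrE; last by move=> t; rewrite halflineE; exact: A0.
exact: uniform_superlevel.
Qed.

Lemma integral_uniform_map (A : R1_type R -> \bar R) : nincr A ->
  (forall t : R, (0 < t)%R -> 0 <= A t) ->
  \int[mu]_(x in D) A (sigma x) = \int[lam]_(t in HL) A t.
Proof.
move=> nA A0; apply/eqP; rewrite eq_le; apply/andP; split.
  apply: le_integral_superlevel => //.
  - exact: measurable_halfline.
  - exact: (measurable_nincr_comp mD us nA).
  - exact: measurable_nincr.
  - exact: uniform_ge0.
  - by move=> t; rewrite halflineE; exact: A0.
  - by move=> l l0; rewrite uniform_superlevel.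
apply: le_integral_superlevel => //.
- exact: measurable_halfline.
- exact: measurable_nincr.
- exact: (measurable_nincr_comp mD us nA).
- by move=> t; rewrite halflineE; exact: A0.
- exact: uniform_ge0.
- by move=> l l0; rewrite uniform_superlevel.
Qed.

(** After two layer cakes the claim is about superlevel sets. On the left there
    is a measure [mu (E `&` F)], at most [mu E] and at most [mu F]; on the right
    two nested downsets of measures [mu E] and [mu F] are intersected, so that
    the smaller of these two bounds is attained. *)
Lemma hardy_littlewood (A : R1_type R -> \bar R) (f : T -> \bar R) : nincr A ->
  (forall t : R, (0 < t)%R -> 0 <= A t) ->
  measurable_fun D f -> (forall x, D x -> 0 <= f x) ->
  \int[mu]_(x in D) (A (sigma x) * f x) <=
  \int[lam]_(t in HL) (A t * rearr mu D f t).
Proof.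
move=> nA A0 mf f0.
have mHL := @measurable_halfline R.
have mAs : measurable_fun D (fun x => A (sigma x)) by exact: (measurable_nincr_comp mD us nA).
have mA : measurable_fun HL A by exact: measurable_nincr.
rewrite (layer_cake_mul mu mD)//; last exact: uniform_ge0.
rewrite (layer_cake_mul lam mHL)//; first last.
- by move=> t _; exact: rearr_ge0.
- by move=> t; rewrite halflineE; exact: A0.
- exact: measurable_rearr.
apply: nn_le_integral => l _; first by apply: integral_ge0 => x [Dx _]; exact: f0.
have mU : measurable (HL `&` [set t : R1_type R | l%:E < A t]) by exact: measurable_superlevel.
have mUs : measurable (D `&` [set x | l%:E < A (sigma x)]) by exact: measurable_superlevel.
apply: le_integral_superlevel => //.
- by apply: measurable_funS mf => // x [].
- by apply: measurable_funS (measurable_rearr f) => // x [].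
- by move=> x [Dx _]; exact: f0.
- by move=> t _; exact: rearr_ge0.
move=> m m0; rewrite -!setIA.
have dU : downset [set t : R | l%:E < A t] by exact: downset_superlevel.
have dV : downset [set t : R | m%:E < rearr mu D f t].
  exact/downset_superlevel/nincr_rearr.
have mfm : measurable (D `&` [set x | m%:E < f x]) by exact: measurable_superlevel.
have mUV : measurable (D `&` ([set x | l%:E < A (sigma x)] `&` [set x | m%:E < f x])).
  by rewrite -[D]setIid setIACA; exact: measurableI.
have [UV|VU] := downset_total dU dV.
- rewrite (_ : _ `&` (_ `&` [set t : R1_type R | m%:E < rearr _ _ _ t]) =
      HL `&` [set t : R1_type R | l%:E < A t]); last first.
    by apply/seteqP; split=> t => [[Ht [? ?]]|[Ht ?]]; do ?split=> //; exact: UV.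
  apply: (@le_trans _ _ (mu (D `&` [set x | l%:E < A (sigma x)]))).
    by apply: le_measure; rewrite ?inE// => x [Dx []].
  by rewrite (uniform_superlevel _ nA).
- rewrite (_ : _ `&` (_ `&` [set t : R1_type R | m%:E < rearr _ _ _ t]) =
      HL `&` [set t : R1_type R | m%:E < rearr mu D f t]); last first.
    by apply/seteqP; split=> t => [[Ht [? ?]]|[Ht ?]]; do ?split=> //; exact: VU.
  apply: (@le_trans _ _ (distr mu D f m)).
    by rewrite ge0_distrE//; apply: le_measure; rewrite ?inE// => x [Dx []].
  by rewrite -(lam_rearr_superlevel mf (ltW m0)).
Qed.

End hardy_littlewood.

Section right_continuous.
Variable R : realType.
Local Notation HL := (@halfline R).

(** For a nonincreasing function this is right-continuity: the superlevel sets
    are open to the right. *)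
Definition rcont (A : R1_type R -> \bar R) := forall (t : R) (y : \bar R),
  (0 < t)%R -> y < A t -> exists2 s : R, (t < s)%R & y < A s.

Lemma rearr_rcont_nincr (A : R1_type R -> \bar R) : nincr A -> rcont A ->
  (forall t : R, (0 < t)%R -> 0 <= A t) ->
  forall t : R, (0 < t)%R -> rearr lam HL A t = A t.
Proof.
move=> nA rA A0 t t0; apply: ge0_eq_lt; [exact: rearr_ge0|exact: A0|move=> m m0].
rewrite (lt_rearr lam (@measurable_halfline R))//; last exact: measurable_nincr.
rewrite ge0_distrE; last by move=> s; rewrite halflineE; exact: A0.
have dU : downset [set s : R | m%:E < A s] by exact: downset_superlevel.
have := lam_downset dU; rewrite /= => ->.
rewrite extent_lt//; split=> [[s ts /= ms]|]; last exact: rA.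
by apply: lt_le_trans ms _; apply: nA => //; exact: ltW.
Qed.

Lemma rcont_rearr d (T : measurableType d) (mu : {measure set T -> \bar R})
    (D : set T) (f : T -> \bar R) : measurable D -> measurable_fun D f ->
  rcont (rearr mu D f : R1_type R -> _).
Proof.
move=> mD mf t y t0 yt.
have [y0|y0] := ltP y 0.
  exists (t + 1)%R; first by rewrite ltrDl.
  by apply: lt_le_trans y0 _; exact: rearr_ge0.
case: y y0 yt => [m| |] // m0; last by rewrite ltNge leey.
move=> /(lt_rearr mu mD t mf m0) h.
have [s ts sm] : exists2 s : R, (t < s)%R & s%:E < distr mu D f m.
  case: (distr _ _ _ _) h => [r|_|//].
    rewrite lte_fin => h.
    by exists ((t + r) / 2)%R; rewrite ?lte_fin midf_lt.
  by exists (t + 1)%R; rewrite ?ltrDl ?ltry.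
by exists s => //; apply/(lt_rearr mu mD).
Qed.

End right_continuous.

(** * Integrals on the half-line *)

Section halfline_integrals.
Variable R : realType.
Local Notation HL := (@halfline R).
Local Notation leb := (@lebesgue_measure R).

Lemma lam_integral_borel (B : set R) (f : R -> \bar R) : measurable B ->
  measurable_fun B f -> (forall x, B x -> 0 <= f x) ->
  \int[lam]_(x in (B : set (R1_type R))) f x = \int[leb]_(x in B) f x.
Proof.
move=> mB mf f0.
have := @ge0_integral_pushforward _ _ (R1_type R) (measurableTypeR R) R id (@measurable_id_R1 R) lam B f mB mf.
rewrite preimage_id => <-; last by move=> x; rewrite inE; exact: f0.
by apply: eq_measure_integral => [|? A mA _]; first exact: measurable_id_R1.
Qed.

(** The fundamental theorem of calculus applies on [[a / k.+2, a]], and the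
    singularity at the origin is reached by monotone convergence. *)
Lemma powR_integral_le (b a : R) : (-1 < b)%R -> (0 < a)%R ->
  \int[lam]_(t in HL `&` [set t : R | (t < a)%R]) ((t : R) `^ b)%:E <=
  (a `^ (1 + b) / (1 + b))%:E.
Proof.
move=> b1 a0.
have b0 : (0 < 1 + b)%R by rewrite -ltrBlDl sub0r.
have mpow (B : set R) : measurable_fun B (fun t : R => (t `^ b)%:E).
  by apply: measurable_funTS; apply/measurable_EFinP; exact: measurable_powR.
have -> : HL `&` [set t : R | (t < a)%R] = [set` `]0%R, a[].
  by apply/seteqP; split=> t /=; rewrite halflineE in_itv/=; [case=> -> ->|move/andP].
rewrite lam_integral_borel//; last by move=> x _; rewrite lee_fin powR_ge0.
pose F k : set R := [set` `[(a / k.+2%:R)%R, a]].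
have F0 k : (0 < a / k.+2%:R)%R by rewrite divr_gt0.
have Fa k : (a / k.+2%:R < a)%R.
  by rewrite ltr_pdivrMr// ltr_pMr// ltr1n.
have ndF : nondecreasing_seq F.
  move=> i j ij; apply/subsetPset => t; rewrite /F /= !in_itv/= => /andP[h ->].
  rewrite andbT; apply: le_trans h; rewrite ler_pM2l// lef_pV2 ?posrE//.
  by rewrite ler_nat !ltnS.
have cF := @ge0_nondecreasing_set_cvg_integral _ (measurableTypeR R) R F (fun t : R => (t `^ b)%:E) leb
  ndF (fun k => measurable_itv _).
have {}cF := cF (fun k => mpow _) (fun k x _ => powR_ge0 x b).
have sub : [set` `]0%R, a[] `<=` \bigcup_k F k.
  move=> t; rewrite /= in_itv/= => /andP[t0 ta].
  have /ltr_add_invr[k] : (0 < t / a)%R by rewrite divr_gt0.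
  rewrite add0r => hk; exists k => //; rewrite /F /= in_itv/= (ltW ta) andbT.
  have {}hk : (a < t * k.+1%:R)%R.
    by move: hk; rewrite ltr_pdivlMr// mulrC ltr_pdivrMr.
  by rewrite ler_pdivrMr// (le_trans (ltW hk))// ler_pM2l// ler_nat.
apply: (@le_trans _ _ (\int[leb]_(x in \bigcup_k F k) (x `^ b)%:E)).
  apply: ge0_subset_integral => //.
  - by apply: bigcup_measurable => k _; exact: measurable_itv.
  - exact: mpow.
  - by move=> x _; rewrite lee_fin powR_ge0.
rewrite -(cvg_lim _ cF)//; apply: lime_le; first by apply/cvg_ex; eexists; exact: cF.
apply: nearW => k.
pose G (t : R) : R := (t `^ (1 + b) / (1 + b))%R.
have dG (x : R) : (0 < x)%R -> is_derive x 1%R G (x `^ b)%R.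
  move=> x0; have dp := is_derive1_powR (1 + b) x0.
  rewrite (_ : G = ((1 + b)^-1 \*: ((fun t => t `^ (1 + b)) : R -> R^o))%R); last first.
    by apply/funext => t; rewrite /G mulrC.
  apply: (is_derive_eq (is_deriveZ (1 + b)^-1%R dp)).
  rewrite addrAC subrr add0r /GRing.scale/= mulrA mulVf ?mul1r//.
  exact: lt0r_neq0.
rewrite (@continuous_FTC2 _ (fun t : R => t `^ b)%R G)//.
- rewrite -EFinB lee_fin lerBlDr lerDl; rewrite divr_ge0 ?powR_ge0//; exact: ltW.
- apply: continuous_in_subspaceT => x; rewrite inE /= in_itv/= => /andP[h _].
  by apply/differentiable_continuous/derivable1_diffP/derivable_powR; rewrite in_itv/= andbT (lt_le_trans (F0 k)).
- split.
  + by move=> x; rewrite in_itv/= => /andP[h _]; have [] := dG x (lt_trans (F0 k) h).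
  + by apply: cvg_at_right_filter; apply/differentiable_continuous/derivable1_diffP; have [] := dG _ (F0 k).
  + by apply: cvg_at_left_filter; apply/differentiable_continuous/derivable1_diffP; have [] := dG _ a0.
- move=> x; rewrite in_itv/= => /andP[h _]; have [_] := dG x (lt_trans (F0 k) h).
  by rewrite derive1E.
Qed.

Lemma measurable_powR_R1 (b : R) (B : set (R1_type R)) :
  measurable_fun B (fun t : R1_type R => ((t : R) `^ b)%:E : \bar R).
Proof.
apply: measurable_funTS; apply/measurable_EFinP.
exact: (measurableT_comp (measurable_powR b) (@measurable_id_R1 R)).
Qed.

Lemma measurable_lt_R1 (a : R) : measurable (HL `&` [set t : R | (t < a)%R]).
Proof.
rewrite (_ : _ `&` _ = [set` `]0%R, a[]); first by apply: measurable_R1; exact: measurable_itv.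
by apply/seteqP; split=> t /=; rewrite halflineE in_itv/=; [case=> -> ->|move/andP].
Qed.

Lemma lam_lt (a : R) : (0 < a)%R -> lam (HL `&` [set t : R | (t < a)%R]) = a%:E.
Proof. by case: (@uniform_map_id R) => _ _ h /h. Qed.

(** The primitive [\int_0^s A]. *)
Definition prim (A : R1_type R -> \bar R) (s : R) : \bar R :=
  \int[lam]_(t in HL `&` [set t : R | (t < s)%R]) A t.

Lemma prim_ge0 A s : (forall t : R, (0 < t)%R -> 0 <= A t) -> 0 <= prim A s.
Proof. by move=> A0; apply: integral_ge0 => t []; rewrite halflineE => /A0. Qed.

Lemma le_prim A B s : (forall t : R, (0 < t)%R -> 0 <= A t) ->
  (forall t : R, (0 < t)%R -> (t < s)%R -> A t <= B t) -> prim A s <= prim B s.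
Proof.
move=> A0 AB; apply: nn_le_integral => t [/=]; rewrite halflineE => t0; first by move=> _; exact: A0.
exact: AB.
Qed.

Lemma prim_homo A s t : (forall t : R, (0 < t)%R -> 0 <= A t) -> measurable_fun HL A ->
  (s <= t)%R -> prim A s <= prim A t.
Proof.
move=> A0 mA st; apply: ge0_subset_integral; try exact: measurable_lt_R1.
- exact: (measurable_funS (@measurable_halfline R) (@subIsetl _ _ _) mA).
- by move=> x []; rewrite halflineE => /A0.
- by move=> x [? /= xs]; split=> //=; exact: lt_le_trans st.
Qed.

Lemma prim_nincr_ge (A : R1_type R -> \bar R) s : (0 < s)%R -> nincr A ->
  (forall t : R, (0 < t)%R -> 0 <= A t) -> s%:E * A s <= prim A s.
Proof.
move=> s0 nA A0; rewrite -[X in X * _]lam_lt// muleC -integral_cst//; last exact: measurable_lt_R1.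
apply: nn_le_integral => t [] /=; rewrite halflineE => t0 ts; first exact: A0.
by apply: nA => //; exact: ltW.
Qed.

Lemma weighted_tailE (b : R) (h : R1_type R -> \bar R) (t : R) : (0 < t)%R ->
  weighted_tail b h t =
  \int[lam]_(s in HL `&` [set s : R | (t < s)%R]) (h s * ((s : R) `^ b)%:E).
Proof.
move=> t0; congr (integral _ _ _); apply/seteqP; split=> s /=; rewrite halflineE.
  by move=> ts; split=> //; apply: lt_trans ts.
by case.
Qed.

Let before : set (R1_type R * R1_type R) := [set p | (p.1 < p.2 :> R)%R].
Let after : set (R1_type R * R1_type R) := [set p | (p.2 < p.1 :> R)%R].

Let m1 : measurable_fun setT (fun p : R1_type R * R1_type R => p.1 : measurableTypeR R).
Proof. exact: measurableT_comp (@measurable_id_R1 R) measurable_fst. Qed.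

Let m2 : measurable_fun setT (fun p : R1_type R * R1_type R => p.2 : measurableTypeR R).
Proof. exact: measurableT_comp (@measurable_id_R1 R) measurable_snd. Qed.

Let mbefore : measurable before.
Proof.
have := @measurable_fun_ltr _ _ _ _ _ _ m1 m2 measurableT [set true] I.
by rewrite setTI.
Qed.

Let mafter : measurable after.
Proof.
have := @measurable_fun_ltr _ _ _ _ _ _ m2 m1 measurableT [set true] I.
by rewrite setTI.
Qed.

Lemma measurable_prim (A : R1_type R -> \bar R) (B : set (R1_type R)) :
  measurable_fun HL A -> (forall t : R, (0 < t)%R -> 0 <= A t) ->
  measurable_fun B (prim A).
Proof.
move=> mA A0; apply: measurable_funTS.
have A0' x : HL x -> 0 <= A x by rewrite halflineE => /A0.
exact: (measurable_rel_section lam (@measurable_halfline R) mafter mA A0').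
Qed.

Lemma measurable_before (t : R) : measurable (HL `&` [set s : R | (t < s)%R]).
Proof.
apply: measurableI; first exact: measurable_halfline.
apply: measurable_R1; rewrite (_ : [set s | _] = [set` `]t, +oo[]); first exact: measurable_itv.
by apply/seteqP; split=> x /=; rewrite in_itv/= andbT.
Qed.

Section tail.
Variables (b : R) (h : R1_type R -> \bar R).
Hypotheses (mh : measurable_fun HL h) (h0 : forall t : R, (0 < t)%R -> 0 <= h t).

Let k (s : R1_type R) := h s * ((s : R) `^ b)%:E.

Let mk : measurable_fun HL k.
Proof. by apply: emeasurable_funM => //; exact: measurable_powR_R1. Qed.

Let k0 s : HL s -> 0 <= k s.
Proof. by rewrite halflineE => s0; rewrite mule_ge0 ?lee_fin ?powR_ge0// h0. Qed.

Lemma weighted_tail_ge0 (t : R) : (0 < t)%R -> 0 <= weighted_tail b h t.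
Proof. by move=> t0; rewrite weighted_tailE//; apply: integral_ge0 => s [/k0]. Qed.

Lemma nincr_weighted_tail : nincr (weighted_tail b h).
Proof.
move=> s t s0 st; rewrite !weighted_tailE//; last exact: lt_le_trans st.
apply: ge0_subset_integral; try exact: measurable_before.
- exact: (measurable_funS (@measurable_halfline R) (@subIsetl _ _ _) mk).
- by move=> x [/k0].
- by move=> x [? /= xs]; split=> //=; exact: le_lt_trans xs.
Qed.

(** Tonelli's theorem over the relation [t < s]: tail integrals are dual to
    primitives. *)
Lemma weighted_tail_dual (A : R1_type R -> \bar R) : measurable_fun HL A ->
  (forall t : R, (0 < t)%R -> 0 <= A t) ->
  \int[lam]_(t in HL) (A t * weighted_tail b h t) =
  \int[lam]_(s in HL) (h s * ((s : R) `^ b)%:E * prim A s).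
Proof.
move=> mA A0; have mHL := @measurable_halfline R.
have A0' x : HL x -> 0 <= A x by rewrite halflineE => /A0.
have := tonelli_rel lam lam mHL mHL mbefore mA mk A0' k0.
move=> <-; apply: eq_integral => t; rewrite inE => tHL.
by rewrite weighted_tailE// -halflineE.
Qed.

End tail.

End halfline_integrals.

(** * The supremum operator and the averaging kernel *)

Section sup_operator.
Variables (R : realType) (al : R).
Hypotheses (al0 : (0 < al)%R) (al1 : (al < 1)%R).
Local Notation HL := (@halfline R).
Implicit Types (g : R1_type R -> \bar R) (s t a : R).

Let powR_mul t (x y : R) : (0 < t)%R -> (t `^ x * t `^ y = t `^ (x + y))%R.
Proof. by move=> t0; rewrite powRD// (gt_eqF t0) implybT. Qed.

Definition sup_weight g t : \bar R :=
  ereal_sup [set (s `^ al)%:E * g s | s in [set s : R | (t <= s)%R]].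

(** [sup_operator al f] is [supop (rearr lam HL f)]. *)
Definition supop g : R1_type R -> \bar R :=
  fun t : R => (t `^ (- al))%:E * sup_weight g t.

Definition avg g t : \bar R := (t `^ (al - 1))%:E * prim g t.

(** The least nonincreasing majorant of [avg g]. *)
Definition sup_avg g : R1_type R -> \bar R := fun s : R =>
  ereal_sup [set avg g t | t in [set t : R | (s <= t)%R]].

Lemma avg_le_sup g t s : (s <= t)%R -> avg g t <= sup_avg g s.
Proof. by move=> st; apply: ereal_sup_ubound; exists t. Qed.

Lemma nincr_sup_avg g : nincr (sup_avg g).
Proof.
move=> s t _ st; apply: ereal_sup_le; apply: image_subset => u /=.
exact: le_trans.
Qed.

Lemma avg_ge0 g t : (forall t, (0 < t)%R -> 0 <= g t) -> 0 <= avg g t.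
Proof. by move=> g0; rewrite mule_ge0 ?prim_ge0// lee_fin powR_ge0. Qed.

Lemma sup_avg_ge0 g t : (forall t, (0 < t)%R -> 0 <= g t) -> 0 <= sup_avg g t.
Proof. by move=> g0; apply: le_trans (avg_le_sup g (lexx t)); exact: avg_ge0. Qed.

Lemma avgK g t : (0 < t)%R -> (t `^ (1 - al))%:E * avg g t = prim g t.
Proof.
move=> t0; rewrite /avg muleA -EFinM powR_mul//.
by rewrite (_ : 1 - al + _ = 0)%R ?powRr0 ?mul1e//; ring.
Qed.

Section nonincreasing.
Variable g : R1_type R -> \bar R.
Hypotheses (ng : nincr g) (g0 : forall t, (0 < t)%R -> 0 <= g t).

Let mg : measurable_fun HL g. Proof. exact: measurable_nincr. Qed.

Lemma weight_le_sup t s : (t <= s)%R -> (s `^ al)%:E * g s <= sup_weight g t.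
Proof. by move=> ts; apply: ereal_sup_ubound; exists s. Qed.

Lemma sup_weight_ge0 t : (0 < t)%R -> 0 <= sup_weight g t.
Proof.
move=> t0; apply: le_trans (weight_le_sup (lexx t)).
by rewrite mule_ge0 ?g0// lee_fin powR_ge0.
Qed.

Lemma sup_weight_nincr s t : (s <= t)%R -> sup_weight g t <= sup_weight g s.
Proof.
move=> st; apply: ereal_sup_le; apply: image_subset => u /=; exact: le_trans.
Qed.

Lemma supop_ge0 t : (0 < t)%R -> 0 <= supop g t.
Proof. by move=> t0; rewrite mule_ge0 ?sup_weight_ge0// lee_fin powR_ge0. Qed.

Lemma powRN_nincr (x s t : R) : (0 <= x)%R -> (0 < s)%R -> (s <= t)%R ->
  (t `^ (- x) <= s `^ (- x))%R.
Proof.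
move=> x0 s0 st; have t0 : (0 < t)%R by exact: lt_le_trans st.
by rewrite !powRN lef_pV2 ?posrE ?powR_gt0// ge0_ler_powR// nnegrE ltW.
Qed.

Lemma nincr_supop : nincr (supop g).
Proof.
move=> s t s0 st; apply: lee_pmul.
- by rewrite lee_fin powR_ge0.
- by apply: sup_weight_ge0; exact: lt_le_trans st.
- by rewrite lee_fin powRN_nincr// ltW.
- exact: sup_weight_nincr.
Qed.

Lemma le_supop t : (0 < t)%R -> g t <= supop g t.
Proof.
move=> t0; apply: (@le_trans _ _ ((t `^ (- al))%:E * ((t `^ al)%:E * g t))).
  by rewrite muleA -EFinM powR_mul// addNr powRr0 mul1e.
by apply: lee_wpmul2l; rewrite ?lee_fin ?powR_ge0//; exact: weight_le_sup.
Qed.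

Lemma supopK t : (0 < t)%R -> (t `^ al)%:E * supop g t = sup_weight g t.
Proof. by move=> t0; rewrite /supop muleA -EFinM powR_mul// subrr powRr0 mul1e. Qed.

Lemma rcont_supop : rcont g -> rcont (supop g).
Proof.
move=> rg t y t0 yt.
have [y0|y0] := ltP y 0.
  exists (t + 1)%R; first by rewrite ltrDl.
  by apply: lt_le_trans y0 _; apply: supop_ge0; rewrite addr_gt0.
have : (t `^ al)%:E * y < sup_weight g t.
  by rewrite -supopK// lte_pmul2l// lte_fin powR_gt0.
move=> /ereal_sup_gt[_ /= [s ts <-] ys].
have s0 : (0 < s)%R by exact: lt_le_trans ts.
have cancel u x : (0 < u)%R -> (u `^ al)%:E * y < x -> y < (u `^ (- al))%:E * x.
  move=> u0 h; rewrite -[y]mul1e -(powRr0 u) -(addNr al) -powR_mul// EFinM -muleA.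
  by rewrite lte_pmul2l// lte_fin powR_gt0.
move: ts; rewrite le_eqVlt => /predU1P[ts|ts].
  have : y < g t.
    by move: ys; rewrite -ts lte_pmul2l// lte_fin powR_gt0.
  move=> /(rg _ _ t0)[u tu yu]; exists u => //; apply: lt_le_trans yu _.
  by apply: le_supop; exact: lt_trans tu.
(* the power of the argument is continuous: the strict inequality survives a
   small move to the right, which keeps [s] among the competitors *)
suff [u [tu us yu]] : exists u, [/\ (t < u)%R, (u <= s)%R &
    (u `^ al)%:E * y < (s `^ al)%:E * g s].
  exists u => //; apply: cancel; first exact: lt_trans tu.
  by apply: lt_le_trans yu _; exact: weight_le_sup.
have W0 : 0 <= (s `^ al)%:E * g s by rewrite mule_ge0 ?g0// lee_fin powR_ge0.
move: W0 ys; set W := _ * g s; case: W => [w| |//] w0 ys; last first.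
  exists s; split=> //; case: y y0 ys {cancel yt} => [r| |]//= r0.
    by rewrite -!EFinM !ltry.
  by rewrite gt0_muley// lte_fin powR_gt0.
case: y y0 ys {cancel yt} => [r| |]//= r0; last by rewrite gt0_muley// lte_fin powR_gt0.
rewrite -EFinM lte_fin => tw; move: r0; rewrite lee_fin le_eqVlt => /predU1P[r0|r0].
  by exists s; split=> //; rewrite -r0 mule0 lte_fin; move: tw; rewrite -r0 mulr0.
pose v := ((w / r) `^ (al^-1))%R.
have wr0 : (0 <= w / r)%R by rewrite divr_ge0// ltW.
have vE : (v `^ al = w / r)%R by rewrite -powRrM mulVf ?powRr1// gt_eqF.
have tv : (t < v)%R.
  rewrite ltNge; apply/negP => vt; have : (v `^ al <= t `^ al)%R.
    by rewrite ge0_ler_powR// ?nnegrE ?powR_ge0 ?ltW.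
  by rewrite vE ler_pdivrMr// leNgt tw.
exists (Num.min s ((t + v) / 2))%R; split.
- by rewrite lt_min ts midf_lt.
- by rewrite ge_min lexx.
- rewrite -EFinM lte_fin -ltr_pdivlMr// -vE gt0_ltr_powR ?nnegrE ?powR_ge0//.
    by rewrite le_min (ltW s0) divr_ge0// addr_ge0 ?powR_ge0// ltW.
  by rewrite gt_min midf_lt ?orbT.
Qed.

(** A mean over [(0, t)], [t >= s], is split at [s]; beyond [s] the function is
    at most [u `^ (- al) * sup_weight g s], which is integrable at the rate
    [t `^ (1 - al)] because [al < 1]. *)
Lemma sup_avg_le_supop s : (0 < s)%R ->
  sup_avg g s <= (1 + (1 - al)^-1)%:E * avg (supop g) s.
Proof.
move=> s0; apply: ge_ereal_sup => _ /= [t st <-].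
have t0 : (0 < t)%R by exact: lt_le_trans st.
have c0 : (0 < 1 - al)%R by rewrite subr_gt0.
set X := avg (supop g) s; set U := sup_weight g s.
have U0 : 0 <= U by exact: sup_weight_ge0.
have mHLt := @measurable_lt_R1 R t.
have split_t : prim g t <= prim g s + (t `^ (1 - al) / (1 - al))%:E * U.
  pose B : set (R1_type R) := HL `&` [set u : R | (s <= u)%R /\ (u < t)%R].
  have mB : measurable B.
    rewrite (_ : B = (HL `&` [set u : R | (u < t)%R]) `\` (HL `&` [set u : R | (u < s)%R])).
      by apply: measurableD => //; exact: measurable_lt_R1.
    apply/seteqP; split=> u /= [].
      by move=> hu [su ut]; split=> // -[_]; rewrite ltNge su.
    by move=> [hu ut] nus; split=> //; split=> //; rewrite leNgt; apply/negP => us; apply: nus.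
  have -> : prim g t = prim g s + \int[lam]_(u in B) g u.
    rewrite /prim -ge0_integral_setU//.
    - congr (integral _ _ _); apply/seteqP; split=> u.
        by move=> [hu /= ut]; have [su|us] := leP s u; [right|left].
      by move=> [[hu /= us]|[hu [/= su ut]]]; split=> //; exact: lt_le_trans st.
    - exact: measurable_lt_R1.
    - apply: measurable_funS (@measurable_halfline R) _ mg.
      by move=> u [[]|[]].
    - by move=> u [[]|[]]; rewrite halflineE => /g0.
    - by apply/disj_setPS => u [[_ /= us] [_ [/= + _]]]; rewrite leNgt us.
  apply: leeD => //.
  apply: (@le_trans _ _ (\int[lam]_(u in B) (((u : R) `^ (- al))%:E * U))).
    apply: nn_le_integral => u [hu [/= su ut]]; have u0 : (0 < u)%R by rewrite -halflineE.
      exact: g0.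
    apply: le_trans (le_supop u0) _.
    by apply: lee_wpmul2l; rewrite ?lee_fin ?powR_ge0//; exact: sup_weight_nincr.
  apply: (@le_trans _ _ (\int[lam]_(u in HL `&` [set u : R | (u < t)%R])
      (((u : R) `^ (- al))%:E * U))).
    apply: (ge0_subset_integral lam mB mHLt).
    - exact: (emeasurable_funM (@measurable_powR_R1 R (- al) _) (measurable_cst U)).
    - by move=> u _; rewrite mule_ge0// lee_fin powR_ge0.
    - by move=> u [hu [/= su ut]]; split.
  have p0 (u : R1_type R) : (HL `&` [set u : R | (u < t)%R]) u ->
    0 <= ((u : R) `^ (- al))%:E by rewrite lee_fin powR_ge0.
  rewrite (ge0_integralZr lam mHLt (@measurable_powR_R1 R (- al) _) p0 U0).
  by apply: lee_wpmul2r => //; apply: powR_integral_le => //; rewrite ltrN2.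
have gX : (s `^ (al - 1))%:E * prim g s <= X.
  apply: lee_wpmul2l; first by rewrite lee_fin powR_ge0.
  by apply: le_prim => // u u0 _; exact: le_supop.
have UX : U <= X.
  rewrite /U -supopK// /X /avg.
  rewrite (_ : s `^ al = (s `^ (al - 1) * s))%R; last first.
    by rewrite -[X in (_ * X)%R]powRr1 ?(ltW s0)// powR_mul// subrK.
  rewrite EFinM -muleA; apply: lee_wpmul2l; first by rewrite lee_fin powR_ge0.
  by apply: prim_nincr_ge => //; [exact: nincr_supop|exact: supop_ge0].
apply: (@le_trans _ _ ((t `^ (al - 1))%:E * (prim g s + (t `^ (1 - al) / (1 - al))%:E * U))).
  by apply: lee_wpmul2l => //; rewrite lee_fin powR_ge0.
have P0 : 0 <= prim g s by exact: prim_ge0.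
rewrite ge0_muleDr//; last by rewrite mule_ge0// lee_fin divr_ge0 ?powR_ge0// ltW.
rewrite EFinD ge0_muleDl//; last by rewrite lee_fin invr_ge0 ltW.
rewrite mul1e; apply: leeD.
  apply: le_trans gX; apply: lee_wpmul2r => //; rewrite lee_fin.
  by rewrite -(opprB 1 al) powRN_nincr// ltW.
rewrite muleA -EFinM mulrA powR_mul//.
rewrite (_ : al - 1 + _ = 0)%R; last by ring.
by rewrite powRr0 mul1r; apply: lee_wpmul2l => //; rewrite lee_fin invr_ge0 ltW.
Qed.


Let cut a : R1_type R -> \bar R := g \_ [set u : R | (u < a)%R].

Let cutE a u : cut a u = if (u < a)%R then g u else 0.
Proof. by rewrite /cut /patch; case: ifPn; rewrite ?inE ?notin_setE /=; [move=> ->|move=> /negP/negbTE ->]. Qed.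

Let cut_ge0 a u : (0 < u)%R -> 0 <= cut a u.
Proof. by move=> u0; rewrite cutE; case: ifP => // _; exact: g0. Qed.

Let nincr_cut a : nincr (cut a).
Proof.
move=> s t s0 st; rewrite !cutE; case: ifPn => [ta|_].
  by rewrite (le_lt_trans st ta); exact: ng.
by case: ifP => // _; exact: g0.
Qed.

(** A competitor [v] of the supremum is treated in three ways: beyond [a] it is
    seen by the mean over [(0, v)]; below [2 t] it is comparable with [t]; in
    between, [v `^ al * g v] is at most twice the integral of
    [g u * u `^ (al - 1)] over [(v / 2, v)]. *)
Let sup_weight_le a t : (0 < t)%R -> (t < a)%R ->
  sup_weight g t <= sup_avg g a +
    2%:E * ((t `^ al)%:E * g t + weighted_tail (al - 1) (cut a) t).
Proof.
move=> t0 ta; set W := weighted_tail _ _ _.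
have W0 : 0 <= W by apply: weighted_tail_ge0 => // u; exact: cut_ge0.
have S0 : 0 <= sup_avg g a by exact: sup_avg_ge0.
have G0 : 0 <= (t `^ al)%:E * g t by rewrite mule_ge0 ?g0// lee_fin powR_ge0.
apply: ge_ereal_sup => _ /= [v tv <-].
have v0 : (0 < v)%R by exact: lt_le_trans tv.
have [av|va] := leP a v.
  apply: (@le_trans _ _ (sup_avg g a)); last first.
    by rewrite leeDl// mule_ge0// adde_ge0.
  apply: le_trans (avg_le_sup g av); rewrite /avg.
  rewrite (_ : v `^ al = (v `^ (al - 1) * v))%R; last first.
    by rewrite -[X in (_ * X)%R]powRr1 ?(ltW v0)// powR_mul// subrK.
  rewrite EFinM -muleA; apply: lee_wpmul2l; first by rewrite lee_fin powR_ge0.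
  exact: prim_nincr_ge.
apply: (@le_trans _ _ (2%:E * ((t `^ al)%:E * g t + W))); last by rewrite leeDr.
have [v2|v2] := ltP v (2 * t)%R.
  apply: (@le_trans _ _ (2%:E * ((t `^ al)%:E * g t))); last first.
    by apply: lee_wpmul2l => //; rewrite leeDl.
  rewrite muleA; apply: lee_pmul; [by rewrite lee_fin powR_ge0|exact: g0| |exact: ng].
  rewrite lee_fin; apply: (@le_trans _ _ ((2 * t) `^ al)%R).
    by rewrite ge0_ler_powR ?nnegrE// ltW// mulr_gt0.
  rewrite powRM ?(ltW t0)//; apply: ler_wpM2r; first exact: powR_ge0.
  by rewrite -[leRHS]powRr1// ler_powR ?ler1n// ltW.
apply: (@le_trans _ _ (2%:E * W)); last by apply: lee_wpmul2l => //; rewrite leeDr.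
have v20 : (0 < v / 2)%R by rewrite divr_gt0.
pose B : set (R1_type R) := [set` `](v / 2)%R, v[].
have mB : measurable B by apply: measurable_R1; exact: measurable_itv.
have lB : lam B = (v / 2)%:E.
  transitivity (@lebesgue_measure R B); first by [].
  rewrite lebesgue_measure_itv/= lte_fin; case: ltP => [_|]; last first.
    by rewrite leNgt ltr_pdivrMr// ltr_pMr// ltr1n.
  by rewrite -EFinD; congr EFin; lra.
apply: (@le_trans _ _ (2%:E * \int[lam]_(u in B) (g v * (v `^ (al - 1))%:E))).
  apply: (@le_trans _ _ (2%:E * (g v * (v `^ (al - 1))%:E * (v / 2)%:E))); last first.
    by rewrite -lB -integral_cst.
  rewrite muleCA -!muleA -!EFinM muleC.
  rewrite (_ : v `^ al = v `^ (al - 1) * (2 * (v / 2)))%R//; last first.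
    by rewrite (mulrC 2%R) divfK// -[X in (_ * X)%R]powRr1 ?(ltW v0)// powR_mul// subrK.
apply: lee_wpmul2l => //; rewrite /W weighted_tailE//.
apply: (@le_trans _ _ (\int[lam]_(u in B) (cut a u * ((u : R) `^ (al - 1))%:E))).
  apply: nn_le_integral => u; rewrite /B /= in_itv/= => /andP[vu uv].
    by rewrite mule_ge0 ?g0// lee_fin powR_ge0.
  have u0 : (0 < u)%R by exact: lt_trans vu.
  rewrite cutE (lt_trans uv va); apply: lee_pmul; rewrite ?lee_fin ?powR_ge0 ?g0//.
    by apply: ng => //; exact: ltW.
  by rewrite -(opprB 1 al) powRN_nincr ?subr_ge0// ltW.
have mk : measurable_fun HL (fun u : R1_type R => cut a u * ((u : R) `^ (al - 1))%:E).
  by apply: emeasurable_funM; [exact/measurable_nincr/nincr_cut|exact: measurable_powR_R1].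
apply: (ge0_subset_integral lam mB (@measurable_before R t)).
- exact: (measurable_funS (@measurable_halfline R) (@subIsetl _ _ _) mk).
- move=> u []; rewrite halflineE => u0 _.
  by rewrite mule_ge0 ?cut_ge0// lee_fin powR_ge0.
- move=> u; rewrite /B /= in_itv/= halflineE => /andP[vu uv]; split.
    exact: lt_trans vu.
  by apply: le_lt_trans vu; rewrite ler_pdivlMr// mulrC.
Qed.

(** The supremum over the competitors below [a] is dominated by a tail integral,
    which integration against [t `^ (- al)] turns back into the integral of [g],
    because [al < 1]. With [a] infinite this would be the boundedness of the
    supremum operator on integrable functions. *)
Lemma prim_supop_le a : (0 < a)%R ->
  prim (supop g) a <= (2 + 3 / (1 - al))%:E * ((a `^ (1 - al))%:E * sup_avg g a).
Proof.
move=> a0; have c0 : (0 < 1 - al)%R by rewrite subr_gt0.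
set S := sup_avg g a; have S0 : 0 <= S by exact: sup_avg_ge0.
pose W := weighted_tail (al - 1) (cut a).
have mcut : measurable_fun HL (cut a) by exact/measurable_nincr/nincr_cut.
have cut0 t : (0 < t)%R -> 0 <= cut a t by exact: cut_ge0.
have W0 t : (0 < t)%R -> 0 <= W t by move=> t0; exact: weighted_tail_ge0.
have mW : measurable_fun HL W by apply: measurable_nincr; exact: nincr_weighted_tail.
pose p (t : R1_type R) : \bar R := ((t : R) `^ (- al))%:E.
have p0 t : 0 <= p t by rewrite lee_fin powR_ge0.
have mp (B : set (R1_type R)) : measurable_fun B p by exact: measurable_powR_R1.
have pL (t : R) : (0 < t)%R -> prim p t <= (t `^ (1 - al) / (1 - al))%:E.
  by move=> t0; apply: powR_integral_le => //; rewrite ltrN2.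
have mHLa := @measurable_lt_R1 R a; have mHL := @measurable_halfline R.
have sub : HL `&` [set u : R | (u < a)%R] `<=` HL by move=> u [].
have pg : prim g a <= (a `^ (1 - al))%:E * S.
  by rewrite -avgK//; apply: lee_wpmul2l; rewrite ?lee_fin ?powR_ge0//; exact: avg_le_sup.
have pW : \int[lam]_(t in HL `&` [set u : R | (u < a)%R]) (p t * W t) <=
    (1 - al)^-1%:E * prim g a.
  apply: (@le_trans _ _ (\int[lam]_(t in HL) (p t * W t))).
    apply: (ge0_subset_integral lam mHLa mHL); last exact: sub.
    - exact: (emeasurable_funM (mp _) mW).
    - by move=> t; rewrite halflineE => t0; rewrite mule_ge0 ?p0 ?W0.
  rewrite (weighted_tail_dual _ mcut cut0 (mp _)) => [|t _]; last exact: p0.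
  apply: (@le_trans _ _ (\int[lam]_(s in HL) ((1 - al)^-1%:E * cut a s))).
    apply: nn_le_integral => s; rewrite halflineE => s0.
      by rewrite !mule_ge0 ?cut0 ?lee_fin ?powR_ge0// prim_ge0.
    rewrite -muleA [leRHS]muleC; apply: lee_wpmul2l; first exact: cut0.
    apply: (@le_trans _ _ ((s `^ (al - 1))%:E * (s `^ (1 - al) / (1 - al))%:E)).
      by apply: lee_wpmul2l; rewrite ?lee_fin ?powR_ge0//; exact: pL.
    by rewrite -EFinM mulrA powR_mul// addrA subrK subrr powRr0 mul1r.
  rewrite (ge0_integralZl lam mHL mcut); last 2 first.
  - by move=> s; rewrite halflineE; exact: cut0.
  - by rewrite lee_fin invr_ge0 ltW.
  apply: lee_wpmul2l; first by rewrite lee_fin invr_ge0 ltW.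
  by rewrite /prim integral_mkcondr.
apply: (@le_trans _ _ (\int[lam]_(t in HL `&` [set u : R | (u < a)%R])
    (p t * S + 2%:E * (g t + p t * W t)))).
  apply: nn_le_integral => t [/=]; rewrite halflineE => t0 ta; first exact: supop_ge0.
  rewrite /supop -/(p t); apply: (@le_trans _ _ (p t *
    (S + 2%:E * ((t `^ al)%:E * g t + W t)))).
    by apply: lee_wpmul2l => //; exact: sup_weight_le.
  have G0 : 0 <= (t `^ al)%:E * g t by rewrite mule_ge0 ?g0// lee_fin powR_ge0.
  rewrite ge0_muleDr//; last by rewrite mule_ge0// adde_ge0// W0.
  rewrite leeD2l// [leLHS]muleCA ge0_muleDr// ?W0//.
  by rewrite muleA -EFinM powR_mul// addNr powRr0 mul1e.
have mga : measurable_fun (HL `&` [set u : R | (u < a)%R]) g.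
  exact: (measurable_funS mHL sub mg).
have mWa : measurable_fun (HL `&` [set u : R | (u < a)%R]) W.
  exact: (measurable_funS mHL sub mW).
have ga0 t : (HL `&` [set u : R | (u < a)%R]) t -> 0 <= g t.
  by move=> []; rewrite halflineE => /g0.
have Wa0 t : (HL `&` [set u : R | (u < a)%R]) t -> 0 <= p t * W t.
  by move=> []; rewrite halflineE => /W0 h _; rewrite mule_ge0.
have mpW := emeasurable_funM (mp (HL `&` [set u : R | (u < a)%R])) mWa.
have mgW := emeasurable_funD mga mpW.
have gW0 t : (HL `&` [set u : R | (u < a)%R]) t -> 0 <= g t + p t * W t.
  by move=> ht; rewrite adde_ge0 ?ga0 ?Wa0.
rewrite (ge0_integralD lam mHLa _ (emeasurable_funM (mp _) (measurable_cst S)) _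
  (emeasurable_funM (measurable_cst 2%:E) mgW)); last 2 first.
- by move=> t _; rewrite mule_ge0.
- by move=> t ht; apply: mule_ge0; [exact: lee0n|exact: gW0].
rewrite (ge0_integralZr lam mHLa (mp _) (fun t _ => p0 t) S0).
rewrite (ge0_integralZl lam mHLa mgW gW0 (lee0n 2)).
rewrite (ge0_integralD lam mHLa ga0 mga Wa0 mpW).
set A := (a `^ (1 - al))%:E * S.
have A0 : 0 <= A by rewrite mule_ge0// lee_fin powR_ge0.
have i0 : 0 <= (1 - al)^-1%:E :> \bar R by rewrite lee_fin invr_ge0 ltW.
rewrite (_ : (2 + 3 / (1 - al))%:E * A = (1 - al)^-1%:E * A + 2%:E * (A + (1 - al)^-1%:E * A)).
  apply: leeD.
    apply: (@le_trans _ _ ((a `^ (1 - al) / (1 - al))%:E * S)).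
      by apply: lee_wpmul2r => //; exact: pL.
    by rewrite /A muleA -EFinM mulrC.
  apply: lee_wpmul2l => //; apply: leeD; first exact: pg.
  by apply: le_trans pW _; exact: lee_wpmul2l.
have -> : (2 + 3 / (1 - al))%:E = (1 - al)^-1%:E + 2%:E * (1 + (1 - al)^-1%:E) :> \bar R.
  by rewrite -[1]/(1%:E) -(EFinD 1) -EFinM -EFinD; congr EFin; field; rewrite gt_eqF.
rewrite ge0_muleDl//; last by rewrite mule_ge0// adde_ge0.
by rewrite -muleA ge0_muleDl// mul1e.
Qed.

End nonincreasing.
End sup_operator.

(** * A uniformly distributed map on the Euclidean space *)

HB.instance Definition _ (R : realType) (n : nat) :=
  @Measure_isSigmaFinite.Build _ _ _ (@Rn_lebesgue R n)
    (completed_measure_extension_sigma_finite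
       (sigma_finiteT (borel_lebesgue_tuple R n))).

Section euclidean.
Variable R : realType.
Local Notation bR := (measurableTypeR R).

Definition cube (n : nat) (r : R) : set (n.-tuple bR) :=
  [set x | forall i, (`|tnth x i| < r)%R].

Arguments cube : clear implicits.

Lemma measurable_cube n r : measurable (cube n r).
Proof.
rewrite (_ : cube n r = \bigcap_(i in [set: 'I_n])
    ((fun x : n.-tuple bR => tnth x i) @^-1` [set` `](- r)%R, r[])).
  apply: fin_bigcap_measurable => // i _.
  by rewrite -[X in measurable X]setTI; apply: measurable_tnth => //; exact: measurable_itv.
apply/seteqP; split=> x h i; first by move=> _ /=; rewrite in_itv/= -ltr_norml; exact: h.
by have := h i I; rewrite /= in_itv/= -ltr_norml.
Qed.

Lemma cube_cons n r : @cons_pair R n @^-1` cube n.+1 r = [set` `](- r)%R, r[] `*` cube n r.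
Proof.
apply/seteqP; split=> -[x t] /=.
  move=> h; split; first by have := h ord0; rewrite tnth0 in_itv/= -ltr_norml.
  by move=> i; have := h (lift ord0 i); rewrite tnthS.
rewrite in_itv/= -ltr_norml => -[xr tr] i.
by have [j ->|->] := unliftP ord0 i; rewrite ?tnthS ?tnth0.
Qed.

Lemma borel_cube n r : (0 < r)%R -> borel_lebesgue_tuple R n (cube n r) = ((2 * r) ^+ n)%:E.
Proof.
move=> r0; elim: n => [|n IHn].
  by rewrite /= diracE mem_set ?expr0// => -[].
rewrite /= /lebesgue_tuple_succ /pushforward cube_cons.
rewrite product_measure1E//; last exact: measurable_cube.
rewrite /= IHn exprS EFinM; congr (_ * _).
transitivity (@lebesgue_measure R [set` `](- r)%R, r[]); first by [].
rewrite lebesgue_measure_itv/= lte_fin ifT; first by rewrite -EFinD; congr EFin; ring.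
by lra.
Qed.

Lemma Rn_cube n r : (0 < r)%R -> @Rn_lebesgue R n (cube n r) = ((2 * r) ^+ n)%:E.
Proof.
move=> r0; rewrite -borel_cube// /Rn_lebesgue /completed_measure_extension/=.
by rewrite measurable_mu_extE//; exact: measurable_cube.
Qed.

Lemma measurable_Rn_cube n r : measurable (cube n r : set (Rn_type R n)).
Proof. by apply: caratheodory_measurable_mu_ext; exact: measurable_cube. Qed.

Definition max_norm n (x : Rn_type R n) : R := \big[Num.max/0%R]_(i < n) `|tnth x i|%R.

Lemma max_norm_lt n (x : Rn_type R n) r : (0 < r)%R -> (max_norm x < r)%R <-> cube n r x.
Proof.
move=> r0; split=> [/bigmax_ltP[_ h] i|h]; first exact: h.
by apply/bigmax_ltP; split=> // i _; exact: h.
Qed.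

Lemma max_norm_ge0 n (x : Rn_type R n) : (0 <= max_norm x)%R.
Proof. exact: bigmax_ge_id. Qed.

Lemma measurable_max_norm n : measurable_fun setT (@max_norm n).
Proof.
apply: (measurability (@RGenInftyO.G R)) => [|/= _ [_] [r] -> <-].
  exact: RGenInftyO.measurableE.
rewrite setTI; have [r0|r0] := ltP 0%R r.
  rewrite (_ : _ @^-1` _ = cube n r); first exact: measurable_Rn_cube.
  by apply/seteqP; split=> x; rewrite /= in_itv/= => /max_norm_lt; exact.
rewrite (_ : _ @^-1` _ = set0)//; apply/seteqP; split=> x //=.
by rewrite in_itv/= ltNge (le_trans r0)// max_norm_ge0.
Qed.

(** [(2 |x|) ^ n] is the volume of the cube of the points closer to the origin
    than [x]; the value at the origin is arbitrary but positive. *)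
Definition vol n (x : Rn_type R n) : R :=
  if max_norm x == 0%R then 1%R else ((2 * max_norm x) ^+ n)%R.

Let side n (t : R) : R := (t `^ (n%:R^-1) / 2)%R.

Let side_gt0 n t : (0 < t)%R -> (0 < side n t)%R.
Proof. by move=> t0; rewrite divr_gt0 ?powR_gt0. Qed.

Let sideK n t : (0 < n)%N -> (0 < t)%R -> ((2 * side n t) ^+ n = t)%R.
Proof.
move=> n0 t0; rewrite mulrC divfK// -powR_mulrn ?powR_ge0// -powRrM mulVf ?powRr1//.
  exact: ltW.
by rewrite pnatr_eq0 -lt0n.
Qed.

Let norm0 n : @Rn_lebesgue R n [set x | max_norm x = 0%R] = 0 \/ n = 0%N.
Proof.
have [->|n0] := posnP n; [by right|left].
have mZ : measurable [set x : Rn_type R n | max_norm x = 0%R].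
  rewrite (_ : [set x | _] = @max_norm n @^-1` [set 0%R])//.
  by rewrite -[X in measurable X]setTI; exact: measurable_max_norm.
apply/eqP; rewrite eq_le measure_ge0 andbT; apply/lee_addgt0Pr => e e0; rewrite add0e.
rewrite -(sideK n0 e0) -Rn_cube ?side_gt0//; apply: le_measure; rewrite ?inE//.
  exact: measurable_Rn_cube.
by move=> x /= x0; apply/max_norm_lt; rewrite ?x0 side_gt0.
Qed.

Lemma uniform_vol n : (0 < n)%N -> uniform_map (@Rn_lebesgue R n) setT (@vol n).
Proof.
move=> n0.
have mvol : measurable_fun setT (@vol n).
  apply: measurable_fun_ifT.
  - apply: measurable_fun_eqr; [exact: measurable_max_norm|exact: measurable_cst].
  - exact: measurable_cst.
  - apply: measurable_funX; apply: measurable_funM; [exact: measurable_cst|exact: measurable_max_norm].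
split=> //.
  move=> x _; rewrite /vol; case: ifPn => // xn0.
  by rewrite exprn_gt0// mulr_gt0// lt_neqAle eq_sym xn0 max_norm_ge0.
move=> t t0; rewrite setTI.
have volt x : max_norm x != 0%R -> (vol x < t)%R <-> cube n (side n t) x.
  move=> xn0; rewrite /vol (negbTE xn0) -{1}(sideK n0 t0) ltr_pXn2r//; last 2 first.
  - by rewrite nnegrE mulr_ge0// max_norm_ge0.
  - by rewrite nnegrE mulr_ge0// ltW// side_gt0.
  by rewrite ltr_pM2l//; apply: max_norm_lt; exact: side_gt0.
have mvt : measurable [set x : Rn_type R n | (vol x < t)%R].
  rewrite (_ : [set x | _] = @vol n @^-1` [set` `]-oo, t[]).
    by rewrite -[X in measurable X]setTI; apply: mvol => //; exact: measurable_itv.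
  by apply/seteqP; split=> x /=; rewrite in_itv.
have mZ : measurable [set x : Rn_type R n | max_norm x = 0%R].
  rewrite (_ : [set x | _] = @max_norm n @^-1` [set 0%R])//.
  by rewrite -[X in measurable X]setTI; exact: measurable_max_norm.
have Z0 : @Rn_lebesgue R n [set x | max_norm x = 0%R] = 0.
  by have [//|n00] := @norm0 n; rewrite n00 in n0.
have cE : @Rn_lebesgue R n (cube n (side n t)) = t%:E.
  by rewrite Rn_cube ?side_gt0// sideK.
have mc := @measurable_Rn_cube n (side n t).
apply/eqP; rewrite eq_le; apply/andP; split.
  rewrite -cE; apply: le_measure; rewrite ?inE// => x /= xt.
  have [x0|x0] := eqVneq (max_norm x) 0%R; last exact/volt.
  by apply/max_norm_lt; rewrite ?x0 side_gt0.
rewrite -cE; apply: (@le_trans _ _ (@Rn_lebesgue R n ([set x : Rn_type R n | (vol x < t)%R] `|`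
    [set x : Rn_type R n | max_norm x = 0%R]))).
  apply: le_measure; rewrite ?inE//; first exact: measurableU.
  move=> x xt; have [x0|x0] := eqVneq (max_norm x) 0%R; [by right|left].
  exact/volt.
apply: (le_trans (measureU2 _ _ _)) => //; rewrite -[leRHS]adde0; apply: leeD => //.
by rewrite le_eqVlt; apply/orP; left; apply/eqP; exact: Z0.
Qed.

End euclidean.

(** * Rearrangement-invariant norms and their associates *)

Section ri_norm_theory.
Context d (T : measurableType d) (R : realType).
Variables (mu : {measure set T -> \bar R}) (D : set T).
Hypothesis mD : measurable D.
Variable rho : (T -> \bar R) -> \bar R.
Hypothesis ri : ri_norm mu D rho.
Local Notation Mp := (@nonneg_meas_funs d T R D).

Lemma ri_norm_le_on f g : Mp f -> Mp g -> (forall x, D x -> f x <= g x) ->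
  rho f <= rho g.
Proof. by move=> Mf Mg fg; apply: (ri_norm_le ri) => //; exact: aeW. Qed.

Lemma ri_norm_eq_on f g : Mp f -> Mp g -> (forall x, D x -> f x = g x) ->
  rho f = rho g.
Proof.
move=> Mf Mg fg; apply/eqP; rewrite eq_le.
by apply/andP; split; apply: ri_norm_le_on => // x Dx; rewrite fg.
Qed.

Lemma Mp_abs f : measurable_fun D f -> Mp (fun x => `|f x|).
Proof. by move=> mf; split=> //; exact: measurableT_comp. Qed.

Lemma ri_space_normE f : Mp f -> ri_space_norm rho f = rho f.
Proof.
move=> Mf; apply: ri_norm_eq_on => //; first by apply: Mp_abs; case: Mf.
by move=> x Dx; rewrite gee0_abs//; case: Mf => _; exact.
Qed.

(** Hoelder's inequality, by homogeneity; when the norm of [g] vanishes, so does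
    [g] almost everywhere. *)
Lemma associate_holder f g : Mp f -> Mp g -> rho g < +oo ->
  \int[mu]_(x in D) (g x * f x) <= associate_norm mu D rho f * rho g.
Proof.
move=> [mf f0] [mg g0] gy; have Mg : Mp g by [].
have rg0 := ri_norm_ge0 ri Mg.
have mgf : measurable_fun D (fun x => g x * f x) by exact: emeasurable_funM.
have [z|nz] := eqVneq (rho g) 0.
  rewrite z mule0 le_eqVlt; apply/orP; left; apply/eqP.
  have /(ri_norm_eq0 ri Mg) z0 := z.
  rewrite -(integral0 mu D); apply: ge0_ae_eq_integral => //.
  - by move=> x Dx; rewrite mule_ge0 ?g0 ?f0.
  - by apply: filterS z0 => x h Dx; rewrite h// mul0e.
case E : (rho g) rg0 nz gy => [c| |//] c0 cn0 cy; last by rewrite ltxx in cy.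
have {c0 cn0} c0 : (0 < c)%R by rewrite lt_neqAle eq_sym -eqe cn0.
have ci0 : (0 <= c^-1)%R by rewrite invr_ge0 ltW.
pose q x := c^-1%:E * g x.
have Mq : Mp q.
  split; first by apply: emeasurable_funM => //; exact: measurable_cst.
  by move=> x Dx; rewrite mule_ge0 ?lee_fin// g0.
have q1 : rho q <= 1.
  by rewrite (ri_normZ ri)// E -EFinM mulVf// gt_eqF.
have -> : \int[mu]_(x in D) (g x * f x) = c%:E * \int[mu]_(x in D) (q x * f x).
  rewrite -ge0_integralZl//.
  - apply: eq_integral => x _; rewrite /q !muleA -EFinM divff ?mul1e//.
    by rewrite gt_eqF.
  - by apply: emeasurable_funM => //; case: Mq.
  - by move=> x Dx; rewrite mule_ge0 ?f0//; case: Mq => _; exact.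
  - by rewrite lee_fin ltW.
rewrite muleC; apply: lee_wpmul2r; first by rewrite lee_fin ltW.
by apply: ereal_sup_ubound; exists q.
Qed.

End ri_norm_theory.

Section ri_norm_halfline.
Variable R : realType.
Local Notation HL := (@halfline R).
Local Notation MpH := (@nonneg_meas_funs _ (R1_type R) R HL).

Lemma Mp_rearr d (T : measurableType d) (m : {measure set T -> \bar R}) (D : set T)
    (f : T -> \bar R) : MpH (rearr m D f).
Proof.
split; first by apply: measurable_nincr => s t _ st; exact: rearr_nincr.
by move=> t _; exact: rearr_ge0.
Qed.

Lemma Mp_nincr (A : R1_type R -> \bar R) : nincr A ->
  (forall t : R, (0 < t)%R -> 0 <= A t) -> MpH A.
Proof.
by move=> nA A0; split; [exact: measurable_nincr|move=> t; rewrite halflineE; exact: A0].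
Qed.

Variable rho : (R1_type R -> \bar R) -> \bar R.
Hypothesis ri : ri_norm lam HL rho.

Lemma ri_norm_rearr f : MpH f -> rho f = rho (rearr lam HL f).
Proof.
move=> Mf; apply: (ri_norm_equimeasurable ri) => //; first exact: Mp_rearr.
by move=> t _; rewrite (rearr_idem _ (@measurable_halfline R))//; case: Mf.
Qed.

End ri_norm_halfline.

Section representation.
Variables (R : realType) (n : nat).
Variables (rho : (Rn_type R n -> \bar R) -> \bar R)
  (rhobar : (R1_type R -> \bar R) -> \bar R).
Hypotheses (n0 : (0 < n)%N) (repr : representation_norm rho rhobar).
Local Notation mu := (@Rn_lebesgue R n).
Local Notation HL := (@halfline R).
Local Notation sigma := (@vol R n).
Local Notation MpH := (@nonneg_meas_funs _ (R1_type R) R HL).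
Local Notation MpR := (@nonneg_meas_funs _ (Rn_type R n) R setT).

Let us : uniform_map mu setT sigma := uniform_vol R n0.
Let ri : ri_norm lam HL rhobar := repr.1.

Lemma Mp_uniform (A : R1_type R -> \bar R) : nincr A ->
  (forall t : R, (0 < t)%R -> 0 <= A t) -> MpR (A \o sigma).
Proof.
move=> nA A0; split; first exact: (measurable_nincr_comp measurableT us nA).
exact: (uniform_ge0 us A0).
Qed.

Lemma repr_rearr f : MpR f -> rho f = rhobar (rearr mu setT f).
Proof.
move=> [mf f0].
have -> : rho f = ri_space_norm rho f.
  by congr rho; apply/funext => x; rewrite gee0_abs// f0.
rewrite repr.2//; congr rhobar; apply/funext => t; exact: abs_rearr.
Qed.

(** Composition with [vol] realizes the representation space on nonincreasing
    functions. *)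
Lemma repr_uniform (A : R1_type R -> \bar R) : nincr A ->
  (forall t : R, (0 < t)%R -> 0 <= A t) -> rho (A \o sigma) = rhobar A.
Proof.
move=> nA A0; rewrite repr_rearr; last exact: Mp_uniform.
by rewrite (rearr_uniform measurableT us)// -(ri_norm_rearr ri)//; exact: Mp_nincr.
Qed.

End representation.

Section representation_associate.
Variables (R : realType) (n : nat).
Variables (rho : (Rn_type R n -> \bar R) -> \bar R)
  (rhobar rhobar' : (R1_type R -> \bar R) -> \bar R).
Hypotheses (n0 : (0 < n)%N) (ri_rho : ri_norm (@Rn_lebesgue R n) setT rho)
  (repr : representation_norm rho rhobar)
  (repr' : representation_norm (associate_norm (@Rn_lebesgue R n) setT rho) rhobar').
Local Notation HL := (@halfline R).

(** Only nonincreasing functions are paired on the half-line, so that a product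
    of two of them can be transported to the Euclidean space. *)
Lemma repr_holder (A B : R1_type R -> \bar R) : nincr A -> nincr B ->
  (forall t : R, (0 < t)%R -> 0 <= A t) -> (forall t : R, (0 < t)%R -> 0 <= B t) ->
  rhobar A < +oo ->
  \int[lam]_(t in HL) (A t * B t) <= rhobar' B * rhobar A.
Proof.
move=> nA nB A0 B0 Ay; have us := uniform_vol R n0.
have nAB : nincr (fun t => A t * B t).
  move=> s t s0 st; have t0 : (0 < t)%R by exact: lt_le_trans st.
  by apply: lee_pmul; [exact: A0|exact: B0|exact: nA|exact: nB].
rewrite -(integral_uniform_map measurableT us nAB); last first.
  by move=> t t0; rewrite mule_ge0 ?A0 ?B0.
rewrite -(repr_uniform n0 repr nA A0) -(repr_uniform n0 repr' nB B0).
have Ay' : rho (A \o @vol R n) < +oo by rewrite (repr_uniform n0 repr).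
exact: (associate_holder measurableT ri_rho (Mp_uniform n0 nB B0) (Mp_uniform n0 nA A0) Ay').
Qed.

(** By the Hardy-Littlewood inequality a test function may be replaced by its
    rearrangement. *)
Lemma repr_associate_le (A : R1_type R -> \bar R) (c : \bar R) : nincr A ->
  (forall t : R, (0 < t)%R -> 0 <= A t) ->
  (forall g : R1_type R -> \bar R, nincr g -> rcont g ->
     (forall t : R, (0 < t)%R -> 0 <= g t) -> rhobar g <= 1 ->
     rearr lam HL g = g -> \int[lam]_(t in HL) (A t * g t) <= c) ->
  rhobar' A <= c.
Proof.
move=> nA A0 h; rewrite -(repr_uniform n0 repr' nA A0).
apply: ge_ereal_sup => _ /= [q [Mq q1] <-].
have us := uniform_vol R n0.
have [mq q0] := Mq.
under eq_integral do rewrite muleC.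
apply: le_trans (hardy_littlewood measurableT us nA A0 mq q0) _; apply: h.
- exact: nincr_rearr.
- exact: rcont_rearr.
- by move=> t _; exact: rearr_ge0.
- by rewrite -(repr_rearr repr).
- exact: rearr_idem.
Qed.

End representation_associate.

Section necessity.
Variables (R : realType) (n : nat) (al : R).
Variables (rho : (Rn_type R n -> \bar R) -> \bar R)
  (rhobar rhobar' : (R1_type R -> \bar R) -> \bar R).
Hypotheses (al0 : (0 < al)%R) (al1 : (al < 1)%R).
Hypotheses (n0 : (0 < n)%N) (ri_rho : ri_norm (@Rn_lebesgue R n) setT rho)
  (repr : representation_norm rho rhobar)
  (repr' : representation_norm (associate_norm (@Rn_lebesgue R n) setT rho) rhobar').
Local Notation HL := (@halfline R).
Local Notation wt := (weighted_tail (al - 1)).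

(** Replacing [avg g] by its nonincreasing majorant allows the rearrangement of
    [h]; the mean of [supop al g] pays for this majorant. *)
Lemma weighted_tail_rearr_le (h : R1_type R -> \bar R) (g : R1_type R -> \bar R) :
  nonneg_meas_funs HL h -> nincr g -> (forall t : R, (0 < t)%R -> 0 <= g t) ->
  \int[lam]_(t in HL) (g t * wt h t) <=
  (1 + (1 - al)^-1)%:E *
    \int[lam]_(t in HL) (supop al g t * wt (rearr lam HL h) t).
Proof.
move=> [mh h0] ng g0; have mHL := @measurable_halfline R.
have h0' t : (0 < t)%R -> 0 <= h t by rewrite -halflineE; exact: h0.
have c0 : (0 <= 1 + (1 - al)^-1)%R by rewrite addr_ge0// invr_ge0 subr_ge0 ltW.
have nT := nincr_supop al0 g0; have T0 t : (0 < t)%R -> 0 <= supop al g t by exact: supop_ge0.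
have r0 t : 0 <= rearr lam HL h t by exact: rearr_ge0.
have mr : measurable_fun HL (rearr lam HL h) by exact: measurable_rearr.
have mT : measurable_fun HL (supop al g) by exact: measurable_nincr.
have mavgT : measurable_fun HL (fun s : R1_type R =>
    rearr lam HL h s * ((s : R) `^ (al - 1))%:E * prim (supop al g) s).
  apply: emeasurable_funM; last exact: measurable_prim.
  by apply: emeasurable_funM => //; exact: measurable_powR_R1.
rewrite (weighted_tail_dual _ mh h0' (measurable_nincr ng) g0).
apply: (@le_trans _ _ (\int[lam]_(s in HL) (sup_avg al g s * h s))).
  apply: nn_le_integral => s; rewrite halflineE => s0.
    by rewrite !mule_ge0 ?h0' ?prim_ge0// lee_fin powR_ge0.
  by rewrite -muleA muleC; apply: lee_wpmul2r; [exact: h0'|exact: avg_le_sup].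
apply: (le_trans (hardy_littlewood mHL (@uniform_map_id R) _ _ mh h0)).
- exact: nincr_sup_avg.
- by move=> s _; exact: sup_avg_ge0.
rewrite (weighted_tail_dual _ mr (fun t _ => r0 t) mT T0).
rewrite -(ge0_integralZl lam mHL mavgT); last 2 first.
- by move=> s; rewrite halflineE => s0; rewrite !mule_ge0 ?prim_ge0// lee_fin powR_ge0.
- by rewrite lee_fin.
apply: nn_le_integral => s; rewrite halflineE => s0.
  by rewrite mule_ge0// sup_avg_ge0.
rewrite -(muleA (rearr _ _ _ _)) -/(avg al _ s) muleCA [leLHS]muleC; apply: lee_wpmul2l => //.
exact: sup_avg_le_supop.
Qed.

(** The norm of the tail of [h] is tested on the nonincreasing [g] in the unit
    ball. The lemma above replaces [g] by [supop al g] and [h] by its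
    rearrangement, and Hoelder's inequality applies to the result. *)
Lemma bounded_sup_operator_tail :
  bounded_operator HL rhobar rhobar (sup_operator al) ->
  exists2 C : R, (0 < C)%R &
    forall f : Rn_type R n -> \bar R, nonneg_meas_funs setT f ->
      ereal_sup
        [set ri_space_norm rhobar' (wt h)
        | h in [set h : R1_type R -> \bar R |
                 nonneg_meas_funs HL h /\
                 equimeasurable lam HL (@Rn_lebesgue R n) setT h f]]
      <= C%:E * ri_space_norm rhobar' (wt (rearr (@Rn_lebesgue R n) setT f)).
Proof.
move=> [C C0 Cb]; have c0 : (0 < 1 + (1 - al)^-1)%R.
  by rewrite ltr_wpDr// invr_ge0 subr_ge0 ltW.
exists ((1 + (1 - al)^-1) * C)%R; first by rewrite mulr_gt0.
move=> f [mf f0]; apply: ge_ereal_sup => _ /= [h [Mh hf] <-].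
have mHL := @measurable_halfline R.
have ri := repr.1; have ri' := repr'.1.
have [mh h0] := Mh; have h0' t : (0 < t)%R -> 0 <= h t by rewrite -halflineE; exact: h0.
have nwh : nincr (wt h) by exact: nincr_weighted_tail.
have wh0 t : (0 < t)%R -> 0 <= wt h t by exact: weighted_tail_ge0.
set fr := rearr _ _ f.
have nwf : nincr (wt fr) by apply: nincr_weighted_tail; [exact: measurable_rearr|move=> *; exact: rearr_ge0].
have wf0 t : (0 < t)%R -> 0 <= wt fr t.
  by apply: weighted_tail_ge0 => *; exact: rearr_ge0.
have Mwf := Mp_nincr nwf wf0.
rewrite (ri_space_normE ri'); last exact: Mp_nincr.
rewrite (ri_space_normE ri')//.
apply: (repr_associate_le n0 repr repr') => // g ng rg g0 g1 gE.
have nT := nincr_supop al0 g0.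
have T0 t : (0 < t)%R -> 0 <= supop al g t by exact: supop_ge0.
have Mg := Mp_nincr ng g0.
have TC : rhobar (supop al g) <= C%:E.
  rewrite -(ri_space_normE ri (Mp_nincr nT T0)).
  have -> : supop al g = sup_operator al g by rewrite /sup_operator gE.
  apply: le_trans (Cb _ _) _.
    split; first exact: Mg.1.
    by rewrite (ri_space_normE ri)// (le_lt_trans g1)// ltry.
  rewrite (ri_space_normE ri)// -[leRHS]mule1; apply: lee_wpmul2l => //.
  by rewrite lee_fin ltW.
under eq_integral do rewrite muleC.
apply: le_trans (weighted_tail_rearr_le Mh ng g0) _.
rewrite EFinM -muleA; apply: lee_wpmul2l; first by rewrite lee_fin ltW.
have wE t : HL t -> wt (rearr lam HL h) t = wt fr t.
  rewrite halflineE => t0.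
  rewrite (weighted_tailE _ _ t0) (weighted_tailE _ fr t0); apply: eq_integral => s.
  by rewrite inE => -[]; rewrite halflineE => s0 _; congr (_ * _); exact: hf.
have -> : \int[lam]_(t in HL) (supop al g t * wt (rearr lam HL h) t) =
    \int[lam]_(t in HL) (supop al g t * wt fr t).
  by apply: eq_integral => t; rewrite inE => /wE ->.
have Ty : rhobar (supop al g) < +oo by exact: le_lt_trans TC (ltry _).
apply: (le_trans (repr_holder n0 ri_rho repr repr' nT nwf T0 wf0 Ty)).
by rewrite muleC; apply: lee_wpmul2r TC; exact: (ri_norm_ge0 ri' Mwf).
Qed.

End necessity.

(** * Step functions on a uniform grid *)

Section grid.
Variable R : realType.
Local Notation HL := (@halfline R).
Local Notation MpH := (@nonneg_meas_funs _ (R1_type R) R HL).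
Implicit Types (d t : R) (k : nat).

Definition slot d t : nat := Num.truncn (t / d)%R.

Definition cell d k : set (R1_type R) := HL `&` [set t : R | slot d t = k].

Lemma slot_eq d t k : (0 < d)%R -> (0 <= t)%R ->
  (slot d t == k) = ((k%:R * d <= t)%R && (t < k.+1%:R * d)%R).
Proof.
move=> d0 t0; rewrite truncn_eq ?divr_ge0 ?(ltW d0)//.
by rewrite ler_pdivlMr// ltr_pdivrMr.
Qed.

Lemma slotP d t : (0 < d)%R -> (0 <= t)%R ->
  ((slot d t)%:R * d <= t)%R /\ (t < (slot d t).+1%:R * d)%R.
Proof. by move=> d0 t0; apply/andP; rewrite -slot_eq. Qed.

Lemma slot_le d t k : (0 < d)%R -> (slot d t <= k)%N = (t < k.+1%:R * d)%R.
Proof. by move=> d0; rewrite /slot truncn_le_nat ltr_pdivrMr. Qed.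

Lemma slot_ge d t k : (0 < d)%R -> (0 <= t)%R -> (k <= slot d t)%N = (k%:R * d <= t)%R.
Proof. by move=> d0 t0; rewrite /slot truncn_ge_nat ?divr_ge0 ?(ltW d0)// ler_pdivlMr. Qed.

Lemma slot_homo d s t : (0 < d)%R -> (s <= t)%R -> (slot d s <= slot d t)%N.
Proof. by move=> d0 st; apply: le_truncn; rewrite ler_pM2r ?invr_gt0. Qed.

Lemma cell_itv d k : (0 < d)%R -> exists b : bool,
  cell d k = [set` Interval (BSide b (k%:R * d)%R) (BLeft (k.+1%:R * d)%R)].
Proof.
move=> d0; exists (0 < k)%N; apply/seteqP; split=> t; rewrite /cell /= halflineE in_itv/=.
  move=> [t0 /eqP]; rewrite slot_eq ?(ltW t0)// => /andP[kt ->]; rewrite andbT.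
  by case: k kt => [|k] //= _; rewrite mul0r.
move=> /andP[kt tk]; have t0 : (0 < t)%R.
  case: k kt tk => [|k] /=; rewrite ?mul0r// => kt _; apply: lt_le_trans kt.
  by rewrite mulr_gt0.
split=> //; apply/eqP; rewrite slot_eq ?(ltW t0)// tk andbT.
by case: k kt {tk} => [|k] //=; rewrite mul0r => /ltW.
Qed.

Lemma measurable_cell d k : (0 < d)%R -> measurable (cell d k).
Proof.
by move=> /(cell_itv k)[b ->]; apply: measurable_R1; exact: measurable_itv.
Qed.

Lemma lam_cell d k : (0 < d)%R -> lam (cell d k) = d%:E.
Proof.
move=> d0; have [b ->] := cell_itv k d0.
transitivity (@lebesgue_measure R
  [set` Interval (BSide b (k%:R * d)%R) (BLeft (k.+1%:R * d)%R)]); first by [].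
rewrite lebesgue_measure_itv/= lte_fin ltr_pM2r// ltr_nat ltnSn -EFinD; congr EFin.
by rewrite -natr1; ring.
Qed.

Section gstep.
Variables (I : finType) (d : R).
Hypothesis d0 : (0 < d)%R.
Implicit Types (e : I -> nat) (w : I -> R).

(** The placement [e] of the values is a parameter, so that moving the cells is a
    change of [e], and subdividing them a change of the index type. *)
Definition gstep e w : R1_type R -> \bar R :=
  fun t : R => (\sum_i w i * (slot d t == e i)%:R)%:E.

Lemma gstep_ge0 e w t : (forall i, (0 <= w i)%R) -> 0 <= gstep e w t.
Proof. by move=> w0; rewrite lee_fin sumr_ge0// => i _; rewrite mulr_ge0. Qed.

Lemma gstep_at e w (i : I) t : injective e -> slot d t = e i -> gstep e w t = (w i)%:E.
Proof.
move=> ie te; rewrite /gstep te (bigD1 i)//= eqxx mulr1 big1 ?addr0// => j ji.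
by rewrite (_ : _ == _ = false) ?mulr0//; apply/negbTE; rewrite eq_sym (inj_eq ie).
Qed.

Lemma gstep_out e w t : (forall i, slot d t != e i) -> gstep e w t = 0.
Proof. by move=> h; rewrite /gstep big1// => i _; rewrite (negbTE (h i)) mulr0. Qed.

Lemma gstep_le e w (B : R1_type R -> \bar R) : injective e ->
  (forall t : R, (0 < t)%R -> 0 <= B t) ->
  (forall i (t : R), (0 < t)%R -> slot d t = e i -> (w i)%:E <= B t) ->
  forall t : R, (0 < t)%R -> gstep e w t <= B t.
Proof.
move=> ie B0 h t t0; have [[i te]|ne] := pselect (exists i, slot d t = e i).
  by rewrite (gstep_at w ie te); exact: h.
by rewrite gstep_out ?B0// => i; apply/eqP => te; apply: ne; exists i.
Qed.

Let patch_cell (A : R1_type R -> \bar R) k := A \_ [set t : R | slot d t = k].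

Let patch_cellE (A : R1_type R -> \bar R) k (t : R) :
  patch_cell A k t = (slot d t == k)%:R%:E * A t.
Proof.
rewrite /patch_cell /patch; have [<-|tk] := eqVneq (slot d t) k.
  by rewrite mem_set ?mul1e.
by rewrite memNset ?mul0e//= => /eqP; rewrite (negbTE tk).
Qed.

Let gstep_mulE e w (A : R1_type R -> \bar R) (t : R1_type R) : (forall i, (0 <= w i)%R) ->
  gstep e w t * A t = \sum_i (w i)%:E * patch_cell A (e i) t.
Proof.
move=> w0; rewrite /gstep -sumEFin ge0_sume_distrl => [|i _]; last by rewrite lee_fin mulr_ge0.
by apply: eq_bigr => i _; rewrite patch_cellE muleA EFinM.
Qed.

Let measurable_patch_cell (A : R1_type R -> \bar R) k : measurable_fun HL A ->
  measurable_fun HL (patch_cell A k).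
Proof.
move=> mA; have mHL := @measurable_halfline R; have mc := measurable_cell k d0.
have : measurable_fun HL (A \_ (cell d k)).
  exact: ((measurable_restrict A mc mHL).1 (measurable_funS mHL (@subIsetl _ _ _) mA)).
apply: eq_measurable_fun => t; rewrite inE => tH.
by rewrite /patch_cell /patch /cell in_setI mem_set.
Qed.

Lemma Mp_gstep e w : (forall i, (0 <= w i)%R) -> MpH (gstep e w).
Proof.
move=> w0; split; last by move=> t _; exact: gstep_ge0.
rewrite (_ : gstep e w = fun t => \sum_i (w i)%:E * patch_cell (cst 1) (e i) t).
  apply: emeasurable_sum => i; apply: emeasurable_funM; first exact: measurable_cst.
  by apply: measurable_patch_cell; exact: measurable_cst.
by apply/funext => t; rewrite -gstep_mulE// mule1.
Qed.

Lemma integral_gstep e w (A : R1_type R -> \bar R) : (forall i, (0 <= w i)%R) ->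
  measurable_fun HL A -> (forall t : R, (0 < t)%R -> 0 <= A t) ->
  \int[lam]_(t in HL) (gstep e w t * A t) =
  \sum_i (w i)%:E * \int[lam]_(t in cell d (e i)) A t.
Proof.
move=> w0 mA A0; have mHL := @measurable_halfline R.
have mP k := measurable_patch_cell k mA.
have P0 k t : HL t -> 0 <= patch_cell A k t.
  by rewrite halflineE => t0; rewrite patch_cellE mule_ge0 ?A0// lee_fin.
have -> : \int[lam]_(t in HL) (gstep e w t * A t) =
    \int[lam]_(t in HL) \sum_i (w i)%:E * patch_cell A (e i) t.
  by apply: eq_integral => t _; exact: gstep_mulE.
rewrite (ge0_integral_sum lam mHL); last 2 first.
- by move=> i; exact: (emeasurable_funM (measurable_cst _) (mP _)).
- by move=> i t ht; apply: mule_ge0; [rewrite lee_fin|exact: P0].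
apply: eq_bigr => i _.
rewrite (ge0_integralZl lam mHL (mP _) (P0 _)); last by rewrite lee_fin.
by rewrite /cell integral_mkcondr.
Qed.

Lemma gstep_superlevel e w (m : R) : injective e -> (0 <= m)%R -> (forall i, (0 <= w i)%R) ->
  lam (HL `&` [set t : R1_type R | m%:E < gstep e w t]) =
  \sum_i (m < w i)%R%:R%:E * d%:E.
Proof.
move=> ie m0 w0; have mHL := @measurable_halfline R.
set L := HL `&` _.
have mL : measurable L by apply: measurable_superlevel => //; case: (Mp_gstep e w0).
have -> : lam L = \int[lam]_(t in HL) (\1_L t)%:E.
  by rewrite (integral_indic lam mHL mL) setIC setIA setIid.
transitivity (\int[lam]_(t in HL) (gstep e (fun i => (m < w i)%R%:R) t * cst 1 t)).
  apply: eq_integral => t; rewrite inE => tH; rewrite mule1 indicE.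
  have [[i te]|ne] := pselect (exists i, slot d t = e i).
    rewrite (gstep_at _ ie te); congr (_%:R%:E); rewrite /L in_setI mem_set//=.
    rewrite (_ : (t \in _) = (m%:E < gstep e w t)); last by apply/idP/idP; rewrite inE.
    by rewrite (gstep_at _ ie te) lte_fin.
  have out i : slot d t != e i by apply/eqP => te; apply: ne; exists i.
  rewrite gstep_out// memNset//= => -[_ /=].
  by rewrite gstep_out// lte_fin ltNge m0.
rewrite integral_gstep//.
apply: eq_bigr => i _; congr (_ * _).
by rewrite (integral_cst lam (measurable_cell (e i) d0)) mul1e; exact: lam_cell.
Qed.

End gstep.

(** The distribution function of a step function counts the values above a level,
    wherever their cells are. *)
Lemma rearr_gstep (I J : finType) d (e : I -> nat) (w : I -> R) (e' : J -> nat) (w' : J -> R) :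
  (0 < d)%R -> injective e -> injective e' ->
  (forall i, (0 <= w i)%R) -> (forall j, (0 <= w' j)%R) ->
  (forall m : R, \sum_i (m < w i)%R%:R = \sum_j (m < w' j)%R%:R :> R)%R ->
  rearr lam HL (gstep d e w) = rearr lam HL (gstep d e' w').
Proof.
move=> d0 ie ie' w0 w0' E; apply: rearr_distr => m m0.
rewrite (ge0_distrE lam m (fun t _ => gstep_ge0 d e t w0)).
rewrite (ge0_distrE lam m (fun t _ => gstep_ge0 d e' t w0')).
apply: (etrans (gstep_superlevel d0 ie (ltW m0) w0)).
apply: (etrans _ (esym (gstep_superlevel d0 ie' (ltW m0) w0'))).
by rewrite -!ge0_sume_distrl// !sumEFin E.
Qed.

End grid.

(** * Dyadic approximation from below *)

Section dyadic.
Variable R : realType.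
Local Notation HL := (@halfline R).

Definition mesh (N : nat) : R := (2 ^+ N)^-1%R.

Lemma mesh_gt0 N : (0 < mesh N)%R. Proof. by rewrite invr_gt0 exprn_gt0. Qed.

Lemma meshS N : mesh N = (2 * mesh N.+1)%R.
Proof. by rewrite /mesh exprS invfM mulrA divff// mul1r. Qed.

Lemma mesh_le N k : (k <= N)%N -> (mesh N <= k.+1%:R^-1)%R.
Proof.
move=> kN; rewrite lef_pV2 ?posrE ?exprn_gt0// -natrX ler_nat.
by apply: leq_trans (ltn_expl N (ltnSn 1)).
Qed.

Variable G : R1_type R -> \bar R.
Hypotheses (nG : nincr G) (rG : rcont G) (G0 : forall t : R, (0 < t)%R -> 0 <= G t).

(** Taking the value at the right end of the cell keeps the step below the
    nonincreasing [G], and increasing with [N]; the cap makes it finite. *)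
Definition dyadic_val (N k : nat) : R :=
  fine (Order.min (N%:R%:E) (G (k.+1%:R * mesh N)%R)).

Definition dyadic (N : nat) : R1_type R -> \bar R :=
  fun t : R => (dyadic_val N (slot (mesh N) t))%:E.

Let right_gt0 N k : (0 < k.+1%:R * mesh N)%R.
Proof. by rewrite mulr_gt0 ?mesh_gt0. Qed.

Lemma dyadic_valE N k :
  (dyadic_val N k)%:E = Order.min (N%:R%:E) (G (k.+1%:R * mesh N)%R).
Proof.
rewrite fineK// ge0_fin_numE.
  by rewrite gt_min ltry.
by rewrite le_min lee_fin ler0n/= G0.
Qed.

Lemma dyadic_val_ge0 N k : (0 <= dyadic_val N k)%R.
Proof. by rewrite -lee_fin dyadic_valE le_min lee_fin ler0n/= G0. Qed.

Lemma dyadic_val_le N k : (dyadic_val N k <= N%:R)%R.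
Proof. by rewrite -lee_fin dyadic_valE ge_min lexx. Qed.

Lemma dyadic_val_leG N k : (dyadic_val N k)%:E <= G (k.+1%:R * mesh N)%R.
Proof. by rewrite dyadic_valE ge_min lexx orbT. Qed.

Lemma dyadic_val_nincr N k l : (k <= l)%N -> (dyadic_val N l <= dyadic_val N k)%R.
Proof.
move=> kl; rewrite -lee_fin !dyadic_valE le_min !ge_min lexx/=; apply/orP; right.
by apply: nG => //; rewrite ler_pM2r ?mesh_gt0// ler_nat.
Qed.

Lemma dyadic_ge0 N t : 0 <= dyadic N t.
Proof. by rewrite lee_fin dyadic_val_ge0. Qed.

Lemma dyadic_val_le_slot N k (t : R) : (0 < t)%R -> slot (mesh N) t = k ->
  (dyadic_val N k)%:E <= G t.
Proof.
move=> t0 <-; apply: le_trans (dyadic_val_leG _ _) _; apply: nG => //; apply: ltW.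
by apply: (slotP _ _).2; [exact: mesh_gt0|exact: ltW].
Qed.

Lemma dyadic_le N (t : R) : (0 < t)%R -> dyadic N t <= G t.
Proof. by move=> t0; exact: dyadic_val_le_slot. Qed.

Lemma nincr_dyadic N : nincr (dyadic N).
Proof.
move=> s t s0 st; rewrite lee_fin; apply: dyadic_val_nincr.
by apply: slot_homo => //; exact: mesh_gt0.
Qed.

Lemma nondecreasing_dyadic (t : R) : (0 < t)%R -> nondecreasing_seq (dyadic ^~ t).
Proof.
move=> t0; apply/nondecreasing_seqP => N; rewrite /dyadic !dyadic_valE le_min !ge_min.
apply/andP; split; first by rewrite lee_fin ler_nat leqnSn.
apply/orP; right; apply: nG => //.
set k := slot (mesh N) t; set l := slot _ t.
have kE : (k.+1%:R * mesh N = k.*2.+2%:R * mesh N.+1)%R.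
  by rewrite meshS mulrA -doubleS -muln2 natrM.
have lk : (l <= k.*2.+1)%N.
  rewrite slot_le ?mesh_gt0// -kE.
  by apply: (slotP _ _).2; [exact: mesh_gt0|exact: ltW].
by rewrite kE ler_pM2r ?mesh_gt0// ler_nat ltnS.
Qed.

(** The right ends of the cells of [t] tend to [t] from the right. *)
Lemma cvg_dyadic (t : R) : (0 < t)%R -> dyadic ^~ t @ \oo --> G t.
Proof.
move=> t0; have -> : G t = ereal_sup (range (dyadic ^~ t)).
  apply/eqP; rewrite eq_le; apply/andP; split; last first.
    by apply: ge_ereal_sup => _ [N _ <-]; exact: dyadic_le.
  rewrite leNgt; apply/negP => lt.
  have s0 : 0 <= ereal_sup (range (dyadic ^~ t)).
    by apply: le_trans (dyadic_ge0 0 t) _; apply: ereal_sup_ubound; exists 0%N.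
  case E : (ereal_sup _) s0 lt => [l| |] // l0 lt; last by rewrite ltNge leey in lt.
  have [s ts ls] := rG t0 lt.
  have [N lN tN] : exists2 N : nat, (l < N%:R)%R & (t + mesh N <= s)%R.
    have /ltr_add_invr[k tk] := ts.
    exists (maxn k (Num.truncn l).+1).
      apply: lt_le_trans (truncnS_gt l) _; by rewrite ler_nat leq_maxr.
    apply: le_trans (ltW tk); rewrite lerD2l; apply: mesh_le; exact: leq_maxl.
  have : l%:E < dyadic N t.
    rewrite /dyadic dyadic_valE lt_min lte_fin lN/=; apply: lt_le_trans ls _; apply: nG => //.
    apply: le_trans tN; rewrite -natr1 mulrDl mul1r lerD2r.
    by apply: (slotP _ _).1; [exact: mesh_gt0|exact: ltW].
  rewrite ltNge -E => /negP; apply; apply: ereal_sup_ubound; by exists N.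
exact/ereal_nondecreasing_cvgn/nondecreasing_dyadic.
Qed.

End dyadic.

(** * Norms of step functions *)

Section step_norm.
Variables (R : realType) (rho : (R1_type R -> \bar R) -> \bar R).
Local Notation HL := (@halfline R).
Hypothesis ri : ri_norm lam HL rho.

Lemma gstepD (I : finType) d (e : I -> nat) (x y : I -> R) :
  gstep d e (fun i => x i + y i)%R = (fun t => gstep d e x t + gstep d e y t).
Proof.
apply/funext => t; rewrite /gstep -EFinD -big_split/=; congr EFin.
by apply: eq_bigr => i _; rewrite mulrDl.
Qed.

Lemma gstepZ (I : finType) d (e : I -> nat) (c : R) (x : I -> R) :
  gstep d e (fun i => c * x i)%R = (fun t => c%:E * gstep d e x t).
Proof.
apply/funext => t; rewrite /gstep -EFinM mulr_sumr; congr EFin.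
by apply: eq_bigr => i _; rewrite mulrA.
Qed.

Lemma gstep_norm_fin (I : finType) d (e : I -> nat) (w : I -> R) : (0 < d)%R ->
  (forall i, (0 <= w i)%R) -> rho (gstep d e w) \is a fin_num.
Proof.
move=> d0 w0; have Mw := Mp_gstep d0 e w0.
rewrite ge0_fin_numE; last exact: (ri_norm_ge0 ri).
pose K := (\max_i e i).+1; pose a := (K%:R * d)%R; pose M := (\sum_i w i)%R.
have M0 : (0 <= M)%R by rewrite sumr_ge0.
have a0 : (0 < a)%R by rewrite mulr_gt0.
pose E : set (R1_type R) := HL `&` [set t : R | (t < a)%R].
have mE : measurable E by exact: measurable_lt_R1.
have EH : E `<=` HL by move=> t [].
have ME : nonneg_meas_funs HL (EFin \o \1_E : R1_type R -> \bar R).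
  split; last by move=> t _; rewrite lee_fin.
  by apply: measurable_funTS; apply/measurable_EFinP; exact: measurable_indic.
have MME : nonneg_meas_funs HL (fun t : R1_type R => M%:E * (EFin \o \1_E) t).
  split; first by apply: emeasurable_funM; [exact: measurable_cst|case: ME].
  by move=> t _; rewrite mule_ge0// lee_fin.
have : rho (gstep d e w) <= rho (fun t => M%:E * (EFin \o \1_E) t).
  apply: (ri_norm_le_on ri) => // t; rewrite halflineE => t0.
  have [[i te]|ne] := pselect (exists i, slot d t = e i); last first.
    rewrite gstep_out ?mule_ge0 ?lee_fin// => i; apply/eqP => te.
    by apply: ne; exists i.
  have -> : (EFin \o (\1_E : R1_type R -> R)) t = 1%:E.
    congr EFin; rewrite indicE mem_set//; split; first by rewrite halflineE.
    rewrite /= /a -slot_le// te; exact: leq_bigmax.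
  rewrite mule1 lee_fin; apply: ler_sum => j _.
  by rewrite -[leRHS]mulr1 ler_wpM2l//; case: (_ == _).
move/le_lt_trans; apply; rewrite (ri_normZ ri)//.
have : rho (EFin \o \1_E) < +oo.
  apply: (ri_norm_indic ri mE EH); apply: (le_lt_trans (_ : _ <= a%:E)); last exact: ltry.
  by rewrite le_eqVlt; apply/orP; left; apply/eqP; exact: lam_lt.
have := ri_norm_ge0 ri ME.
by case: (rho _) => // r _ _; rewrite -EFinM ltry.
Qed.

Lemma gstep_norm_rearrange (I J : finType) d (e : I -> nat) (w : I -> R)
    (e' : J -> nat) (w' : J -> R) :
  (0 < d)%R -> injective e -> injective e' ->
  (forall i, (0 <= w i)%R) -> (forall j, (0 <= w' j)%R) ->
  (forall m : R, \sum_i (m < w i)%R%:R = \sum_j (m < w' j)%R%:R :> R)%R ->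
  rho (gstep d e w) = rho (gstep d e' w').
Proof.
move=> d0 ie ie' w0 w0' E.
rewrite (ri_norm_rearr ri (Mp_gstep d0 e w0)) (ri_norm_rearr ri (Mp_gstep d0 e' w0')).
by rewrite (rearr_gstep d0 ie ie' w0 w0' E).
Qed.

Lemma gstep_norm_sum (I J : finType) d (e : I -> nat) (w : J -> I -> R) : (0 < d)%R ->
  (forall j i, (0 <= w j i)%R) ->
  rho (gstep d e (fun i => \sum_j w j i)%R) <= \sum_j rho (gstep d e (w j)).
Proof.
move=> d0 w0; rewrite -big_enum/=.
have -> : (fun i => \sum_j w j i)%R = (fun i => \sum_(j <- enum J) w j i)%R.
  by apply/funext => i; rewrite big_enum.
elim: (enum J) => [|j r IHr].
  have -> : (fun i => \sum_(j <- [::]) w j i)%R = (fun i => 0 * 1)%R.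
    by apply/funext => i; rewrite big_nil mul0r.
  rewrite big_nil gstepZ (ri_normZ ri)//; last by apply: Mp_gstep.
  by rewrite mul0e.
have -> : (fun i => \sum_(k <- j :: r) w k i)%R = (fun i => w j i + \sum_(k <- r) w k i)%R.
  by apply/funext => i; rewrite big_cons.
rewrite gstepD big_cons; apply: le_trans (ri_normD ri _ _) _.
- exact: Mp_gstep.
- by apply: Mp_gstep => // i; rewrite sumr_ge0.
- by rewrite leeD2l.
Qed.

End step_norm.

Section averaging.
Variables (R : realType) (N M : nat) (d : R).
Hypothesis d0 : (0 < d)%R.

Definition sub_mesh : R := (d / M.+1%:R)%R.

Definition sub_cell (ji : 'I_N * 'I_M.+1) : nat := (ji.1 * M.+1 + ji.2)%N.

Lemma sub_mesh_gt0 : (0 < sub_mesh)%R. Proof. by rewrite divr_gt0. Qed.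

Lemma sub_cell_inj : injective sub_cell.
Proof.
move=> [j i] [j' i'] /= h; congr pair; apply/val_inj.
  by have := congr1 (divn^~ M.+1) h; rewrite /sub_cell/= !divnMDl// !divn_small// !addn0.
by have := congr1 (modn^~ M.+1) h; rewrite /sub_cell/= !modnMDl !modn_small.
Qed.

Lemma slot_sub_mesh t : (0 <= t)%R -> slot d t = (slot sub_mesh t %/ M.+1)%N.
Proof.
move=> t0; set k := slot sub_mesh t; apply/eqP; rewrite slot_eq//.
have dE : d = (M.+1%:R * sub_mesh)%R by rewrite mulrC divfK.
have [k1 k2] := slotP sub_mesh_gt0 t0.
have aE a : (a%:R * d = (a * M.+1)%:R * sub_mesh)%R by rewrite {1}dE mulrA natrM.
rewrite !aE; apply/andP; split.
  by apply: le_trans k1; rewrite ler_pM2r ?sub_mesh_gt0// ler_nat leq_trunc_div.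
apply: lt_le_trans k2 _; rewrite ler_pM2r ?sub_mesh_gt0// ler_nat.
exact: ltn_ceil.
Qed.

Lemma gstep_sub_mesh (v : 'I_N -> R) (t : R) : (0 <= t)%R ->
  gstep d val v t = gstep sub_mesh sub_cell (fun ji => v ji.1) t.
Proof.
move=> t0; have tE := slot_sub_mesh t0.
have [tN|tN] := ltnP (slot d t) N.
  rewrite (@gstep_at _ _ _ val v (Ordinal tN) t val_inj)//.
  have iM : (slot sub_mesh t %% M.+1 < M.+1)%N by rewrite ltn_mod.
  rewrite (@gstep_at _ _ _ _ _ (Ordinal tN, Ordinal iM) t sub_cell_inj)//.
  by rewrite /sub_cell/= tE -divn_eq.
rewrite !gstep_out// => [[j i]|i].
  apply/eqP => h; move: tN; rewrite tE h /sub_cell/= divnMDl// divn_small// addn0.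
  by rewrite leqNgt ltn_ord.
by apply/eqP => h; move: tN; rewrite h leqNgt ltn_ord.
Qed.

Definition average (w : 'I_N * 'I_M.+1 -> R) (j : 'I_N) : R :=
  (M.+1%:R^-1 * \sum_i w (j, i))%R.

(** Averaging over the cells is the mean of the [M.+1] cyclic shifts of the subcells
    inside their cells. A shift does not change the distribution, hence not the
    norm, and the triangle inequality concludes. *)
Lemma averaging_norm (rho : (R1_type R -> \bar R) -> \bar R)
    (ri : ri_norm lam (@halfline R) rho) (w : 'I_N * 'I_M.+1 -> R) :
  (forall ji, (0 <= w ji)%R) ->
  rho (gstep d val (average w)) <= rho (gstep sub_mesh sub_cell w).
Proof.
move=> w0; have s0 := sub_mesh_gt0.
have a0 j : (0 <= average w j)%R.
  by rewrite mulr_ge0 ?sumr_ge0// invr_ge0.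
pose sh (r : 'I_M.+1) (ji : 'I_N * 'I_M.+1) := w (ji.1, ji.2 + r)%R.
have aE ji : average w ji.1 = (M.+1%:R^-1 * \sum_r sh r ji)%R.
  rewrite /average /sh; congr (_ * _)%R; rewrite (reindex_inj (addrI ji.2))/=.
  by apply: eq_bigr.
have sh0 r ji : (0 <= sh r ji)%R by exact: w0.
have -> : rho (gstep d val (average w)) =
    rho (gstep sub_mesh sub_cell (fun ji => M.+1%:R^-1 * \sum_r sh r ji)%R).
  apply: (ri_norm_eq_on ri).
  - exact: Mp_gstep.
  - by apply: Mp_gstep => // ji; rewrite -aE.
  - move=> t; rewrite halflineE => t0; rewrite gstep_sub_mesh ?ltW//; congr (gstep _ _ _ _).
    by apply/funext => ji; exact: aE.
rewrite gstepZ (ri_normZ ri)//; last by apply: (Mp_gstep s0) => ji; rewrite sumr_ge0.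
have shE r : rho (gstep sub_mesh sub_cell (sh r)) = rho (gstep sub_mesh sub_cell w).
  apply: (gstep_norm_rearrange ri s0 sub_cell_inj sub_cell_inj) => // m.
  rewrite (reindex_inj (h := fun ji : 'I_N * 'I_M.+1 => (ji.1, ji.2 - r)%R))/=.
    by apply: eq_bigr => -[j i] _; rewrite /sh/= subrK.
  move=> [j i] [j' i'] h; have /= jj := congr1 fst h; have /= ii := congr1 snd h.
  by rewrite jj; congr pair; exact: (addIr _ ii).
apply: (@le_trans _ _ (M.+1%:R^-1%:E * \sum_r rho (gstep sub_mesh sub_cell (sh r)))).
  by apply: lee_wpmul2l; [rewrite lee_fin invr_ge0|exact: gstep_norm_sum].
under eq_bigr do rewrite shE.
rewrite -(fineK (gstep_norm_fin ri sub_cell s0 w0)) sumEFin -EFinM lee_fin.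
by rewrite sumr_const card_ord -[X in (_ * X)%R]mulr_natl mulrA mulVf// mul1r.
Qed.

End averaging.

(** * The dual of the norm on step functions *)

Section norming.
Variables (R : realType) (rho : (R1_type R -> \bar R) -> \bar R).
Local Notation HL := (@halfline R).
Hypothesis ri : ri_norm lam HL rho.
Variables (N : nat) (d : R).
Hypothesis d0 : (0 < d)%R.

(** The positive part makes the functional monotone, and thereby the coefficients
    of a linear functional below it nonnegative. *)
Let P (x : 'I_N -> R) : R := fine (rho (gstep d val (fun i => Num.max 0%R (x i)))).

Let max0 (x : 'I_N -> R) i : (0 <= Num.max 0 (x i))%R.
Proof. by rewrite le_max lexx. Qed.

Let PE x : (P x)%:E = rho (gstep d val (fun i => Num.max 0%R (x i))).
Proof. by rewrite fineK//; exact: gstep_norm_fin. Qed.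

Let PD (x y : 'I_N -> R) : (P (fun i => x i + y i) <= P x + P y)%R.
Proof.
rewrite -lee_fin EFinD !PE; apply: le_trans (ri_normD ri _ _); try exact: (Mp_gstep d0 _ (max0 _)).
rewrite -gstepD; apply: (ri_norm_le_on ri).
- exact: (Mp_gstep d0 _ (max0 _)).
- by apply: (Mp_gstep d0) => i; rewrite addr_ge0.
move=> t _; rewrite lee_fin; apply: ler_sum => i _; apply: ler_wpM2r => //.
rewrite ge_max addr_ge0//=; apply: lerD; by rewrite le_max lexx orbT.
Qed.

Let PZ c (x : 'I_N -> R) : (0 <= c)%R -> (P (fun i => c * x i) <= c * P x)%R.
Proof.
move=> c0; rewrite -lee_fin EFinM !PE -(ri_normZ ri)//; last exact: (Mp_gstep d0 _ (max0 _)).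
rewrite -gstepZ (_ : (fun i => Num.max 0 (c * x i))%R = (fun i => c * Num.max 0 (x i))%R)//.
by apply/funext => i; rewrite maxr_pMr// mulr0.
Qed.

(** The coefficients of the norming functional are sorted: since [G] is
    nonincreasing this increases the pairing with [G], and since the norm is
    invariant under permutations of the cells the bound by the norm survives. *)
Lemma norming_step (G : nat -> R) : (forall k, (0 <= G k)%R) ->
  (forall k l, (k <= l)%N -> (G l <= G k)%R) ->
  exists phi : nat -> R, [/\ (forall k, (0 <= phi k)%R),
    (forall k l, (k <= l)%N -> (phi l <= phi k)%R), (forall k, (N <= k)%N -> phi k = 0%R),
    (forall x : 'I_N -> R, (forall i, (0 <= x i)%R) ->
      (\sum_(i < N) phi i * x i)%R%:E <= rho (gstep d val x)) &
    rho (gstep d val (fun i : 'I_N => G i)) <= (\sum_(i < N) phi i * G i)%R%:E].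
Proof.
move=> G0 dG.
have [phi0 phi0_le phi0_G] := norming_functional (fun i : 'I_N => G i) PD PZ.
have phi00 i : (0 <= phi0 i)%R.
  have := phi0_le (fun j => - (j == i)%:R)%R.
  have -> : P (fun j : 'I_N => - (j == i)%:R)%R = 0%R.
    apply: EFin_inj; rewrite PE.
    rewrite (_ : (fun j : 'I_N => _) = (fun j => 0 * Num.max 0 0)%R); last first.
      by apply/funext => j; rewrite mul0r max_l// oppr_le0.
    by rewrite gstepZ (ri_normZ ri)// ?mul0e//; exact: (Mp_gstep d0 _ (fun=> max0 (fun=> 0%R) i)).
  rewrite (bigD1 i)//= eqxx big1 ?addr0 => [|j /negbTE ->]; last by rewrite oppr0 mulr0.
  by rewrite mulrN1 oppr_le0.
have [s [sdec sG]] := sort_functional phi0 (fun i j : 'I_N => @dG i j).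
pose phi (k : nat) : R := oapp (fun i : 'I_N => phi0 (s i)) 0%R (insub k).
have phiE (i : 'I_N) : phi i = phi0 (s i) by rewrite /phi valK.
have phi_out k : (N <= k)%N -> phi k = 0%R by move=> Nk; rewrite /phi insubF// ltnNge Nk.
have posE (x : 'I_N -> R) : (forall i, (0 <= x i)%R) ->
    (fun i => Num.max 0%R (x i)) = x.
  by move=> x0; apply/funext => i; rewrite max_r.
exists phi; split=> //.
- by move=> k; rewrite /phi; case: insub => /=.
- move=> k l kl; have [lN|Nl] := ltnP l N; last first.
    by rewrite phi_out// /phi; case: insub => /=.
  have kN := leq_ltn_trans kl lN.
  by rewrite (phiE (Ordinal kN)) (phiE (Ordinal lN)); exact: sdec.
- move=> x x0; have xs0 i : (0 <= x ((s^-1)%g i))%R by [].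
  rewrite (gstep_norm_rearrange ri d0 val_inj val_inj x0 xs0); last first.
    by move=> m; rewrite [LHS](reindex_inj (@perm_inj _ (s^-1)%g)).
  have := phi0_le (fun i => x ((s^-1)%g i)); rewrite -lee_fin PE posE//.
  apply: le_trans; rewrite lee_fin le_eqVlt; apply/orP; left; apply/eqP.
  rewrite [RHS](reindex_inj (@perm_inj _ s))/=; apply: eq_bigr => i _.
  by rewrite phiE permK.
- rewrite -(posE (fun i : 'I_N => G i))// -PE lee_fin; apply: le_trans phi0_G _.
  apply: le_trans sG _; rewrite le_eqVlt; apply/orP; left; apply/eqP.
  by apply: eq_bigr => i _; rewrite phiE.
Qed.

End norming.

(** * Nonincreasing step functions *)

Section decreasing_steps.
Variables (R : realType) (N : nat) (d : R).
Hypothesis d0 : (0 < d)%R.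

Lemma gstep_ord (w : nat -> R) (t : R) :
  gstep d val (fun i : 'I_N => w i) t = if (slot d t < N)%N then (w (slot d t))%:E else 0.
Proof.
case: ltnP => tN; first by rewrite (@gstep_at _ _ _ val _ (Ordinal tN) t val_inj).
by rewrite gstep_out// => i; apply/eqP => h; move: tN; rewrite h leqNgt ltn_ord.
Qed.

Lemma nincr_gstep (w : nat -> R) : (forall k, (0 <= w k)%R) ->
  (forall k l, (k <= l)%N -> (w l <= w k)%R) ->
  nincr (gstep d val (fun i : 'I_N => w i)).
Proof.
move=> w0 dw s t s0 st; rewrite !gstep_ord; have h := slot_homo d0 st.
case: ltnP => tN; last by case: ifP => //; rewrite lee_fin.
by rewrite (leq_ltn_trans h tN) lee_fin; exact: dw.
Qed.

Lemma rcont_gstep (I : finType) (e : I -> nat) (w : I -> R) : rcont (gstep d e w).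
Proof.
move=> t y t0 yt; have [tl tr] := slotP d0 (ltW t0).
pose s := ((t + (slot d t).+1%:R * d) / 2)%R.
have [ts sr] := (midf_lt tr); exists s => //.
have /eqP st : slot d s == slot d t.
  by rewrite slot_eq ?(le_trans (ltW t0) (ltW ts))// (le_trans tl (ltW ts)) sr.
by rewrite /gstep st.
Qed.

(** The cell of [t] is at most [j] exactly when [t] precedes the right end of the
    cell [j], so that the sum on the right is over the [j] past the cell of [t]. *)
Lemma gstep_stair (u : nat -> R) (t : R) :
  gstep d val (fun i : 'I_N => \sum_(j < N | (i <= j)%N) u j)%R t =
  (\sum_(j < N) u j * (t < j.+1%:R * d)%R%:R)%R%:E.
Proof.
rewrite (gstep_ord (fun k => \sum_(j < N | (k <= j)%N) u j)%R).
under [in RHS]eq_bigr do rewrite -slot_le//.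
case: ltnP => tN.
  congr EFin; rewrite big_mkcond/=; apply: eq_bigr => j _.
  by case: leqP; rewrite ?mulr1 ?mulr0.
rewrite big1// => j _; rewrite leqNgt (leq_trans (ltn_ord j) tN) mulr0//.
Qed.

End decreasing_steps.

Section dual_step.
Variables (R : realType) (n : nat).
Variables (rho : (Rn_type R n -> \bar R) -> \bar R)
  (rhobar rhobar' : (R1_type R -> \bar R) -> \bar R).
Hypotheses (n0 : (0 < n)%N)
  (repr : representation_norm rho rhobar)
  (repr' : representation_norm (associate_norm (@Rn_lebesgue R n) setT rho) rhobar').
Local Notation HL := (@halfline R).
Variables (N0 N : nat) (phi : nat -> R).
Local Notation d := (mesh R N0).
Hypotheses (phi0 : forall k, (0 <= phi k)%R)
  (dphi : forall k l, (k <= l)%N -> (phi l <= phi k)%R)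
  (phi_le : forall x : 'I_N -> R, (forall i, (0 <= x i)%R) ->
     (\sum_(i < N) phi i * x i)%R%:E <= rhobar (gstep d val x)).

Definition dual_step := gstep d val (fun i : 'I_N => phi i / d)%R.

(** A nonincreasing test function [g] is approximated by its dyadic steps. Pairing
    these with [dual_step] only involves their averages over the cells of mesh
    [d], to which the bound on [phi] applies, and averaging does not increase
    the norm. *)
Lemma dual_step_norm : rhobar' dual_step <= 1.
Proof.
have ri := repr.1; have d0 := mesh_gt0 R N0; have mHL := @measurable_halfline R.
have nP : nincr dual_step.
  apply: (@nincr_gstep R N d d0 (fun k => phi k / d)%R) => [k|k l kl].
    by rewrite divr_ge0// ltW.
  by rewrite ler_pM2r ?invr_gt0// dphi.
have w0 i : (0 <= phi i / d)%R by rewrite divr_ge0// ltW.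
have P0 t : 0 <= dual_step t by exact: gstep_ge0.
have mP : measurable_fun HL dual_step by exact: measurable_nincr.
apply: (repr_associate_le n0 repr repr' nP) => // g ng rg g0 g1 _.
have mg : measurable_fun HL g by exact: measurable_nincr.
have Mg := Mp_nincr ng g0.
pose F m (t : R1_type R) := dual_step t * dyadic g m t.
have mF m : measurable_fun HL (F m).
  by apply: emeasurable_funM => //; apply: measurable_nincr; exact: nincr_dyadic.
have F0 m t : HL t -> 0 <= F m t by move=> _; rewrite mule_ge0// dyadic_ge0.
have ndF t : HL t -> nondecreasing_seq (F ^~ t).
  rewrite halflineE => t0 a b ab; apply: lee_wpmul2l => //.
  exact: nondecreasing_dyadic.
have FE t : HL t -> dual_step t * g t = limn (F ^~ t).
  rewrite halflineE => t0; apply/esym/cvg_lim => //.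
  by apply: cvgeZl => //; exact: cvg_dyadic.
have cF := cvg_monotone_convergence (mu := lam) mHL mF F0 ndF.
have -> : \int[lam]_(t in HL) (dual_step t * g t) = \int[lam]_(t in HL) limn (F ^~ t).
  by apply: eq_integral => t; rewrite inE => /FE.
rewrite -(cvg_lim _ cF)//; apply: lime_le; first by apply/cvg_ex; eexists; exact: cF.
near=> m; have Nm : (N0 <= m)%N by near: m; exact: nbhs_infty_ge.
pose M := (2 ^ (m - N0)).-1.
have ME : M.+1 = (2 ^ (m - N0))%N by rewrite prednK// expn_gt0.
have smE : sub_mesh M d = mesh R m.
  by rewrite /sub_mesh ME /mesh natrX -invfM -exprD subnKC.
pose w (ji : 'I_N * 'I_M.+1) := dyadic_val g m (sub_cell ji).
have ww0 ji : (0 <= w ji)%R by exact: dyadic_val_ge0.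
have m0 := mesh_gt0 R m.
have E : \int[lam]_(t in HL) F m t = (\sum_(j < N) phi j * average w j)%R%:E.
  transitivity (\int[lam]_(t in HL) (gstep (mesh R m) (@sub_cell N M)
      (fun ji => phi ji.1 / d)%R t * dyadic g m t)).
    apply: eq_integral => t; rewrite inE halflineE => t0.
    by rewrite /F /dual_step (gstep_sub_mesh M d0)// ?ltW// smE.
  rewrite integral_gstep//; last 2 first.
  - by apply: measurable_nincr; exact: nincr_dyadic.
  - by move=> t _; exact: dyadic_ge0.
  transitivity (\sum_(ji : 'I_N * 'I_M.+1) (phi ji.1 / d * (w ji * mesh R m))%R%:E).
    apply: eq_bigr => ji _; rewrite [RHS]EFinM; congr (_ * _).
    transitivity (\int[lam]_(t in cell (mesh R m) (sub_cell ji)) (w ji)%:E).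
      by apply: eq_integral => t; rewrite inE => -[_ /=]; rewrite /dyadic => ->.
    rewrite (integral_cst lam (measurable_cell _ m0)) EFinM; congr (_ * _).
    exact: lam_cell.
  rewrite sumEFin; congr EFin.
  rewrite -(pair_bigA _ (fun (j : 'I_N) (i : 'I_M.+1) => phi j / d * (w (j, i) * mesh R m)))%R/=.
  apply: eq_bigr => j _; rewrite /average -mulr_sumr -mulr_suml -smE /sub_mesh.
  by field; rewrite (gt_eqF d0) andbT addrC natr1 pnatr_eq0.
rewrite E; apply: le_trans g1; apply: le_trans (phi_le _) _.
  by move=> j; rewrite mulr_ge0 ?invr_ge0 ?sumr_ge0.
apply: le_trans (averaging_norm d0 ri ww0) _; rewrite smE.
apply: (ri_norm_le_on ri) => //; first exact: (Mp_gstep m0 _ ww0).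
move=> t; rewrite halflineE; apply: gstep_le => //; first exact: sub_cell_inj.
by move=> ji u u0 ue; exact: dyadic_val_le_slot.
Unshelve. all: by end_near. Qed.

End dual_step.

(** * Moving cells to where the mean is large *)

Section separated_cells.
Variables (R : realType) (al : R).
Hypotheses (al0 : (0 < al)%R) (al1 : (al < 1)%R).
Local Notation HL := (@halfline R).
Variables (g : R1_type R -> \bar R).
Hypotheses (ng : nincr g) (g0 : forall t : R, (0 < t)%R -> 0 <= g t).

(** [prim g] is nondecreasing and [4 `^ (al - 1) >= 1 / 4]. *)
Lemma avg_quarter (u t : R) : (0 < u)%R -> (u <= t)%R -> (t <= 4 * u)%R ->
  4^-1%:E * avg al g u <= avg al g t.
Proof.
move=> u0 ut tu; have t0 : (0 < t)%R by exact: lt_le_trans ut.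
have mg : measurable_fun HL g by exact: measurable_nincr.
rewrite /avg muleA -EFinM; apply: lee_pmul.
- by rewrite lee_fin mulr_ge0// ?powR_ge0// invr_ge0.
- exact: prim_ge0.
- rewrite lee_fin; apply: (@le_trans _ _ ((4 * u) `^ (al - 1))%R).
    rewrite powRM ?(ltW u0)//; apply: ler_wpM2r; first exact: powR_ge0.
    rewrite -[leLHS]powR_inv1//; apply: ler_powR; rewrite ?ler1n//.
    by rewrite -[leLHS]add0r lerD2r ltW.
  by rewrite -(opprB 1 al) powRN_nincr// subr_ge0 ltW.
- exact: prim_homo.
Qed.

(** Choose [u] where [avg al g] exceeds half of its supremum and [2 ^ m] with
    [u <= 2 ^ m * d <= 2 * u]; on the block the argument is between [u] and
    [4 * u], whence the factor [1 / 8]. *)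
Lemma dyadic_block (d b : R) (i : nat) : (0 < d)%R -> (0 <= b)%R ->
  b%:E <= sup_avg al g (i.+1%:R * d)%R ->
  exists m : nat, (i < 2 ^ m)%N /\ forall t, (0 < t)%R ->
    ((2 ^ m)%:R * d <= t)%R -> (t < (2 ^ m.+1)%:R * d)%R -> (b / 8)%:E <= avg al g t.
Proof.
move=> d0; rewrite le_eqVlt => /predU1P[<- _|b0 bS].
  exists i; split; first exact: ltn_expl.
  by move=> t t0 _ _; rewrite mul0r avg_ge0.
have : (b / 2)%:E < sup_avg al g (i.+1%:R * d)%R.
  by apply: lt_le_trans bS; rewrite lte_fin ltr_pdivrMr// ltr_pMr// ltr1n.
move=> /ereal_sup_gt[_ /= [u iu <-] bu].
have u0 : (0 < u)%R by apply: lt_le_trans iu; rewrite mulr_gt0.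
have ex : exists m, (u <= (2 ^ m)%:R * d)%R.
  exists (slot d u).+1; have [_ h] := slotP d0 (ltW u0).
  apply: le_trans (ltW h) _; rewrite ler_pM2r// ler_nat; apply: ltnW; exact: ltn_expl.
pose m := ex_minn ex; have [um mmin] : (u <= (2 ^ m)%:R * d)%R /\
    forall k, (u <= (2 ^ k)%:R * d)%R -> (m <= k)%N by rewrite /m; case: ex_minnP.
exists m; split.
  by rewrite -(ler_nat R) -(ler_pM2r d0); exact: le_trans um.
move=> t t0 mt tm; have tu : (t <= 4 * u)%R.
  apply: le_trans (ltW tm) _; rewrite expnS natrM.
  suff : ((2 ^ m)%:R * d <= 2 * u)%R by lra.
  case E : m => [|k].
    rewrite expn0 mul1r; apply: le_trans (_ : u <= _)%R; last by lra.
    by apply: le_trans iu; rewrite ler_peMl ?ler1n// ltW.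
  have : ~~ (u <= (2 ^ k)%:R * d)%R by apply/negP => /mmin; rewrite E ltnn.
  by rewrite -ltNge expnS natrM => h; lra.
apply: le_trans (avg_quarter u0 (le_trans um mt) tu).
rewrite (_ : b / 8 = 4^-1 * (b / 2))%R; last by field.
by rewrite EFinM; apply: lee_wpmul2l; [rewrite lee_fin invr_ge0|exact: ltW].
Qed.

(** The block for the index [i] has length [2 ^ m * d], more than [i] cells. The
    index [i] takes the cell number [i] of its block; distinct blocks being
    disjoint, distinct indices get distinct cells. *)
Lemma separated_cells (d : R) (N : nat) (B : nat -> R) : (0 < d)%R ->
  (forall i, (0 <= B i)%R) -> (forall i, (B i)%:E <= sup_avg al g (i.+1%:R * d)%R) ->
  exists2 e : 'I_N -> nat, injective e &
    forall i t, cell d (e i) t -> (B i / 8)%:E <= avg al g t.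
Proof.
move=> d0 B0 BS.
have [m mP] := fin_all_exists (fun i : 'I_N => dyadic_block d0 (B0 i) (BS i)).
exists (fun i : 'I_N => 2 ^ m i + i)%N.
  have mono (i j : 'I_N) : (m i < m j)%N -> (2 ^ m i + i < 2 ^ m j + j)%N.
    move=> ij; apply: (@leq_trans (2 ^ m j)); last exact: leq_addr.
    apply: (@leq_trans (2 ^ (m i).+1)); last by rewrite leq_exp2l.
    by rewrite expnS mul2n -addnn ltn_add2l; case: (mP i).
  move=> i j ij; have [h|h|h] := ltngtP (m i) (m j).
  - by have := mono _ _ h; rewrite ij ltnn.
  - by have := mono _ _ h; rewrite ij ltnn.
  - by apply/val_inj; move: ij; rewrite h => /addnI.
move=> i t [/=]; rewrite halflineE => t0 te; have [im it] := mP i.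
have [tl tr] := slotP d0 (ltW t0); rewrite te in tl tr.
apply: it => //.
  by apply: le_trans tl; rewrite ler_pM2r// ler_nat leq_addr.
apply: lt_le_trans tr _; rewrite ler_pM2r// ler_nat.
by rewrite expnS mul2n -addnn ltn_add2l.
Qed.

End separated_cells.

(** * The tail integral of a stair function *)

Section tail_of_stairs.
Variables (R : realType) (al : R).
Hypotheses (al0 : (0 < al)%R) (al1 : (al < 1)%R).
Local Notation HL := (@halfline R).

(** Summand by summand: the tail integral of the indicator of [(0, a)] vanishes
    beyond [a] and is at most [a `^ al / al] before. *)
Lemma weighted_tail_stairs (N : nat) (d : R) (c : nat -> R) (t : R) : (0 < d)%R ->
  (forall j, (0 <= c j)%R) -> (0 < t)%R ->
  weighted_tail (al - 1) (gstep d val (fun i : 'I_N =>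
    \sum_(j < N | (i <= j)%N) c j * (j.+1%:R * d) `^ (- al))%R) t <=
  al^-1%:E * gstep d val (fun i : 'I_N => \sum_(j < N | (i <= j)%N) c j)%R t.
Proof.
move=> d0 c0 t0; pose a (j : nat) : R := (j.+1%:R * d)%R.
have a0 j : (0 < a j)%R by rewrite mulr_gt0.
pose p (s : R1_type R) : \bar R := ((s : R) `^ (al - 1))%:E.
pose q (j : nat) : R1_type R -> \bar R := p \_ [set s : R | (s < a j)%R].
have mp B : measurable_fun B p by exact: measurable_powR_R1.
have p0 s : 0 <= p s by rewrite lee_fin powR_ge0.
have mT := @measurable_before R t; have mHL := @measurable_halfline R.
have sT : HL `&` [set s : R | (t < s)%R] `<=` HL by move=> ? [].
have mq j : measurable_fun (HL `&` [set s : R | (t < s)%R]) (q j).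
  have : measurable_fun (HL `&` [set s : R | (t < s)%R])
      (p \_ (HL `&` [set s : R | (s < a j)%R])).
    exact: ((measurable_restrict p (@measurable_lt_R1 R (a j)) mT).1 (mp _)).
  apply: eq_measurable_fun => s; rewrite inE => -[sH _].
  by rewrite /q /patch in_setI mem_set.
have q0 j s : 0 <= q j s by rewrite /q /patch; case: ifP.
rewrite gstep_stair// weighted_tailE//.
have -> : \int[lam]_(s in HL `&` [set s : R | (t < s)%R])
    (gstep d val (fun i : 'I_N => \sum_(j < N | (i <= j)%N) c j * (a j) `^ (- al))%R s * p s) =
    \int[lam]_(s in HL `&` [set s : R | (t < s)%R])
      \sum_(j < N) (c j * (a j) `^ (- al))%:E * q j s.
  apply: eq_integral => s; rewrite inE => -[_ _].
  rewrite (gstep_stair _ d0 (fun j => c j * (a j) `^ (- al))%R) -sumEFin.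
  rewrite ge0_sume_distrl => [|j _]; last by rewrite lee_fin !mulr_ge0 ?powR_ge0.
  apply: eq_bigr => j _; rewrite EFinM -muleA; congr (_ * _).
  rewrite /q /patch; case: ltP => sa; first by rewrite mem_set ?mul1e.
  by rewrite memNset ?mul0e//= => /(le_lt_trans sa); rewrite ltxx.
have fu0 j : 0 <= (c j * (a j) `^ (- al))%:E by rewrite lee_fin mulr_ge0 ?powR_ge0.
rewrite (ge0_integral_sum lam mT); last 2 first.
- by move=> j; exact: (emeasurable_funM (measurable_cst _) (mq j)).
- by move=> j s _; apply: mule_ge0.
rewrite -EFinM mulr_sumr -sumEFin; apply: lee_sum => j _.
rewrite (ge0_integralZl lam mT (mq j) (fun s _ => q0 j s) (fu0 j)).
apply: (@le_trans _ _ ((c j * (a j) `^ (- al))%:E * ((t < a j)%R%:R * ((a j) `^ al / al))%:E)); last first.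
  rewrite -EFinM lee_fin le_eqVlt; apply/orP; left; apply/eqP.
  have : ((a j) `^ (- al) * (a j) `^ al = 1)%R.
    by rewrite -powRD ?addNr ?powRr0// (gt_eqF (a0 j)) implybT.
  by rewrite -/(a j) => h; rewrite [RHS]mulrC; ring: h.
apply: lee_wpmul2l => //; rewrite /q -integral_mkcondr.
case: ltP => ta.
  rewrite mul1r; apply: le_trans (_ : prim p (a j) <= _).
    have mA := @measurable_lt_R1 R (a j).
    have mA' : measurable (HL `&` [set s : R | (t < s)%R] `&` [set s : R | (s < a j)%R]).
      apply: measurableI => //; apply: measurable_R1.
      rewrite (_ : [set s | _] = [set` `]-oo, (a j)[]); first exact: measurable_itv.
      by apply/seteqP; split=> s /=; rewrite in_itv.
    apply: (ge0_subset_integral lam mA' mA (mp _)); first by move=> s _; exact: p0.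
    by move=> s [[sH _] sa].
  have := @powR_integral_le R (al - 1) (a j).
  rewrite (_ : 1 + (al - 1) = al)%R; last by ring.
  by apply => //; rewrite -[ltLHS]add0r ltrD2r.
rewrite (_ : _ `&` _ = set0) ?integral_set0 ?mul0r//.
apply/seteqP; split=> s //= [[_ ts] sa].
by have := lt_trans ts sa; rewrite ltNge ta.
Qed.

End tail_of_stairs.

(** * From tail integrals to the supremum operator *)

Section sufficiency.
Variables (R : realType) (n : nat) (al : R).
Variables (rho : (Rn_type R n -> \bar R) -> \bar R)
  (rhobar rhobar' : (R1_type R -> \bar R) -> \bar R).
Hypotheses (al0 : (0 < al)%R) (al1 : (al < 1)%R).
Hypotheses (n0 : (0 < n)%N) (ri_rho : ri_norm (@Rn_lebesgue R n) setT rho)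
  (repr : representation_norm rho rhobar)
  (repr' : representation_norm (associate_norm (@Rn_lebesgue R n) setT rho) rhobar').
Local Notation HL := (@halfline R).
Local Notation mu := (@Rn_lebesgue R n).
Local Notation wt := (weighted_tail (al - 1)).
Variable C : R.
Hypothesis C0 : (0 < C)%R.
Hypothesis tail_le : forall f : Rn_type R n -> \bar R, nonneg_meas_funs setT f ->
  ereal_sup
    [set ri_space_norm rhobar' (wt h)
    | h in [set h : R1_type R -> \bar R |
             nonneg_meas_funs HL h /\ equimeasurable lam HL mu setT h f]]
  <= C%:E * ri_space_norm rhobar' (wt (rearr mu setT f)).

(** The hypothesis read on the half-line, through the function [f \o vol] on the
    Euclidean space. *)
Lemma tail_rearrangement_le (f h : R1_type R -> \bar R) : nincr f -> rcont f ->
  (forall t : R, (0 < t)%R -> 0 <= f t) -> nonneg_meas_funs HL h ->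
  rearr lam HL h = rearr lam HL f -> rhobar' (wt h) <= C%:E * rhobar' (wt f).
Proof.
move=> nf rf f0 Mh hf; have us := uniform_vol R n0; have ri' := repr'.1.
have [mh h0] := Mh; have h0' t : (0 < t)%R -> 0 <= h t by rewrite -halflineE; exact: h0.
have MF := Mp_uniform n0 nf f0.
have rF : rearr mu setT (f \o @vol R n) = rearr lam HL f by exact: (rearr_uniform measurableT us).
have nwh : nincr (wt h) by exact: nincr_weighted_tail.
have wh0 t : (0 < t)%R -> 0 <= wt h t by exact: weighted_tail_ge0.
have mf : measurable_fun HL f by exact: measurable_nincr.
have nwf : nincr (wt f) by exact: nincr_weighted_tail.
have wf0 t : (0 < t)%R -> 0 <= wt f t by exact: weighted_tail_ge0.
have wE t : (0 < t)%R -> wt (rearr lam HL f) t = wt f t.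
  move=> t0; rewrite (weighted_tailE _ _ t0) (weighted_tailE _ f t0); apply: eq_integral => s.
  rewrite inE => -[]; rewrite halflineE => s0 _; congr (_ * _).
  exact: rearr_rcont_nincr.
have Mwr : nonneg_meas_funs HL (wt (rearr lam HL f)).
  apply: Mp_nincr.
    by apply: nincr_weighted_tail; [exact: measurable_rearr|move=> *; exact: rearr_ge0].
  by move=> t t0; rewrite wE// wf0.
rewrite -(ri_space_normE ri' (Mp_nincr nwh wh0)).
apply: (@le_trans _ _ (C%:E * ri_space_norm rhobar' (wt (rearr mu setT (f \o @vol R n))))).
  apply: le_trans (tail_le MF); apply: ereal_sup_ubound; exists h => //; split=> //.
  by move=> t t0; rewrite hf rF.
rewrite rF (ri_space_normE ri' Mwr); apply: lee_wpmul2l; first by rewrite lee_fin ltW.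
by apply: (ri_norm_le_on ri' Mwr (Mp_nincr nwf wf0)) => t; rewrite halflineE => /wE ->.
Qed.

(** The norm of the step is evaluated through a norming functional [phi]. Summation
    by parts turns [\sum_i phi i * G i] into a sum of [c j] times integrals of
    [supop al g] over [(0, a j)], which are bounded by [a j `^ (1 - al)] times the
    majorant of [avg al g]; the resulting sum is a pairing of [avg al g] with a
    rearrangement [h] of the stair function [f]. *)
Lemma supop_dyadic_norm_le (g : R1_type R -> \bar R) (L N : nat) : nincr g -> rcont g ->
  (forall t : R, (0 < t)%R -> 0 <= g t) -> rhobar g < +oo ->
  rhobar (gstep (mesh R L) val (fun i : 'I_N => dyadic_val (supop al g) L i)) <=
  (8 * (2 + 3 / (1 - al)) * (C / al))%:E * rhobar g.
Proof.
move=> ng rg g0 gy; set d := mesh R L; have d0 : (0 < d)%R := mesh_gt0 R L.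
have ri := repr.1; have ri' := repr'.1; have mHL := @measurable_halfline R.
pose T := supop al g; have nT : nincr T by exact: nincr_supop.
have T0 t : (0 < t)%R -> 0 <= T t by exact: supop_ge0.
pose G k := dyadic_val T L k.
have G0 k : (0 <= G k)%R by exact: dyadic_val_ge0.
have dG k l : (k <= l)%N -> (G l <= G k)%R by exact: dyadic_val_nincr.
have [phi [phi0 dphi phi_out phi_le phi_G]] := norming_step ri N d0 G0 dG.
apply: (le_trans phi_G).
pose a (j : nat) : R := (j.+1%:R * d)%R.
have a0 j : (0 < a j)%R by rewrite mulr_gt0.
pose c j : R := ((phi j - phi j.+1) / d)%R.
have c0 j : (0 <= c j)%R by rewrite divr_ge0 ?(ltW d0)// subr_ge0 dphi.
pose u j : R := (c j * (a j) `^ (- al))%R.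
have u0 j : (0 <= u j)%R by rewrite mulr_ge0 ?powR_ge0.
pose w (k : nat) : R := (\sum_(j < N | (k <= j)%N) u j)%R.
have w0 k : (0 <= w k)%R by rewrite sumr_ge0.
have dw k l : (k <= l)%N -> (w l <= w k)%R.
  move=> kl; rewrite /w big_mkcond [leRHS]big_mkcond/=; apply: ler_sum => j _.
  by case: ifP => [lj|_]; [rewrite (leq_trans kl lj)|case: ifP].
pose f := gstep d val (fun i : 'I_N => w i).
have nf : nincr f by exact: nincr_gstep.
have rf : rcont f by exact: rcont_gstep.
have f0 t : 0 <= f t by exact: gstep_ge0.
(* [phi i / d] is the sum of the [c j] with [j >= i], so that [wt f] is at most
   [al^-1] times the dual step of norm at most 1 *)
have wf1 : rhobar' (wt f) <= (al^-1)%:E.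
  have tele k : (\sum_(j < N | (k <= j)%N) c j = phi k / d)%R.
    have [kN|Nk] := leqP k N; last first.
      rewrite big1 ?(phi_out _ (ltnW Nk)) ?mul0r// => j kj.
      by move: Nk; rewrite ltnNge (leq_trans kj (ltnW (ltn_ord j))).
    rewrite -(big_geq_mkord k N xpredT c)/= /c -mulr_suml; congr (_ / _)%R.
    transitivity (- (phi N - phi k))%R; last by rewrite phi_out// sub0r opprK.
    by rewrite -(telescope_sumr phi kN) -sumrN; apply: eq_bigr => i _; rewrite opprB.
  have Mdual : nonneg_meas_funs HL (dual_step L N phi).
    by apply: Mp_gstep => // i; rewrite divr_ge0// ltW.
  have mwf : measurable_fun HL f by exact: measurable_nincr.
  have Mwf : nonneg_meas_funs HL (wt f).
    apply: Mp_nincr; first exact: nincr_weighted_tail.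
    by move=> t t0; apply: weighted_tail_ge0.
  have Md : nonneg_meas_funs HL (fun t => (al^-1)%:E * dual_step L N phi t).
    split; first by apply: emeasurable_funM; [exact: measurable_cst|case: Mdual].
    by move=> t tH; apply: mule_ge0; [rewrite lee_fin invr_ge0 ltW|case: Mdual => _; exact].
  apply: (@le_trans _ _ (rhobar' (fun t => (al^-1)%:E * dual_step L N phi t))).
    apply: (ri_norm_le_on ri' Mwf Md) => t; rewrite halflineE => t0.
    apply: le_trans (weighted_tail_stairs al0 N d0 c0 t0) _.
    rewrite le_eqVlt; apply/orP; left; apply/eqP; congr (_ * gstep _ _ _ _).
    by apply/funext => i; exact: tele.
  rewrite (ri_normZ ri')//; last by rewrite invr_ge0 ltW.
  rewrite -[leRHS]mule1; apply: lee_wpmul2l; first by rewrite lee_fin invr_ge0 ltW.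
  exact: (dual_step_norm n0 repr repr' phi0 dphi phi_le).
(* the majorant of the mean may be infinite; the cap is large enough for the
   bound on the sums of [G], whose values are at most [L] *)
pose cap : \bar R := (L%:R * (a N) `^ al)%:E.
pose B k : R := fine (Order.min (sup_avg al g (a k)) cap).
have cap0 : 0 <= cap by rewrite lee_fin mulr_ge0 ?powR_ge0.
have S0 k : 0 <= sup_avg al g (a k) by exact: sup_avg_ge0.
have BE k : (B k)%:E = Order.min (sup_avg al g (a k)) cap.
  rewrite fineK// ge0_fin_numE; last by rewrite le_min S0.
  by rewrite gt_min ltry orbT.
have B0 k : (0 <= B k)%R by rewrite -lee_fin BE le_min S0.
have BS k : (B k)%:E <= sup_avg al g (a k) by rewrite BE ge_min lexx.
have dB k l : (k <= l)%N -> (B l <= B k)%R.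
  move=> kl; rewrite -lee_fin !BE le_min !ge_min lexx orbT andbT; apply/orP; left.
  by apply: nincr_sup_avg => //; rewrite ler_pM2r// ler_nat.
have [e ie eB] := separated_cells al0 al1 ng g0 N d0 B0 BS.
pose h := gstep d e (fun i : 'I_N => w i).
have Mh : nonneg_meas_funs HL h by exact: Mp_gstep.
have hf : rearr lam HL h = rearr lam HL f by exact: rearr_gstep.
have wh : rhobar' (wt h) <= (C / al)%:E.
  apply: le_trans (tail_rearrangement_le nf rf (fun t _ => f0 t) Mh hf) _.
  by rewrite EFinM; apply: lee_wpmul2l => //; rewrite lee_fin ltW.
have h0 t : (0 < t)%R -> 0 <= h t by move=> _; exact: gstep_ge0.
have nwh : nincr (wt h) by apply: nincr_weighted_tail => //; case: Mh.
have wh0 t : (0 < t)%R -> 0 <= wt h t by apply: weighted_tail_ge0 => //; case: Mh.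
have mg : measurable_fun HL g by exact: measurable_nincr.
have pair_le : \int[lam]_(t in HL) (g t * wt h t) <= (C / al)%:E * rhobar g.
  apply: (le_trans (repr_holder n0 ri_rho repr repr' ng nwh g0 wh0 gy)).
  by apply: lee_wpmul2r wh; exact: (ri_norm_ge0 ri (Mp_nincr ng g0)).
have pair_ge : (\sum_(i < N) w i * (B i / 8 * d))%R%:E <= \int[lam]_(t in HL) (g t * wt h t).
  rewrite (weighted_tail_dual _ Mh.1 h0 mg g0).
  have mavg : measurable_fun HL (avg al g).
    by apply: emeasurable_funM; [exact: measurable_powR_R1|exact: measurable_prim].
  have avg0 t : (0 < t)%R -> 0 <= avg al g t by move=> _; exact: avg_ge0.
  have -> : \int[lam]_(s in HL) (h s * ((s : R) `^ (al - 1))%:E * prim g s) =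
      \int[lam]_(s in HL) (h s * avg al g s).
    by apply: eq_integral => s _; rewrite -muleA.
  rewrite (integral_gstep d0 e (fun i : 'I_N => w0 i) mavg avg0) -sumEFin.
  apply: lee_sum => i _; rewrite EFinM; apply: lee_wpmul2l; first by rewrite lee_fin.
  apply: (@le_trans _ _ (\int[lam]_(t in cell d (e i)) (B i / 8)%:E)).
    rewrite (integral_cst lam (measurable_cell _ d0)) EFinM; apply: lee_wpmul2l.
      by rewrite lee_fin divr_ge0.
    by rewrite le_eqVlt; apply/orP; left; apply/eqP/esym; exact: lam_cell.
  apply: nn_le_integral => t tc; first by rewrite lee_fin divr_ge0.
  exact: eB.
have key j : (j < N)%N ->
    (d * \sum_(i < j.+1) G i <= (2 + 3 / (1 - al)) * ((a j) `^ (1 - al) * B j))%R.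
  move=> jN; pose s := (d * \sum_(i < j.+1) G i)%R.
  have s0 : (0 <= s)%R by rewrite mulr_ge0 ?sumr_ge0// ltW.
  have sT : s%:E <= prim T (a j).
    have -> : s%:E = \int[lam]_(t in HL) (gstep d val (fun i : 'I_j.+1 => G i) t * cst 1 t).
      rewrite integral_gstep// /s mulr_sumr -sumEFin; apply: eq_bigr => i _.
      rewrite (integral_cst lam (measurable_cell _ d0)) mul1e mulrC EFinM; congr (_ * _).
      by apply/esym; exact: lam_cell.
    rewrite /prim integral_mkcondr; apply: nn_le_integral => t; rewrite halflineE => t0.
      by rewrite mule1 gstep_ge0.
    rewrite mule1; apply: gstep_le t0 => //.
    - by move=> v v0; rewrite /patch; case: ifP => // _; exact: T0.
    - move=> i v v0 vi; rewrite /patch mem_set.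
        by apply: dyadic_val_le_slot.
      by rewrite /= /a -slot_le// vi -ltnS; exact: ltn_ord.
  have aa : (0 <= a j `^ (1 - al))%R by exact: powR_ge0.
  rewrite -lee_fin -/s [leRHS]EFinM [X in _ <= _ * X]EFinM BE; case: (leP (sup_avg al g (a j)) cap) => _.
    exact: (le_trans sT (prim_supop_le al0 al1 ng g0 (a0 j))).
  rewrite -!EFinM lee_fin.
  apply: (@le_trans _ _ (a j * L%:R)%R).
    have -> : (a j * L%:R = d * (j.+1%:R * L%:R))%R by rewrite /a; ring.
    apply: ler_wpM2l; first exact: ltW.
    apply: le_trans (ler_sum _ (fun (i : 'I_j.+1) _ => dyadic_val_le T0 L i)) _.
    by rewrite sumr_const card_ord mulr_natl.
  have aE : (a j = a j `^ (1 - al) * a j `^ al)%R.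
    by rewrite -powRD ?subrK ?powRr1 ?(ltW (a0 j))// (gt_eqF (a0 j)) implybT.
  have aN : (a j `^ al <= a N `^ al)%R.
    apply: ge0_ler_powR; rewrite ?nnegrE ?(ltW (a0 _)) ?(ltW al0)//.
    by rewrite ler_pM2r// ler_nat ltnS ltnW.
  apply: (@le_trans _ _ (1 * (a j `^ (1 - al) * (L%:R * a N `^ al)))%R); last first.
    apply: ler_wpM2r; first by rewrite !mulr_ge0 ?powR_ge0.
    by rewrite -[leLHS]addr0 lerD ?ler1n// divr_ge0// subr_ge0 ltW.
  rewrite mul1r {1}aE -mulrA; apply: ler_wpM2l => //.
  by rewrite mulrC; apply: ler_wpM2l.
have K0 : (0 <= 2 + 3 / (1 - al))%R by rewrite addr_ge0// divr_ge0// subr_ge0 ltW.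
apply: (@le_trans _ _ ((8 * (2 + 3 / (1 - al)))%:E * (\sum_(i < N) w i * (B i / 8 * d))%R%:E)).
  rewrite -EFinM lee_fin.
  rewrite (abel_sum G (phi_out _ (leqnn N))).
  have -> : (\sum_(i < N) w i * (B i / 8 * d) = d / 8 * \sum_(j < N) u j * \sum_(i < j.+1) B i)%R.
    rewrite mulr_sumr; under eq_bigr => i _ do rewrite /w mulr_suml big_mkcond/=.
    rewrite exchange_big/=; apply: eq_bigr => j _.
    rewrite (big_ord_widen N B (ltn_ord j)) !mulr_sumr [RHS]big_mkcond/=.
    by apply: eq_bigr => i _; rewrite ltnS; case: ifP => // _; ring.
  rewrite !mulr_sumr; apply: ler_sum => j _.
  have SB : (j.+1%:R * B j <= \sum_(i < j.+1) B i)%R.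
    apply: le_trans (_ : \sum_(i < j.+1) B j <= _)%R.
      by rewrite sumr_const card_ord mulr_natl.
    by apply: ler_sum => i _; apply: dB; rewrite -ltnS.
  have -> : (phi j - phi j.+1 = c j * d)%R by rewrite divfK// gt_eqF.
  have aE : (a j `^ (1 - al) = a j `^ (- al) * a j)%R.
    by rewrite -[X in (_ * X)%R]powRr1 ?(ltW (a0 j))// -powRD 1?addrC// (gt_eqF (a0 j)) implybT.
  rewrite -mulrA; apply: le_trans (ler_wpM2l (c0 j) (key _ (ltn_ord j))) _.
  rewrite aE.
  have -> : (c j * ((2 + 3 / (1 - al)) * (a j `^ (- al) * a j * B j)) =
      (2 + 3 / (1 - al)) * (u j * d) * (j.+1%:R * B j))%R by rewrite /u {2}/a; ring.
  have -> : (8 * (2 + 3 / (1 - al)) * (d / 8 * (u j * \sum_(i < j.+1) B i)) =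
      (2 + 3 / (1 - al)) * (u j * d) * \sum_(i < j.+1) B i)%R.
    by field; rewrite gt_eqF// subr_gt0.
  apply: ler_wpM2l SB; apply: mulr_ge0; first exact: K0.
  by apply: mulr_ge0; [exact: u0|exact: ltW].
rewrite [X in _ <= X * _]EFinM -muleA; apply: lee_wpmul2l.
  by rewrite lee_fin mulr_ge0.
exact: le_trans pair_ge pair_le.
Qed.

End sufficiency.

(** Exhaustion of a nonincreasing function by finitely supported steps: the
    Fatou property reduces a norm estimate to them. *)
Lemma norm_le_dyadic (R : realType) (rho : (R1_type R -> \bar R) -> \bar R)
    (G : R1_type R -> \bar R) (c : \bar R) :
  ri_norm lam (@halfline R) rho -> nincr G -> rcont G ->
  (forall t : R, (0 < t)%R -> 0 <= G t) ->
  (forall L N, rho (gstep (mesh R L) val (fun i : 'I_N => dyadic_val G L i)) <= c) ->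
  rho G <= c.
Proof.
move=> ri nG rG G0 h.
pose F (m : nat) := gstep (mesh R m) val (fun i : 'I_(4 ^ m) => dyadic_val G m i).
have FE m (t : R) : (0 < t)%R -> F m t = if (t < 2 ^+ m)%R then dyadic G m t else 0.
  move=> t0; rewrite /F (gstep_ord _ _ (dyadic_val G m)).
  rewrite ltnNge slot_ge ?mesh_gt0 ?(ltW t0)// -ltNge natrX /mesh.
  by rewrite (_ : (4%:R ^+ m / 2 ^+ m = 2 ^+ m :> R)%R)// -expr_div_n; congr (_ ^+ m)%R; field.
have MF m : nonneg_meas_funs (@halfline R) (F m).
  by apply: Mp_gstep => [|i]; [exact: mesh_gt0|exact: dyadic_val_ge0].
have [_ cF] : nondecreasing_seq (rho \o F) /\ rho \o F @ \oo --> rho G.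
  apply: (ri_norm_fatou ri) => //; first exact: Mp_nincr.
  apply: aeW => t; rewrite halflineE => t0; split.
    apply/nondecreasing_seqP => m; rewrite !FE//; case: ifPn => [tm|_].
      rewrite (lt_le_trans tm); first by rewrite (nondecreasing_dyadic nG G0 t0).
      by rewrite exprS ler_peMl ?exprn_ge0// ler1n.
    by case: ifP => // _; exact: dyadic_ge0.
  apply: cvg_trans (cvg_dyadic nG rG G0 t0); apply: near_eq_cvg.
  near=> m; rewrite FE// ifT//.
  apply: (@lt_trans _ _ (Num.truncn t).+1%:R); first exact: truncnS_gt.
  rewrite -natrX ltr_nat; apply: (@leq_ltn_trans m); last exact: ltn_expl.
  by near: m; exact: nbhs_infty_ge.
rewrite -(cvg_lim _ cF)//; apply: lime_le; first by apply/cvg_ex; eexists; exact: cF.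
by apply: nearW => m; exact: h.
Unshelve. all: by end_near. Qed.

(** Both norms only see the rearrangement [g] of the argument. *)
Lemma tail_bounded_sup_operator (R : realType) (n : nat) (al : R)
    (rho : (Rn_type R n -> \bar R) -> \bar R)
    (rhobar rhobar' : (R1_type R -> \bar R) -> \bar R) :
  (0 < al)%R -> (al < 1)%R -> (0 < n)%N ->
  ri_norm (@Rn_lebesgue R n) setT rho -> representation_norm rho rhobar ->
  representation_norm (associate_norm (@Rn_lebesgue R n) setT rho) rhobar' ->
  (exists2 C : R, (0 < C)%R &
    forall f : Rn_type R n -> \bar R, nonneg_meas_funs setT f ->
      ereal_sup
        [set ri_space_norm rhobar' (weighted_tail (al - 1) h)
        | h in [set h : R1_type R -> \bar R |
                 nonneg_meas_funs (@halfline R) h /\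
                 equimeasurable lam (@halfline R) (@Rn_lebesgue R n) setT h f]]
      <= C%:E * ri_space_norm rhobar'
                  (weighted_tail (al - 1) (rearr (@Rn_lebesgue R n) setT f))) ->
  bounded_operator (@halfline R) rhobar rhobar (sup_operator al).
Proof.
move=> al0 al1 n0 ri_rho repr repr' [C C0 Cb].
have ri := repr.1; have mHL := @measurable_halfline R.
exists (8 * (2 + 3 / (1 - al)) * (C / al))%R.
  by rewrite !mulr_gt0 ?invr_gt0// addr_gt0// divr_gt0// subr_gt0.
move=> f [mf fy]; set g := rearr lam (@halfline R) f.
have gE : rhobar g = ri_space_norm rhobar f.
  rewrite /ri_space_norm (ri_norm_rearr ri (Mp_abs mf)); congr rhobar.
  by apply: rearr_distr => l _; rewrite /distr; under [in RHS]eq_fun do rewrite abse_id.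
have ng : nincr g by exact: nincr_rearr.
have rg : rcont g by exact: rcont_rearr.
have g0 t : (0 < t)%R -> 0 <= g t by move=> _; exact: rearr_ge0.
have nT : nincr (supop al g) by exact: nincr_supop.
have T0 t : (0 < t)%R -> 0 <= supop al g t by exact: supop_ge0.
have -> : sup_operator al f = supop al g by [].
rewrite (ri_space_normE ri (Mp_nincr nT T0)) -gE.
apply: (norm_le_dyadic ri nT) => //; first exact: rcont_supop.
move=> L N; apply: (supop_dyadic_norm_le al0 al1 n0 ri_rho repr repr' C0 Cb) => //.
by rewrite gE.
Qed.

Theorem theorem4p7 (R : realType) (n : nat) (gamma : R)
    (rho : (Rn_type R n -> \bar R) -> \bar R)
    (rhobar rhobar' : (R1_type R -> \bar R) -> \bar R)
    (gamma_gt0 : (0 < gamma)%R) (gamma_ltn : (gamma < n%:R)%R)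
    (ri_rho : ri_norm (@Rn_lebesgue R n) setT rho)
    (repr_rho : representation_norm rho rhobar)
    (repr_rho' :
      representation_norm (associate_norm (@Rn_lebesgue R n) setT rho) rhobar') :
  bounded_operator (@halfline R) rhobar rhobar (sup_operator (gamma / n%:R))
  <->
  (exists2 C : R, (0 < C)%R &
    forall f : Rn_type R n -> \bar R, nonneg_meas_funs setT f ->
      ereal_sup
        [set ri_space_norm rhobar' (weighted_tail (gamma / n%:R - 1) h)
        | h in [set h : R1_type R -> \bar R |
                 nonneg_meas_funs (@halfline R) h /\
                 equimeasurable (@completed_lebesgue_measure R) (@halfline R)
                   (@Rn_lebesgue R n) setT h f]]
      <= C%:E * ri_space_norm rhobar'
           (weighted_tail (gamma / n%:R - 1) (rearr (@Rn_lebesgue R n) setT f))).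
Proof.
have nR0 : (0 < n%:R :> R)%R by exact: lt_trans gamma_ltn.
have n0 : (0 < n)%N by rewrite -(ltr0n R).
have al0 : (0 < gamma / n%:R)%R by rewrite divr_gt0.
have al1 : (gamma / n%:R < 1)%R by rewrite ltr_pdivrMr// mul1r.
split; first exact: (bounded_sup_operator_tail al0 al1 n0 ri_rho repr_rho repr_rho').
exact: (tail_bounded_sup_operator al0 al1 n0 ri_rho repr_rho repr_rho').
Qed.
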